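(* Let $(G,c,\boldsymbol{b})$ be an instance of the robust transshipment problem under consistent flow constraints on an SP digraph $G$ with a unique source and parallel sinks. The label-tree algorithm described in the context computes an optimal robust $\boldsymbol{b}$-flow in $\mathcal{O}(|V(G)|^2+|V(G)|\cdot|A(G)|)$ time.
   Context: An instance $(G,c,\boldsymbol{b})$ of the robust transshipment problem under consistent flow constraints consists of: a (multi-)digraph $G=(V,A)$, with $V(G)=V$ and $A(G)=A$, whose arc set is divided into two disjoint sets, $A=A^{\mathrm{fix}}\cup A^{\mathrm{free}}$ (fixed and free arcs); an arc cost $c:A\to\mathbb{Z}_{\ge 0}$; a finite set of scenarios $\Lambda$; and for each $\lambda\in\Lambda$ vertex balances $b^\lambda:V\to\mathbb{Z}$ with $\sum_{v\in V}b^\lambda(v)=0$; write $\boldsymbol{b}=(b^1,\ldots,b^{|\Lambda|})$. There are no arc capacities. For $\lambda\in\Lambda$, a $b^\lambda$-flow is a function $f^\lambda:A\to\mathbb{Z}_{\ge 0}$ with $\sum_{a=(v,w)\in A}f^\lambda(a)-\sum_{a=(w,v)\in A}f^\lambda(a)=b^\lambda(v)$ for every $v\in V$; its cost is $c(f^\lambda)=\sum_{a\in A}c(a)\cdot f^\lambda(a)$. A robust $\boldsymbol{b}$-flow is a tuple $\boldsymbol{f}=(f^1,\ldots,f^{|\Lambda|})$ of $b^\lambda$-flows such that $f^\lambda(a)=f^{\lambda'}(a)$ for all $a\in A^{\mathrm{fix}}$ and all $\lambda,\lambda'\in\Lambda$; its cost is $c(\boldsymbol{f})=\max_{\lambda\in\Lambda}c(f^\lambda)$.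 It is optimal if it has minimum cost among all robust $\boldsymbol{b}$-flows. A vertex with positive (negative) balance is a source (sink) of the respective scenario. The instance has a unique source $s$ if each scenario has only one vertex with positive balance and this vertex is $s$ in all scenarios. It has parallel sinks if there is no path between any two sinks; each scenario may have several sinks. The sinks of scenario $\lambda$ are denoted $t^\lambda_1,\ldots,t^\lambda_{\gamma_t(\lambda)}$. An analogous definition applies to a unique sink. SP (series-parallel) digraphs are defined recursively: (1) a single arc $(o,q)$ is an SP digraph with origin $o$ and target $q$; (2) if $G_1$ (origin $o_1$, target $q_1$) and $G_2$ (origin $o_2$, target $q_2$) are SP digraphs, then so are their series composition (contract $q_1$ with $o_2$; origin $o_1$, target $q_2$) and their parallel composition (contract $o_1$ with $o_2$ to the origin and $q_1$ with $q_2$ to the target). SP digraphs may have parallel arcs. Without loss of generality, $s$ is the origin of $G$. For vertices $v,w$ for which a $(v,w)$-path exists, the subgraph $G_{vw}$ spanned by $v,w$ is the subgraph of $G$ induced by all vertices $x$ for which both a $(v,x)$-path and an $(x,w)$-path exist; it is an SP digraph with origin $v$ and target $w$. The label of a vertex $v$ is $\pi(v)=\{t\in V(G)\mid t \text{ is a sink and there exists a } (v,t)\text{-path}\}$. Labels $\pi(v),\pi(w)$ are $(v,w)$-consecutive if $\pi(w)\subsetneq\pi(v)$ and there is no vertex $z\in V(G)$ with $\pi(w)\subsetneq\pi(z)\subsetneq\pi(v)$. A vertex $v$ is a last vertex (of label $\pi(v)$) if $\pi(v)\neq\emptyset$ and for each vertex $w$ with an arc $(v,w)\in A(G)$ the labels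 $\pi(v),\pi(w)$ are $(v,w)$-consecutive. The label tree $T^\pi$ is the directed tree, with root $s$ and with the sinks as leaves, defined by $V(T^\pi)=\{s\}\cup\{v\in V(G)\mid v\text{ is a last vertex}\}$ and $A(T^\pi)=\{(s,w)\mid w\in V(T^\pi)\text{ and }\pi(s)=\pi(w)\}\cup\{(v,w)\mid v,w\in V(T^\pi)\text{ and }\pi(v),\pi(w)\text{ are }(v,w)\text{-consecutive}\}$. For $\lambda\in\Lambda$ and $v\in V(G)$ let $\beta^\lambda(v)=\sum_{t\in\pi(v)\cap\{t^\lambda_1,\ldots,t^\lambda_{\gamma_t(\lambda)}\}}|b^\lambda(t)|$. The label-tree algorithm: (1) Construct the label tree $T^\pi$. (2) For every arc $(v,w)\in A(T^\pi)$, consider the unique source, unique sink instance $\mathcal{I}_{vw}=(G_{vw},c,\boldsymbol{b_{vw}})$ on $G_{vw}$, where the arc cost $c$ remains equal and the balances are, for $\lambda\in\Lambda$, $b^\lambda_{vw}(v)=\beta^\lambda(w)$, $b^\lambda_{vw}(w)=-\beta^\lambda(w)$ and $b^\lambda_{vw}(u)=0$ for all other vertices $u$ of $G_{vw}$; compute an optimal robust $\boldsymbol{b_{vw}}$-flow $\boldsymbol{f_{vw}}=(f^1_{vw},\ldots,f^{|\Lambda|}_{vw})$ for $\mathcal{I}_{vw}$ such that every feasible robust $\boldsymbol{b_{vw}}$-flow $\boldsymbol{\tilde f}$ satisfies $c(f^\lambda_{vw})\le c(\tilde f^\lambda)$ for all $\lambda\in\Lambda$. (3) Return $\boldsymbol{f}=\sum_{(v,w)\in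 A(T^\pi)}\boldsymbol{f_{vw}}$. The flow in step (2) is obtained as follows. Let $m=\min_{\lambda\in\Lambda}\beta^\lambda(w)$, let $p^{\mathrm{free}}$ be a shortest $(v,w)$-path (with respect to $c$) in $G_{vw}-A^{\mathrm{fix}}$ and $p^{\mathrm{fix}}$ a shortest $(v,w)$-path in $G_{vw}$; $A(p)$ is the arc set and $c(p)$ the cost of a path $p$. If $c(p^{\mathrm{fix}})<c(p^{\mathrm{free}})$, set for every $\lambda$: $f^\lambda_{vw}(a)=m$ for $a\in A(p^{\mathrm{fix}})\setminus A(p^{\mathrm{free}})$, $f^\lambda_{vw}(a)=\beta^\lambda(w)-m$ for $a\in A(p^{\mathrm{free}})\setminus A(p^{\mathrm{fix}})$, $f^\lambda_{vw}(a)=\beta^\lambda(w)$ for $a\in A(p^{\mathrm{fix}})\cap A(p^{\mathrm{free}})$, and $0$ otherwise. Else set $f^\lambda_{vw}(a)=\beta^\lambda(w)$ for $a\in A(p^{\mathrm{free}})$ and $0$ otherwise.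
   Formalization: Label tree mended: no loop at s; a consecutive tree arc (v,w) needs v to be a last vertex; last vertices ignore arcs to vertices with empty label. Optimality is claimed for feasible instances. The time bound carries a factor |Λ|, the number of scenarios. *)

(* Defs.v *)
From HB Require Import structures.
From mathcomp Require Import all_boot all_order all_algebra.

Set Implicit Arguments.
Unset Strict Implicit.
Unset Printing Implicit Defensive.

Import Order.TTheory GRing.Theory Num.Theory.

Record digraph := Digraph {
  verts : finType;
  arcs : finType;
  src : arcs -> verts;
  tgt : arcs -> verts
}.

Definition adj (G : digraph) : rel (verts G) :=
  [rel x y | [exists a : arcs G, (src a == x) && (tgt a == y)]].

Definition reaches (G : digraph) (x y : verts G) : bool := connect (@adj G) x y.

(* A path is given by its arcs, so parallel arcs are distinguished. *)
Fixpoint is_walk (G : digraph) (v w : verts G) (p : seq (arcs G)) : bool :=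
  if p is a :: p' then (src a == v) && is_walk (tgt a) w p' else v == w.

Definition is_path (G : digraph) (v w : verts G) (p : seq (arcs G)) : bool :=
  is_walk v w p && uniq (v :: [seq tgt a | a <- p]).

Definition induced (G : digraph) (X : {set verts G}) : digraph :=
  @Digraph {x : verts G | x \in X}
           {a : arcs G | (src a \in X) && (tgt a \in X)}
           (fun a => exist _ (src (val a)) (proj1 (andP (valP a))))
           (fun a => exist _ (tgt (val a)) (proj2 (andP (valP a)))).

Definition between (G : digraph) (v w : verts G) : {set verts G} :=
  [set x | reaches v x && reaches x w].

Definition spanned (G : digraph) (v w : verts G) : digraph :=
  induced (between v w).

(* [G] is, up to isomorphism, the disjoint union of [G1] and [G2] in which
   [x : verts G1] is contracted with [y : verts G2] exactly when [R x y];
   [h1] and [h2] are the resulting maps on vertices. *)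
Definition gluing (G1 G2 G : digraph) (R : verts G1 -> verts G2 -> Prop)
    (h1 : verts G1 -> verts G) (h2 : verts G2 -> verts G) : Prop :=
  [/\ injective h1,
      injective h2,
      (forall x y, h1 x = h2 y <-> R x y),
      (forall v, (exists x, v = h1 x) \/ (exists y, v = h2 y)) &
      exists k : arcs G1 + arcs G2 -> arcs G,
        [/\ bijective k,
            (forall a, src (k (inl a)) = h1 (src a)),
            (forall a, tgt (k (inl a)) = h1 (tgt a)),
            (forall a, src (k (inr a)) = h2 (src a)) &
            (forall a, tgt (k (inr a)) = h2 (tgt a))]].

Inductive sp_digraph : forall G : digraph, verts G -> verts G -> Prop :=
| sp_arc (G : digraph) (o q : verts G) (a : arcs G) :
    o <> q ->
    (forall v : verts G, v = o \/ v = q) ->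
    (forall b : arcs G, b = a) ->
    src a = o -> tgt a = q ->
    sp_digraph o q
| sp_series (G1 G2 G : digraph) (o1 q1 : verts G1) (o2 q2 : verts G2)
    (h1 : verts G1 -> verts G) (h2 : verts G2 -> verts G) :
    sp_digraph o1 q1 -> sp_digraph o2 q2 ->
    gluing (fun x y => x = q1 /\ y = o2) h1 h2 ->
    sp_digraph (h1 o1) (h2 q2)
| sp_parallel (G1 G2 G : digraph) (o1 q1 : verts G1) (o2 q2 : verts G2)
    (h1 : verts G1 -> verts G) (h2 : verts G2 -> verts G) :
    sp_digraph o1 q1 -> sp_digraph o2 q2 ->
    gluing (fun x y => (x = o1 /\ y = o2) \/ (x = q1 /\ y = q2)) h1 h2 ->
    sp_digraph (h1 o1) (h1 q1).

(* The free arcs are the complement of [fixed]. *)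
Record instance (G : digraph) (L : finType) := Instance {
  fixed : {set arcs G};
  cost : arcs G -> nat;
  bal : L -> verts G -> int
}.

Section Problem.
Variables (G : digraph) (L : finType) (I : instance G L).

Definition balanced : Prop :=
  forall l : L, (\sum_(v : verts G) bal I l v = 0)%R.

Definition is_flow (b : verts G -> int) (f : arcs G -> nat) : Prop :=
  forall v : verts G,
    ((\sum_(a : arcs G | src a == v) f a)%N%:Z
       - (\sum_(a : arcs G | tgt a == v) f a)%N%:Z = b v)%R.

Definition flow_cost (f : arcs G -> nat) : nat :=
  \sum_(a : arcs G) cost I a * f a.

Definition robust_flow (f : L -> arcs G -> nat) : Prop :=
  (forall l, is_flow (bal I l) (f l)) /\
  (forall a, a \in fixed I -> forall l l', f l a = f l' a).

Definition robust_cost (f : L -> arcs G -> nat) : nat :=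
  \max_(l : L) flow_cost (f l).

Definition feasible : Prop := exists f, robust_flow f.

Definition optimal (f : L -> arcs G -> nat) : Prop :=
  robust_flow f /\ forall g, robust_flow g -> robust_cost f <= robust_cost g.

Definition scenariowise_optimal (f : L -> arcs G -> nat) : Prop :=
  optimal f /\
  forall g, robust_flow g -> forall l, flow_cost (f l) <= flow_cost (g l).

Definition is_sink (l : L) (t : verts G) : bool := (bal I l t < 0)%R.

Definition sinks : {set verts G} := [set t | [exists l, is_sink l t]].

Definition unique_source (s : verts G) : Prop :=
  forall (l : L) (v : verts G), (0 < bal I l v)%R = (v == s).

Definition parallel_sinks : Prop :=
  forall t t' : verts G, t \in sinks -> t' \in sinks -> t != t' ->
    ~~ reaches t t'.

Definition label (v : verts G) : {set verts G} := [set t in sinks | reaches v t].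

Definition consecutive (v w : verts G) : bool :=
  (label w \proper label v) &&
  ~~ [exists z, (label w \proper label z) && (label z \proper label v)].

(* Successors with an empty label never carry flow and are disregarded: an arc
   from [v] to such a dead end must not prevent [v] from being the branching
   vertex of its label. *)
Definition last_vertex (v : verts G) : bool :=
  (label v != set0) &&
  [forall a : arcs G, (src a == v) && (label (tgt a) != set0)
                       ==> consecutive v (tgt a)].

Definition tree_vertex (s v : verts G) : bool := (v == s) || last_vertex v.

(* For this to be a tree, the loop at [s] is left out, and the children of a
   label hang below its last vertex only: if [s] is not a last vertex, its only
   child is the last vertex with the label of [s]. *)
Definition tree_arc (s v w : verts G) : bool :=
  [&& v == s, tree_vertex s w, w != s & label s == label w] ||
  [&& last_vertex v, tree_vertex s w & consecutive v w].

Definition beta (l : L) (v : verts G) : nat :=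
  \sum_(t in label v | is_sink l t) `|bal I l t|%N.

Definition path_cost (p : seq (arcs G)) : nat := \sum_(a <- p) cost I a.

Definition shortest_path (B : {set arcs G}) (v w : verts G) (p : seq (arcs G)) :
    Prop :=
  (is_path v w p && all (mem B) p) /\
  forall q, is_path v w q && all (mem B) q -> path_cost p <= path_cost q.

(* [None] means that there is no path, i.e. cost [+oo]. *)
Definition shortest_path_opt (B : {set arcs G}) (v w : verts G)
    (op : option (seq (arcs G))) : Prop :=
  if op is Some p then shortest_path B v w p
  else forall q, ~~ (is_path v w q && all (mem B) q).

(* The flow sending [d l] units in scenario [l] along the two paths.  The bigop
   below is the minimum of [d], provided [L] is nonempty. *)
Definition two_path_flow (d : L -> nat) (pfix : seq (arcs G))
    (opfree : option (seq (arcs G))) (l : L) (a : arcs G) : nat :=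
  let d0 := \max_(l1 : L) d l1 in
  let m := \big[minn/d0]_(l1 : L) d l1 in
  let pfree := odflt [::] opfree in
  if (if opfree is Some p then path_cost pfix < path_cost p else true) then
    if (a \in pfix) && (a \notin pfree) then m
    else if (a \in pfree) && (a \notin pfix) then d l - m
    else if (a \in pfix) && (a \in pfree) then d l
    else 0
  else if a \in pfree then d l else 0.

Definition unique_sink_step (d : L -> nat) (v w : verts G)
    (f : L -> arcs G -> nat) : Prop :=
  exists pfix opfree,
    [/\ shortest_path setT v w pfix,
        shortest_path_opt (~: fixed I) v w opfree &
        forall l a, f l a = two_path_flow d pfix opfree l a].

End Problem.

Section Algorithm.
Variables (G : digraph) (L : finType) (I : instance G L).

Definition sub_instance (v w : verts G) : instance (spanned v w) L :=
  {| fixed := [set a : arcs (spanned v w) | val a \in fixed I];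
     cost := fun a => cost I (val a);
     bal := fun l u =>
       if val u == v then ((beta I l w)%:Z)%R
       else if val u == w then (- (beta I l w)%:Z)%R else 0%R |}.

Definition step2 (v w : verts G) (f : L -> arcs (spanned v w) -> nat) : Prop :=
  exists o q : verts (spanned v w),
    [/\ val o = v, val q = w &
        unique_sink_step (sub_instance v w) (fun l => beta I l w) o q f].

Definition extend (v w : verts G) (f : arcs (spanned v w) -> nat) (a : arcs G) :
    nat :=
  if insub a is Some a' then f a' else 0.

(* [f] is a possible result of the label-tree algorithm; the only freedom is
   the choice among several shortest paths. *)
Definition label_tree_result (s : verts G) (f : L -> arcs G -> nat) : Prop :=
  exists F : forall v w : verts G, L -> arcs (spanned v w) -> nat,
    (forall v w, tree_arc I s v w -> step2 (F v w)) /\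
    (forall l a,
       f l a = \sum_(e : verts G * verts G | tree_arc I s e.1 e.2)
                 extend (F e.1 e.2 l) a).

End Algorithm.

(* A unit-cost random access machine, programmed by while-programs.  Words are
   integers, memory consists of banks indexed by naturals (a program only
   mentions finitely many of them), and an address is taken in absolute value.
   There is addition and subtraction but no multiplication.  Every constant,
   memory access, arithmetic operation, assignment and test takes one step. *)
Definition memory := nat -> nat -> int.

Inductive expr :=
| Lit (z : int)
| Cell (x : nat) (e : expr)
| Plus (e1 e2 : expr)
| Minus (e1 e2 : expr).

(* [If e1 e2 c1 c2] and [While e1 e2 c] test [e1 <= e2]. *)
Inductive cmd :=
| Skip
| Store (x : nat) (i e : expr)
| Seq (c1 c2 : cmd)
| If (e1 e2 : expr) (c1 c2 : cmd)
| While (e1 e2 : expr) (c : cmd).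

Fixpoint eval (M : memory) (e : expr) : int :=
  match e with
  | Lit z => z
  | Cell x e => M x `|eval M e|%N
  | Plus e1 e2 => (eval M e1 + eval M e2)%R
  | Minus e1 e2 => (eval M e1 - eval M e2)%R
  end.

Fixpoint eval_time (e : expr) : nat :=
  match e with
  | Lit _ => 1
  | Cell _ e => (eval_time e).+1
  | Plus e1 e2 | Minus e1 e2 => (eval_time e1 + eval_time e2).+1
  end.

Definition update (M : memory) (x i : nat) (z : int) : memory :=
  fun x' i' => if (x' == x) && (i' == i) then z else M x' i'.

(* [exec c M t M']: started in [M], [c] halts in [M'] after [t] steps. *)
Inductive exec : cmd -> memory -> nat -> memory -> Prop :=
| exec_skip M : exec Skip M 1 M
| exec_store M x i e :
    exec (Store x i e) M (eval_time i + eval_time e).+1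
         (update M x `|eval M i|%N (eval M e))
| exec_seq M1 M2 M3 c1 c2 t1 t2 :
    exec c1 M1 t1 M2 -> exec c2 M2 t2 M3 -> exec (Seq c1 c2) M1 (t1 + t2) M3
| exec_if_true M M' e1 e2 c1 c2 t :
    (eval M e1 <= eval M e2)%R -> exec c1 M t M' ->
    exec (If e1 e2 c1 c2) M (eval_time e1 + eval_time e2 + t).+1 M'
| exec_if_false M M' e1 e2 c1 c2 t :
    ~~ (eval M e1 <= eval M e2)%R -> exec c2 M t M' ->
    exec (If e1 e2 c1 c2) M (eval_time e1 + eval_time e2 + t).+1 M'
| exec_while_true M1 M2 M3 e1 e2 c t1 t2 :
    (eval M1 e1 <= eval M1 e2)%R ->
    exec c M1 t1 M2 -> exec (While e1 e2 c) M2 t2 M3 ->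
    exec (While e1 e2 c) M1 (eval_time e1 + eval_time e2 + t1 + t2).+1 M3
| exec_while_false M e1 e2 c :
    ~~ (eval M e1 <= eval M e2)%R ->
    exec (While e1 e2 c) M (eval_time e1 + eval_time e2).+1 M.

(* Vertices, arcs and scenarios are numbered by their rank in [enum].  Bank 0
   holds |V|, |A| and the number of scenarios; banks 1 to 4 hold, for each arc,
   its source, its target, its cost and whether it is fixed; bank 5 holds the
   balances, scenario by scenario.  All other cells are 0. *)
Definition input (G : digraph) (L : finType) (I : instance G L) : memory :=
  fun x i => nth 0%R (nth [::] [::
    [:: #|verts G|%:Z; #|arcs G|%:Z; #|L|%:Z];
    [seq (nat_of_ord (enum_rank (src a)))%:Z | a <- enum (arcs G)];
    [seq (nat_of_ord (enum_rank (tgt a)))%:Z | a <- enum (arcs G)];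
    [seq (cost I a)%:Z | a <- enum (arcs G)];
    [seq (nat_of_bool (a \in fixed I))%:Z | a <- enum (arcs G)];
    [seq bal I l v | l <- enum L, v <- enum (verts G)]]%R x) i.

(* Bank 6 holds the flow, scenario by scenario. *)
Definition outputs (G : digraph) (L : finType) (M : memory)
    (f : L -> arcs G -> nat) : Prop :=
  forall l a, M 6 (enum_rank l * #|arcs G| + enum_rank a) = (f l a)%:Z%R.

Definition computes_within (P : cmd) (G : digraph) (L : finType)
    (I : instance G L) (f : L -> arcs G -> nat) (T : nat) : Prop :=
  exists t M, [/\ exec P (input I) t M, outputs M f & t <= T].

(* Main.v *)
Require Import Defs.
From mathcomp Require Import all_boot all_order all_algebra.
From mathcomp Require Import zify ring.

Set Implicit Arguments.
Unset Strict Implicit.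
Unset Printing Implicit Defensive.

Import Order.TTheory GRing.Theory Num.Theory.

(** Why the algorithm is correct.  Call a vertex terminal if its label is
    nonempty and no arc leads from it to a vertex of the same label; these are
    the last vertices ([terminal_last]).  In a series-parallel digraph with
    parallel sinks, every walk from [s] to a sink of the label of a terminal
    vertex [w] passes through [w] ([terminal_between]): alternatives that avoid
    [w] would merge with the walks through [w] at a vertex [p] behind [w]
    ([sp_set_merge]), and since sinks do not reach each other, all sinks of [w]
    would lie behind [p], so that [w] and [p] had the same label.  Hence there is
    one terminal vertex for each nonempty label, and the subgraphs spanned by the
    arcs of the label tree partition the arcs with live target: an arc belongs to
    the tree arc that ends in the terminal vertex of the label of its target
    ([between_arc]).  The same bottleneck property shows that a robust flow
    restricts to a robust flow of the instance of each tree arc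
    ([flow_restrict]).  So sums of optimal flows of these instances have minimum
    cost in every scenario, and they are robust flows of the whole instance
    because their balances are those of the restrictions of any feasible flow
    ([label_tree_optimal]).

    For a single tree arc the lower bound is an induction on the series-parallel
    structure ([sp_flow_bound]): compared with a flow of value [e] that agrees on
    the fixed arcs, a flow of value [d] can send at most [minn d e] units along
    paths with fixed arcs, the others pay for a free path.  With [e] the least
    demand over all scenarios, this is the cost of the two-path flow
    ([sub_optimal]).

    Why it runs in the stated time.  Labels need not be computed as sets.  The
    terminal vertex of the label of [u] is determined by those of its successors:
    it is their common value, or [u] itself if they differ or [u] is a sink
    ([last_of_merge]).  Shortest paths inside the subgraphs of all tree arcs are
    found at once by relaxing all arcs, the distance being reset to zero at [s]
    and at the terminal vertices ([dist_tree], [traceP], [dist_lower]).  Both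
    rules are local in an acyclic digraph, so [n] rounds over all [m] arcs reach
    the fixed point, in time O(n (n + m)).  The demands behind the terminal
    vertices are collected by climbing from each sink to [s] along shortest path
    predecessors: by the bottleneck property, this walk meets exactly the
    terminal vertices whose label contains the sink ([up_count]).  Climbing and
    routing take O(n) steps for each vertex and scenario.  The program consists
    of counting loops over vertices, arcs and scenarios, so its effect is a
    function on memories and its running time can be read off from the loop
    bounds ([exec_compile]). *)

(** * Series-parallel arc sets *)

Section SpSet.
Variable G : digraph.
Implicit Types (A B : {set arcs G}) (x y z o p q v w : verts G) (a : arcs G).

Definition incident A x : bool :=
  [exists a in A, (src a == x) || (tgt a == x)].

Definition adj_in A : rel (verts G) :=
  [rel x y | [exists a in A, (src a == x) && (tgt a == y)]].

Definition reaches_in A x y : bool := connect (adj_in A) x y.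

(** The decomposition of a series-parallel digraph inside one ambient digraph:
    components are arc sets, which share vertices instead of being glued along
    maps between vertex types. *)
Inductive sp_set : {set arcs G} -> verts G -> verts G -> Prop :=
| sp_set_arc a : src a != tgt a -> sp_set [set a] (src a) (tgt a)
| sp_set_series A1 A2 o p q :
    sp_set A1 o p -> sp_set A2 p q -> [disjoint A1 & A2] ->
    (forall x, incident A1 x -> incident A2 x -> x = p) ->
    sp_set (A1 :|: A2) o q
| sp_set_parallel A1 A2 o q :
    sp_set A1 o q -> sp_set A2 o q -> [disjoint A1 & A2] ->
    (forall x, incident A1 x -> incident A2 x -> x = o \/ x = q) ->
    sp_set (A1 :|: A2) o q.

Lemma incident_src A a : a \in A -> incident A (src a).
Proof. by move=> aA; apply/exists_inP; exists a; rewrite ?eqxx. Qed.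

Lemma incident_tgt A a : a \in A -> incident A (tgt a).
Proof. by move=> aA; apply/exists_inP; exists a; rewrite ?eqxx ?orbT. Qed.

Lemma incidentU A1 A2 x : incident (A1 :|: A2) x = incident A1 x || incident A2 x.
Proof.
apply/exists_inP/orP => [[a]|[]/exists_inP[a aA ax]].
- by rewrite inE => /orP[] aA ax; [left|right]; apply/exists_inP; exists a.
- by exists a; rewrite // inE aA.
- by exists a; rewrite // inE aA orbT.
Qed.

Lemma incident_set1 a x : incident [set a] x = (src a == x) || (tgt a == x).
Proof.
apply/exists_inP/idP => [[b]|H]; first by rewrite inE => /eqP ->.
by exists a; rewrite ?inE.
Qed.

Lemma reaches_in_arc A a : a \in A -> reaches_in A (src a) (tgt a).
Proof. by move=> aA; apply/connect1/exists_inP; exists a; rewrite ?eqxx. Qed.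

Lemma reaches_in_trans A y x z :
  reaches_in A x y -> reaches_in A y z -> reaches_in A x z.
Proof. exact: connect_trans. Qed.

Lemma reaches_in_sub A B x y : A \subset B -> reaches_in A x y -> reaches_in B x y.
Proof.
move=> /subsetP AB; apply: connect_sub => u v /exists_inP[a aA H].
by apply/connect1/exists_inP; exists a => //; exact: AB.
Qed.

(** Reachability stays within a part [A'] of the arcs that traps every walk
    entering a vertex set [P], either forwards or backwards. *)
Lemma reaches_in_forward A A' (P : pred (verts G)) x y :
  (forall a, a \in A -> P (src a) -> a \in A' /\ P (tgt a)) ->
  P x -> reaches_in A x y -> reaches_in A' x y /\ P y.
Proof.
move=> clos Px /connectP[s]; elim: s x Px => [|z s IH] x Px /=.
  by move=> _ ->; split=> //; exact: connect0.
case/andP=> /exists_inP[a aA /andP[/eqP ax /eqP az]] sP yE.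
rewrite -{x}ax in Px *; rewrite -{z}az in sP yE *.
have [aA' Pt] := clos a aA Px.
have [H ?] := IH _ Pt sP yE; split=> //.
exact: reaches_in_trans (reaches_in_arc aA') H.
Qed.

Lemma reaches_in_backward A A' (P : pred (verts G)) x y :
  (forall a, a \in A -> P (tgt a) -> a \in A' /\ P (src a)) ->
  P y -> reaches_in A x y -> reaches_in A' x y /\ P x.
Proof.
move=> clos Py /connectP[s]; elim: s x => [|z s IH] x /=.
  by move=> _ <-; split=> //; exact: connect0.
case/andP=> /exists_inP[a aA /andP[/eqP ax /eqP az]] sP yE.
rewrite -{x}ax; rewrite -{z}az in sP yE.
have [H Pt] := IH _ sP yE.
have [aA' Ps] := clos a aA Pt; split=> //.
exact: reaches_in_trans (reaches_in_arc aA') H.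
Qed.

Lemma sp_set_incident_ends A o q : sp_set A o q -> incident A o /\ incident A q.
Proof.
elim=> [a _|A1 A2 o' p q' _ [H1 H2] _ [H3 H4] _ _|A1 A2 o' q' _ [H1 H2] _ _ _ _].
- by rewrite !incident_set1 !eqxx orbT.
- by rewrite !incidentU H1 H4 orbT.
- by rewrite !incidentU H1 H2.
Qed.

Lemma sp_set_terminals A o q : sp_set A o q ->
  [/\ o != q, forall a, a \in A -> tgt a != o & forall a, a \in A -> src a != q].
Proof.
elim=> [a na|A1 A2 o' p q' S1 [n1 t1 s1] S2 [n2 t2 s2] _ J
       |A1 A2 o' q' S1 [n1 t1 s1] S2 [n2 t2 s2] _ J].
- by split=> // b; rewrite inE => /eqP ->; rewrite // eq_sym.
- have [io1 ip1] := sp_set_incident_ends S1.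
  have [ip2 iq2] := sp_set_incident_ends S2.
  split.
  + apply/eqP=> E; move: iq2; rewrite -E => iq2.
    by rewrite (J _ io1 iq2) eqxx in n1.
  + move=> a; rewrite inE => /orP[/t1 //|aA].
    apply/eqP=> E; have := J _ io1; rewrite -E => /(_ (incident_tgt aA)) F.
    by have := t2 a aA; rewrite F eqxx.
  + move=> a; rewrite inE => /orP[aA|/s2 //].
    apply/eqP=> E; have := J _ (incident_src aA); rewrite E => /(_ iq2) F.
    by have := s1 a aA; rewrite -F E eqxx.
- by split=> // a; rewrite inE => /orP[]; [exact: t1|exact: t2|exact: s1|exact: s2].
Qed.

(* Arcs leave the first component of a series composition for good: whatever
   reaches its vertices lies in it, and symmetrically for the second. *)
Section Series.
Variables (A1 A2 : {set arcs G}) (o p q : verts G).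
Hypotheses (S1 : sp_set A1 o p) (S2 : sp_set A2 p q).
Hypothesis J : forall x, incident A1 x -> incident A2 x -> x = p.

Lemma series_reaches_fst x y : incident A1 y -> reaches_in (A1 :|: A2) x y ->
  reaches_in A1 x y /\ incident A1 x.
Proof.
apply: reaches_in_backward => a; rewrite inE => /orP[aA|aA] it.
  by split=> //; exact: incident_src.
have [_ t2 _] := sp_set_terminals S2.
by have := t2 a aA; rewrite (J it (incident_tgt aA)) eqxx.
Qed.

Lemma series_reaches_snd x y : incident A2 x -> reaches_in (A1 :|: A2) x y ->
  reaches_in A2 x y /\ incident A2 y.
Proof.
apply: reaches_in_forward => a; rewrite inE => /orP[aA|aA] it; last first.
  by split=> //; exact: incident_tgt.
have [_ _ s1] := sp_set_terminals S1.
by have := s1 a aA; rewrite (J (incident_src aA) it) eqxx.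
Qed.
End Series.

(* Walks can change the component of a parallel composition at its ends only,
   and no arc enters the origin or leaves the target. *)
Section Parallel.
Variables (A1 A2 : {set arcs G}) (o q : verts G).
Hypotheses (S1 : sp_set A1 o q) (S2 : sp_set A2 o q).
Hypothesis J : forall x, incident A1 x -> incident A2 x -> x = o \/ x = q.

Lemma parallel_reaches_forward x y : incident A1 x -> x != o ->
  reaches_in (A1 :|: A2) x y -> reaches_in A1 x y /\ incident A1 y && (y != o).
Proof.
move=> ix xo; apply: (reaches_in_forward (P := fun x => incident A1 x && (x != o)));
  last by rewrite ix.
move=> a; rewrite inE => /orP[aA|aA] /andP[i1 no].
  have [_ t1 _] := sp_set_terminals S1.
  by split=> //; rewrite t1 // andbT incident_tgt.
have [_ _ s2] := sp_set_terminals S2.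
case: (J i1 (incident_src aA)) => E; first by rewrite E eqxx in no.
by have := s2 a aA; rewrite E eqxx.
Qed.

Lemma parallel_reaches_backward x y : incident A1 y -> y != q ->
  reaches_in (A1 :|: A2) x y -> reaches_in A1 x y /\ incident A1 x && (x != q).
Proof.
move=> iy yq; apply: (reaches_in_backward (P := fun x => incident A1 x && (x != q)));
  last by rewrite iy.
move=> a; rewrite inE => /orP[aA|aA] /andP[i1 no].
  have [_ _ s1] := sp_set_terminals S1.
  by split=> //; rewrite s1 // andbT incident_src.
have [_ t2 _] := sp_set_terminals S2.
case: (J i1 (incident_tgt aA)) => E; last by rewrite E eqxx in no.
by have := t2 a aA; rewrite E eqxx.
Qed.
End Parallel.

Lemma sp_set_reaches A o q x : sp_set A o q -> incident A x ->
  reaches_in A o x /\ reaches_in A x q.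
Proof.
move=> S; elim: S x => [a na|A1 A2 o' p q' S1 IH1 S2 IH2 _ J
       |A1 A2 o' q' S1 IH1 S2 IH2 _ J] x.
- rewrite incident_set1 => /orP[]/eqP <-; split; try exact: connect0;
    by apply: reaches_in_arc; rewrite inE.
- have [io1 ip1] := sp_set_incident_ends S1.
  have [ip2 iq2] := sp_set_incident_ends S2.
  have sub1 : A1 \subset A1 :|: A2 by exact: subsetUl.
  have sub2 : A2 \subset A1 :|: A2 by exact: subsetUr.
  rewrite incidentU => /orP[/IH1|/IH2] [ox xq].
    split; first exact: reaches_in_sub ox.
    apply: reaches_in_trans (reaches_in_sub sub1 xq) (reaches_in_sub sub2 _).
    by have [] := IH2 _ ip2.
  split; last exact: reaches_in_sub xq.
  apply: reaches_in_trans (reaches_in_sub sub1 _) (reaches_in_sub sub2 ox).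
  by have [] := IH1 _ ip1.
- rewrite incidentU => /orP[/IH1|/IH2] [ox xq]; split;
    by [apply: reaches_in_sub ox; rewrite ?subsetUl ?subsetUr|
        apply: reaches_in_sub xq; rewrite ?subsetUl ?subsetUr].
Qed.

Lemma parallel_reaches A1 A2 o q x y :
  sp_set A1 o q -> sp_set A2 o q ->
  (forall x, incident A1 x -> incident A2 x -> x = o \/ x = q) ->
  incident A1 x -> incident A1 y -> reaches_in (A1 :|: A2) x y -> reaches_in A1 x y.
Proof.
move=> S1 S2 J ix iy xy; have [->|xo] := eqVneq x o.
  by have [] := sp_set_reaches S1 iy.
by have [] := parallel_reaches_forward S1 S2 J ix xo xy.
Qed.

Lemma sp_set_acyclic A o q a : sp_set A o q -> a \in A ->
  ~~ reaches_in A (tgt a) (src a).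
Proof.
move=> S; elim: S a => [a na|A1 A2 o' p q' S1 IH1 S2 IH2 _ J
       |A1 A2 o' q' S1 IH1 S2 IH2 _ J] b.
- rewrite inE => /eqP -> {b}; apply/negP => R.
  have clos c : c \in [set a] -> src c == tgt a -> c \in set0 /\ tgt c == tgt a.
    by rewrite inE => /eqP ->; rewrite (negbTE na).
  have [_] := reaches_in_forward (P := pred1 (tgt a)) clos (eqxx _) R.
  by rewrite /= (negbTE na).
- rewrite inE => /orP[]bA; apply/negP=> R.
    have [R' _] := series_reaches_fst S2 J (incident_src bA) R.
    by move: (IH1 b bA); rewrite R'.
  have [R' _] := series_reaches_snd S1 J (incident_tgt bA) R.
  by move: (IH2 b bA); rewrite R'.
- rewrite inE => /orP[]bA; apply/negP=> R.
    move: (IH1 b bA); rewrite (parallel_reaches S1 S2 J _ _ R) //;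
    by [exact: incident_src|exact: incident_tgt].
  move: (IH2 b bA); rewrite (parallel_reaches S2 S1 _ _ _ (y := src b)) //;
    rewrite ?incident_src ?incident_tgt //; last by rewrite setUC.
  by move=> x i2 i1; exact: J.
Qed.

(** If no common walk meets [a] and [w], some parallel composition has them on
    different sides; [p] is the target of the innermost one.  What lies behind
    [w] is on its side, hence before [p], or behind [p]. *)
Lemma sp_set_merge A o q a w : sp_set A o q -> a \in A -> incident A w ->
  ~~ reaches_in A w (src a) -> ~~ reaches_in A (tgt a) w ->
  exists p, [/\ p != w, reaches_in A w p,
    forall z, reaches_in A (tgt a) z -> reaches_in A w z -> reaches_in A p z &
    forall z, reaches_in A w z -> reaches_in A z p || reaches_in A p z].
Proof.
move=> S; elim: S a w => [a na|A1 A2 o' p q' S1 IH1 S2 IH2 _ J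
       |A1 A2 o' q' S1 IH1 S2 IH2 _ J] b w.
- rewrite inE incident_set1 => /eqP -> /orP[]/eqP <-; rewrite ?negbK => //.
    by rewrite /reaches_in connect0.
  by rewrite /reaches_in !connect0.
- have [io1 ip1] := sp_set_incident_ends S1.
  have [ip2 iq2] := sp_set_incident_ends S2.
  have sub1 : A1 \subset A1 :|: A2 by exact: subsetUl.
  have sub2 : A2 \subset A1 :|: A2 by exact: subsetUr.
  have cross x y : incident A1 x -> incident A2 y -> reaches_in (A1 :|: A2) x y.
    move=> i1 i2; have [_ /(reaches_in_sub sub1) xp] := sp_set_reaches S1 i1.
    apply: (reaches_in_trans xp); apply: (reaches_in_sub sub2).
    by have [] := sp_set_reaches S2 i2.
  rewrite inE incidentU => /orP[]bA /orP[]iw nws ntw.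
  + have [||m [mw wm m1 m2]] := IH1 b w bA iw.
    * by apply: contra nws; exact: reaches_in_sub.
    * by apply: contra ntw; exact: reaches_in_sub.
    have im : incident A1 m.
      have clos a : a \in A1 -> incident A1 (src a) -> a \in A1 /\ incident A1 (tgt a).
        by move=> aA _; split=> //; exact: incident_tgt.
      by have [] := reaches_in_forward (P := incident A1) clos iw wm.
    have side z : reaches_in (A1 :|: A2) w z -> incident A1 z \/ incident A2 z.
      case/connectP=> s; elim/last_ind: s => [|s y _]; first by move=> _ ->; left.
      rewrite rcons_path last_rcons => /andP[_ /exists_inP[a aA /andP[_ /eqP <-]]] ->.
      by move: aA; rewrite inE => /orP[]/incident_tgt; auto.
    exists m; split=> // [|z bz wz|z wz]; first exact: reaches_in_sub wm.
      case: (side z wz) => iz; last exact: cross.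
      have [bz' _] := series_reaches_fst S2 J iz bz.
      have [wz' _] := series_reaches_fst S2 J iz wz.
      exact: reaches_in_sub (m1 _ bz' wz').
    case: (side z wz) => iz; last by rewrite orbC cross.
    have [wz' _] := series_reaches_fst S2 J iz wz.
    by case/orP: (m2 _ wz') => /(reaches_in_sub sub1) ->; rewrite ?orbT.
  + by case/negP: ntw; apply: cross => //; exact: incident_tgt.
  + by case/negP: nws; apply: cross => //; exact: incident_src.
  + have [||m [mw wm m1 m2]] := IH2 b w bA iw.
    * by apply: contra nws; exact: reaches_in_sub.
    * by apply: contra ntw; exact: reaches_in_sub.
    exists m; split=> // [|z bz wz|z wz]; first exact: reaches_in_sub wm.
      have [bz' _] := series_reaches_snd S1 J (incident_tgt bA) bz.
      have [wz' _] := series_reaches_snd S1 J iw wz.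
      exact: reaches_in_sub (m1 _ bz' wz').
    have [wz' _] := series_reaches_snd S1 J iw wz.
    by case/orP: (m2 _ wz') => /(reaches_in_sub sub2) ->; rewrite ?orbT.
- wlog bA : A1 A2 S1 IH1 S2 IH2 J / b \in A1.
    move=> H; rewrite inE => /orP[]bA; first by apply: H => //; rewrite inE bA.
    rewrite setUC; apply: H => //; last by rewrite inE bA.
    by move=> x i1 i2; exact: J.
  move=> _; rewrite incidentU => iw nws ntw.
  have sub1 : A1 \subset A1 :|: A2 by exact: subsetUl.
  have sub2 : A2 \subset A1 :|: A2 by exact: subsetUr.
  have wo : w != o'.
    apply: contra nws => /eqP ->; apply: (reaches_in_sub sub1).
    by have [] := sp_set_reaches S1 (incident_src bA).
  have wq : w != q'.
    apply: contra ntw => /eqP ->; apply: (reaches_in_sub sub1).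
    by have [] := sp_set_reaches S1 (incident_tgt bA).
  have bo : tgt b != o' by have [_ ->] := sp_set_terminals S1.
  have J' x : incident A2 x -> incident A1 x -> x = o' \/ x = q' by move=> *; exact: J.
  have fwd2 x y : incident A2 x -> x != o' -> reaches_in (A1 :|: A2) x y ->
      reaches_in A2 x y /\ incident A2 y && (y != o').
    by rewrite setUC; exact: (parallel_reaches_forward S2 S1 J').
  case/orP: iw => iw.
  + have [||m [mw wm m1 m2]] := IH1 b w bA iw.
    * by apply: contra nws; exact: reaches_in_sub.
    * by apply: contra ntw; exact: reaches_in_sub.
    exists m; split=> // [|z bz wz|z wz]; first exact: reaches_in_sub wm.
      have [bz' _] := parallel_reaches_forward S1 S2 J (incident_tgt bA) bo bz.
      have [wz' _] := parallel_reaches_forward S1 S2 J iw wo wz.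
      exact: reaches_in_sub (m1 _ bz' wz').
    have [wz' _] := parallel_reaches_forward S1 S2 J iw wo wz.
    by case/orP: (m2 _ wz') => /(reaches_in_sub sub1) ->; rewrite ?orbT.
  (* [w] is an inner vertex of the other component: both sides merge at [q'] *)
  + exists q'; split; first by rewrite eq_sym.
    * by apply: (reaches_in_sub sub2); have [] := sp_set_reaches S2 iw.
    * move=> z bz wz.
      have [_ /andP[i1 zo]] := parallel_reaches_forward S1 S2 J (incident_tgt bA) bo bz.
      have [_ /andP[i2 _]] := fwd2 _ _ iw wo wz.
      by case: (J z i1 i2) zo => ->; [rewrite eqxx|move=> _; exact: connect0].
    * move=> z wz; have [_ /andP[i2 _]] := fwd2 _ _ iw wo wz.
      by rewrite (reaches_in_sub sub2) //; have [] := sp_set_reaches S2 i2.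
Qed.

End SpSet.

(** * Flows on series-parallel arc sets *)

Section Blocks.
Variable G : digraph.
Implicit Types (A B : {set arcs G}) (x y z o p q v w : verts G) (a : arcs G).

Definition block A v w : {set arcs G} :=
  [set a in A | reaches_in A v (src a) && reaches_in A (tgt a) w].

Lemma block_sub A v w : block A v w \subset A.
Proof. by apply/subsetP=> a; rewrite inE => /andP[]. Qed.

Lemma incident_sub A B x : A \subset B -> incident A x -> incident B x.
Proof.
by move=> /subsetP AB /exists_inP[a /AB aB H]; apply/exists_inP; exists a.
Qed.

Lemma series_block_fst A1 A2 o p q v w : sp_set A1 o p -> sp_set A2 p q ->
  (forall x, incident A1 x -> incident A2 x -> x = p) ->
  incident A1 w -> block (A1 :|: A2) v w = block A1 v w.
Proof.
move=> S1 S2 J iw; have sub1 : A1 \subset A1 :|: A2 by exact: subsetUl.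
have [_ t2 _] := sp_set_terminals S2.
apply/setP=> a; rewrite !inE; apply/idP/idP; last first.
  by case/and3P=> -> /(reaches_in_sub sub1) -> /(reaches_in_sub sub1) ->.
case/and3P=> aA va aw; have [aw' it] := series_reaches_fst S2 J iw aw.
case/orP: aA => aA; last first.
  by have := t2 a aA; rewrite (J _ it (incident_tgt aA)) eqxx.
have [va' _] := series_reaches_fst S2 J (incident_src aA) va.
by rewrite aA va' aw'.
Qed.

Lemma series_block_snd A1 A2 o p q v w : sp_set A1 o p -> sp_set A2 p q ->
  (forall x, incident A1 x -> incident A2 x -> x = p) ->
  incident A2 v -> block (A1 :|: A2) v w = block A2 v w.
Proof.
move=> S1 S2 J iv; have sub2 : A2 \subset A1 :|: A2 by exact: subsetUr.
have [_ _ s1] := sp_set_terminals S1.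
apply/setP=> a; rewrite !inE; apply/idP/idP; last first.
  by case/and3P=> -> /(reaches_in_sub sub2) -> /(reaches_in_sub sub2) ->;
     rewrite orbT.
case/and3P=> aA va aw; have [va' isa] := series_reaches_snd S1 J iv va.
case/orP: aA => aA.
  by have := s1 a aA; rewrite (J _ (incident_src aA) isa) eqxx.
have [aw' _] := series_reaches_snd S1 J (incident_tgt aA) aw.
by rewrite aA va' aw'.
Qed.

Lemma series_block_cross A1 A2 o p q v w : sp_set A1 o p -> sp_set A2 p q ->
  (forall x, incident A1 x -> incident A2 x -> x = p) ->
  incident A1 v -> incident A2 w ->
  block (A1 :|: A2) v w = block A1 v p :|: block A2 p w.
Proof.
move=> S1 S2 J iv iw.
have sub1 : A1 \subset A1 :|: A2 by exact: subsetUl.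
have sub2 : A2 \subset A1 :|: A2 by exact: subsetUr.
apply/setP=> a; rewrite !inE; apply/idP/idP.
  case/and3P=> /orP[]aA va aw.
    have [va' _] := series_reaches_fst S2 J (incident_src aA) va.
    by have [_ ->] := sp_set_reaches S1 (incident_tgt aA); rewrite aA va'.
  have [aw' _] := series_reaches_snd S1 J (incident_tgt aA) aw.
  by have [-> _] := sp_set_reaches S2 (incident_src aA); rewrite aA aw' orbT.
case/orP=> /and3P[aA va aw].
  rewrite aA (reaches_in_sub sub1 va) /=.
  apply: reaches_in_trans (reaches_in_sub sub1 aw) (reaches_in_sub sub2 _).
  by have [] := sp_set_reaches S2 iw.
rewrite aA orbT (reaches_in_sub sub2 aw) andbT /=.
apply: reaches_in_trans (reaches_in_sub sub1 _) (reaches_in_sub sub2 va).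
by have [] := sp_set_reaches S1 iv.
Qed.

Lemma parallel_block A1 A2 o q v w : sp_set A1 o q -> sp_set A2 o q ->
  (forall x, incident A1 x -> incident A2 x -> x = o \/ x = q) ->
  incident A1 v -> incident A1 w -> (v != o) || (w != q) ->
  block (A1 :|: A2) v w = block A1 v w.
Proof.
move=> S1 S2 J iv iw vw; have sub1 : A1 \subset A1 :|: A2 by exact: subsetUl.
have [_ t2 s2] := sp_set_terminals S2.
apply/setP=> a; rewrite !inE; apply/idP/idP; last first.
  by case/and3P=> -> /(reaches_in_sub sub1) -> /(reaches_in_sub sub1) ->.
case/and3P=> aA va aw; suff aA1 : a \in A1.
  rewrite aA1 (parallel_reaches S1 S2 J iv (incident_src aA1) va).
  by rewrite (parallel_reaches S1 S2 J (incident_tgt aA1) iw aw).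
case/orP: aA => // aA; case/orP: vw => [vo|wq].
  have [_ /andP[i1 so]] := parallel_reaches_forward S1 S2 J iv vo va.
  have := s2 a aA; case: (J _ i1 (incident_src aA)) => E; last by rewrite E eqxx.
  by rewrite E eqxx in so.
have [_ /andP[i1 tq]] := parallel_reaches_backward S1 S2 J iw wq aw.
have := t2 a aA; case: (J _ i1 (incident_tgt aA)) => E; first by rewrite E eqxx.
by rewrite E eqxx in tq.
Qed.

(** In a composition, the part between two vertices is the whole, or lies in one
    component, or is the series composition of what lies before and behind the
    contracted vertex. *)
Lemma sp_set_block A o q v w : sp_set A o q -> incident A v -> incident A w ->
  v != w -> reaches_in A v w -> sp_set (block A v w) v w.
Proof.
move=> S; elim: S v w => [a na|A1 A2 o' p q' S1 IH1 S2 IH2 D J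
       |A1 A2 o' q' S1 IH1 S2 IH2 D J] v w.
- rewrite !incident_set1 => /orP[]/eqP <- /orP[]/eqP <-; rewrite ?eqxx // => _ R.
    have -> : block [set a] (src a) (tgt a) = [set a].
      apply/setP=> b; rewrite !inE; case: eqVneq => //= ->.
      by rewrite /reaches_in !connect0.
    exact: sp_set_arc.
  by case/negP: (sp_set_acyclic (sp_set_arc na) (set11 a)).
- have sub1 : A1 \subset A1 :|: A2 by exact: subsetUl.
  have sub2 : A2 \subset A1 :|: A2 by exact: subsetUr.
  rewrite !incidentU => iv iw vw R.
  have [iw1|niw1] := boolP (incident A1 w).
    have [R' iv1] := series_reaches_fst S2 J iw1 R.
    by rewrite (series_block_fst _ S1 S2 J) //; exact: IH1.
  have [iv2|niv2] := boolP (incident A2 v).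
    have [R' iw2] := series_reaches_snd S1 J iv2 R.
    by rewrite (series_block_snd _ S1 S2 J) //; exact: IH2.
  rewrite (negbTE niw1) /= in iw; rewrite (negbTE niv2) orbF in iv.
  rewrite (series_block_cross S1 S2 J iv iw).
  have [io1 ip1] := sp_set_incident_ends S1.
  have [ip2 iq2] := sp_set_incident_ends S2.
  apply: (@sp_set_series _ _ _ v p w).
  + apply: IH1 => //; first by apply: contra niv2 => /eqP ->.
    by have [] := sp_set_reaches S1 iv.
  + apply: IH2 => //; first by apply: contra niw1 => /eqP <-.
    by have [] := sp_set_reaches S2 iw.
  + exact: disjointWl (block_sub _ _ _) (disjointWr (block_sub _ _ _) D).
  + by move=> x /(incident_sub (block_sub _ _ _)) i1
      /(incident_sub (block_sub _ _ _)); exact: J.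
- have J' x : incident A2 x -> incident A1 x -> x = o' \/ x = q' by move=> *; exact: J.
  have [/andP[/eqP -> /eqP ->]|] := boolP ((v == o') && (w == q')).
    move=> _ _ _ _; have -> : block (A1 :|: A2) o' q' = A1 :|: A2; last first.
      exact: sp_set_parallel.
    apply/setP=> a; rewrite [LHS]inE; case: (boolP (a \in _)) => //= aA.
    have S : sp_set (A1 :|: A2) o' q' by exact: sp_set_parallel.
    have [-> _] := sp_set_reaches S (incident_src aA).
    by have [_ ->] := sp_set_reaches S (incident_tgt aA).
  rewrite negb_and => nvw iv iw vw R.
  have : (incident A1 v && incident A1 w) || (incident A2 v && incident A2 w).
    case/orP: nvw => H; [move: iv|move: iw]; rewrite incidentU => /orP[]i.
    + by have [_ /andP[-> _]] := parallel_reaches_forward S1 S2 J i H R; rewrite i.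
    + rewrite setUC in R.
      by have [_ /andP[-> _]] := parallel_reaches_forward S2 S1 J' i H R; rewrite i orbT.
    + by have [_ /andP[-> _]] := parallel_reaches_backward S1 S2 J i H R; rewrite i.
    + rewrite setUC in R.
      by have [_ /andP[-> _]] := parallel_reaches_backward S2 S1 J' i H R; rewrite i orbT.
  case/orP=> /andP[i1 i2].
    rewrite (parallel_block S1 S2 J) //.
    by apply: IH1 => //; exact: (parallel_reaches S1 S2 J i1 i2 R).
  rewrite setUC in R *; rewrite (parallel_block S2 S1 J') //.
  by apply: IH2 => //; exact: (parallel_reaches S2 S1 J' i1 i2 R).
Qed.

(** Adding the value [d] at the ends on the side where it is missing keeps the
    equations free of subtraction. *)
Definition conserves A v w (d : nat) (g : arcs G -> nat) : Prop :=
  forall x, \sum_(a in A | src a == x) g a + d * (x == w) =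
            \sum_(a in A | tgt a == x) g a + d * (x == v).

Lemma eq_sum_missing (T : finType) (F1 F2 : T -> nat) (p : T) :
  \sum_x F1 x = \sum_x F2 x -> (forall x : T, x != p -> F1 x = F2 x) -> F1 p = F2 p.
Proof.
move=> E H; move: E; rewrite (bigD1 p) //= [RHS](bigD1 p) //=.
by rewrite (eq_bigr F2) // => /addIn.
Qed.

Lemma sum_by_end A (e : arcs G -> verts G) (g : arcs G -> nat) :
  \sum_x \sum_(a in A | e a == x) g a = \sum_(a in A) g a.
Proof. by rewrite [RHS](partition_big e predT). Qed.

Lemma sum_delta (d : nat) w : \sum_x d * (x == w) = d.
Proof.
rewrite (bigD1 w) //= eqxx muln1 big1 ?addn0 // => x /negbTE ->.
by rewrite muln0.
Qed.

(** Summed over all vertices, both sides count every arc once, so one of the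
    equations follows from the others. *)
Lemma conserves_missing A v w d g p :
  (forall x, x != p -> \sum_(a in A | src a == x) g a + d * (x == w) =
            \sum_(a in A | tgt a == x) g a + d * (x == v)) ->
  conserves A v w d g.
Proof.
move=> H x; have [->|] := eqVneq x p; last exact: H.
apply: (@eq_sum_missing _
  (fun x => \sum_(a in A | src a == x) g a + d * (x == w))
  (fun x => \sum_(a in A | tgt a == x) g a + d * (x == v))) => //.
by rewrite !big_split /= !sum_by_end !sum_delta.
Qed.

Lemma sum_setU A1 A2 (g : arcs G -> nat) : [disjoint A1 & A2] ->
  \sum_(a in A1 :|: A2) g a = \sum_(a in A1) g a + \sum_(a in A2) g a.
Proof. by move=> D; rewrite -bigU //; apply: eq_bigl => a; rewrite !inE. Qed.

Lemma sum_disjointU A1 A2 (P : pred (arcs G)) (g : arcs G -> nat) :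
  [disjoint A1 & A2] -> \sum_(a in A1 :|: A2 | P a) g a =
  \sum_(a in A1 | P a) g a + \sum_(a in A2 | P a) g a.
Proof.
by move=> D; rewrite big_mkcondr sum_setU //= -!big_mkcondr.
Qed.

Lemma sum_src_out A x (g : arcs G -> nat) : ~~ incident A x ->
  \sum_(a in A | src a == x) g a = 0.
Proof.
move=> nix; apply: big1 => a /andP[aA /eqP E].
by case/negP: nix; rewrite -E incident_src.
Qed.

Lemma sum_tgt_out A x (g : arcs G -> nat) : ~~ incident A x ->
  \sum_(a in A | tgt a == x) g a = 0.
Proof.
move=> nix; apply: big1 => a /andP[aA /eqP E].
by case/negP: nix; rewrite -E incident_tgt.
Qed.

Lemma series_conserves A1 A2 o p q d g : sp_set A1 o p -> sp_set A2 p q ->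
  [disjoint A1 & A2] -> (forall x, incident A1 x -> incident A2 x -> x = p) ->
  conserves (A1 :|: A2) o q d g -> conserves A1 o p d g /\ conserves A2 p q d g.
Proof.
move=> S1 S2 D J C.
have [io1 ip1] := sp_set_incident_ends S1.
have [ip2 iq2] := sp_set_incident_ends S2.
have [n1 _ _] := sp_set_terminals S1; have [n2 _ _] := sp_set_terminals S2.
split; apply: (@conserves_missing _ _ _ _ _ p) => x xp;
  move: (C x); rewrite !sum_disjointU // (negbTE xp) muln0 ?addn0.
- have [i1|ni1] := boolP (incident A1 x).
    have ni2 : ~~ incident A2 x by apply: contra xp => /(J _ i1) ->.
    rewrite (sum_src_out _ ni2) (sum_tgt_out _ ni2) !addn0.
    have /negbTE -> : x != q by apply: contra ni2 => /eqP ->.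
    by rewrite muln0 addn0.
  rewrite (sum_src_out _ ni1) (sum_tgt_out _ ni1).
  have /negbTE -> : x != o by apply: contra ni1 => /eqP ->.
  by rewrite muln0.
- have [i2|ni2] := boolP (incident A2 x).
    have ni1 : ~~ incident A1 x by apply: contra xp => i1; rewrite (J _ i1 i2).
    rewrite (sum_src_out _ ni1) (sum_tgt_out _ ni1) !add0n.
    have /negbTE -> : x != o by apply: contra ni1 => /eqP ->.
    by rewrite muln0 addn0.
  rewrite (sum_src_out _ ni2) (sum_tgt_out _ ni2).
  have /negbTE -> : x != q by apply: contra ni2 => /eqP ->.
  by rewrite muln0.
Qed.

(** The two values are the outflows at the origin, which no arc enters. *)
Lemma parallel_conserves A1 A2 o q d g : sp_set A1 o q -> sp_set A2 o q ->
  [disjoint A1 & A2] ->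
  (forall x, incident A1 x -> incident A2 x -> x = o \/ x = q) ->
  conserves (A1 :|: A2) o q d g ->
  exists d1 d2, [/\ d = d1 + d2, conserves A1 o q d1 g & conserves A2 o q d2 g].
Proof.
move=> S1 S2 D J C.
have no_in A : sp_set A o q -> \sum_(a in A | tgt a == o) g a = 0.
  move=> S; have [_ t _] := sp_set_terminals S.
  by apply: big1 => a /andP[/t/negbTE ->].
have [n1 _ _] := sp_set_terminals S1.
exists (\sum_(a in A1 | src a == o) g a), (\sum_(a in A2 | src a == o) g a); split.
- move: (C o); rewrite !sum_disjointU // (negbTE n1) muln0 addn0.
  by rewrite !no_in // eqxx muln1 add0n => ->.
- apply: (@conserves_missing _ _ _ _ _ q) => x xq; rewrite (negbTE xq) muln0 addn0.
  have [->|xo] := eqVneq x o; first by rewrite no_in // muln1.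
  rewrite muln0 addn0; have [i1|ni1] := boolP (incident A1 x); last first.
    by rewrite (sum_src_out _ ni1) (sum_tgt_out _ ni1).
  have ni2 : ~~ incident A2 x.
    by apply/negP=> i2; case: (J _ i1 i2) => E; [case/eqP: xo|case/eqP: xq].
  move: (C x); rewrite !sum_disjointU // (negbTE xq) (negbTE xo).
  by rewrite (sum_src_out _ ni2) (sum_tgt_out _ ni2) !muln0 !addn0.
- apply: (@conserves_missing _ _ _ _ _ q) => x xq; rewrite (negbTE xq) muln0 addn0.
  have [->|xo] := eqVneq x o; first by rewrite no_in // muln1.
  rewrite muln0 addn0; have [i2|ni2] := boolP (incident A2 x); last first.
    by rewrite (sum_src_out _ ni2) (sum_tgt_out _ ni2).
  have ni1 : ~~ incident A1 x.
    by apply/negP=> i1; case: (J _ i1 i2) => E; [case/eqP: xo|case/eqP: xq].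
  move: (C x); rewrite !sum_disjointU // (negbTE xq) (negbTE xo).
  by rewrite (sum_src_out _ ni1) (sum_tgt_out _ ni1) !muln0 !addn0 !add0n.
Qed.

Definition walk_in A v w (p : seq (arcs G)) : bool := is_walk v w p && all (mem A) p.

Lemma is_walk_cat v w (p1 p2 : seq (arcs G)) u :
  is_walk v u p1 -> is_walk u w p2 -> is_walk v w (p1 ++ p2).
Proof.
by elim: p1 v => [|a p1 IH] v /=; [move=> /eqP -> | case/andP=> -> /IH H /H].
Qed.

Lemma walk_in_cat A v w (p1 p2 : seq (arcs G)) u :
  walk_in A v u p1 -> walk_in A u w p2 -> walk_in A v w (p1 ++ p2).
Proof.
case/andP=> w1 a1 /andP[w2 a2]; rewrite /walk_in all_cat a1 a2 /= andbT.
exact: is_walk_cat w1 w2.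
Qed.

Lemma walk_in_sub A B v w (p : seq (arcs G)) : A \subset B -> walk_in A v w p -> walk_in B v w p.
Proof.
move=> /subsetP AB /andP[W Al]; rewrite /walk_in W /=.
by apply/allP=> a /(allP Al) /AB.
Qed.

Section Cost.
Variables (c : arcs G -> nat) (F : {set arcs G}).

Definition wcost (p : seq (arcs G)) : nat := \sum_(a <- p) c a.

(** The two forms of the lower bound, for a digraph with a free path [pr] and for
    one where every path uses a fixed arc. *)
Definition bounds_free A o q (pf pr : seq (arcs G)) : Prop :=
  forall d e g h, conserves A o q d g -> conserves A o q e h ->
    (forall a, a \in F -> g a = h a) ->
    minn d e * wcost pf + (d - e) * wcost pr <= \sum_(a in A) c a * g a.

Definition bounds_rigid A o q (pf : seq (arcs G)) : Prop :=
  forall d e g h, conserves A o q d g -> conserves A o q e h ->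
    (forall a, a \in F -> g a = h a) ->
    d = e /\ d * wcost pf <= \sum_(a in A) c a * g a.

(** Each branch on its own lets only [minn di ei] units travel at the cheap rate,
    and the sum of these minima is at most [minn (d1 + d2) (e1 + e2)]; replacing
    a free unit by a cheap one only lowers the bound. *)
Lemma bound_parallel d1 d2 e1 e2 r r1 r2 s s1 s2 k1 k2 :
  r <= s -> r <= r1 -> r <= r2 -> s <= s1 -> s <= s2 ->
  minn d1 e1 * r1 + (d1 - e1) * s1 <= k1 ->
  minn d2 e2 * r2 + (d2 - e2) * s2 <= k2 ->
  minn (d1 + d2) (e1 + e2) * r + (d1 + d2 - (e1 + e2)) * s <= k1 + k2.
Proof.
move=> rs r1l r2l s1l s2l H1 H2.
set m1 := minn d1 e1 in H1; set m2 := minn d2 e2 in H2; set m := minn _ _.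
have K1 : m1 * r + (d1 - e1) * s <= k1.
  by apply: leq_trans H1; apply: leq_add; rewrite leq_mul2l ?r1l ?s1l orbT.
have K2 : m2 * r + (d2 - e2) * s <= k2.
  by apply: leq_trans H2; apply: leq_add; rewrite leq_mul2l ?r2l ?s2l orbT.
apply: leq_trans (leq_add K1 K2).
have [t Et] : exists t, m = m1 + m2 + t.
  by exists (m - (m1 + m2)); rewrite /m /m1 /m2; lia.
have Ed : (d1 - e1) + (d2 - e2) = (d1 + d2 - (e1 + e2)) + t.
  by move: Et; rewrite /m /m1 /m2; lia.
have -> : m1 * r + (d1 - e1) * s + (m2 * r + (d2 - e2) * s) =
  (m1 + m2) * r + ((d1 - e1) + (d2 - e2)) * s by rewrite !mulnDl; lia.
rewrite Ed Et !mulnDl.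
have : t * r <= t * s by rewrite leq_mul2l rs orbT.
lia.
Qed.

(** The bounds add up in series, and in parallel by [bound_parallel].  The
    statement depends on the series-parallel structure: in general a single unit
    of the second flow may agree with the fixed arcs of two different paths of
    the first one. *)
Lemma sp_flow_bound A o q : sp_set A o q -> exists2 pf, walk_in A o q pf &
  (exists pr, [/\ walk_in (A :\: F) o q pr, wcost pf <= wcost pr &
                  bounds_free A o q pf pr]) \/
  bounds_rigid A o q pf.
Proof.
elim=> {A o q} [a na|A1 A2 o p q S1 IH1 S2 IH2 D J|A1 A2 o q S1 IH1 S2 IH2 D J].
- have W : walk_in [set a] (src a) (tgt a) [:: a].
    by rewrite /walk_in /= !eqxx !inE eqxx.
  exists [:: a] => //.
  have val d g : conserves [set a] (src a) (tgt a) d g -> g a = d.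
    move=> /(_ (src a)); rewrite (negbTE na) muln0 addn0 eqxx muln1.
    rewrite (big_pred1 a) => [|b]; last by rewrite !inE; case: eqVneq => //= ->; rewrite eqxx.
    rewrite big_pred0 => [->|b]; first by [].
    rewrite !inE; case: eqVneq => //= ->.
    by rewrite eq_sym (negbTE na).
  have costE (g : arcs G -> nat) : \sum_(b in [set a]) c b * g b = c a * g a.
    by rewrite big_set1.
  have [aF|naF] := boolP (a \in F).
    right=> d e g h /val gd /val he agr; rewrite -gd -he agr //; split=> //.
    by rewrite costE /wcost big_seq1 agr // mulnC.
  left; exists [:: a]; split=> //.
    by rewrite /walk_in /= !eqxx !inE eqxx naF.
  move=> d e g h /val gd _ _; rewrite costE gd /wcost big_seq1 -mulnDl mulnC.
  by rewrite leq_mul2l; apply/orP; right; lia.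
- case: IH1 => pf1 W1 IH1; case: IH2 => pf2 W2 IH2.
  have sub1 : A1 \subset A1 :|: A2 by exact: subsetUl.
  have sub2 : A2 \subset A1 :|: A2 by exact: subsetUr.
  exists (pf1 ++ pf2).
    exact: walk_in_cat (walk_in_sub sub1 W1) (walk_in_sub sub2 W2).
  have costU (g : arcs G -> nat) : \sum_(b in A1 :|: A2) c b * g b =
      \sum_(b in A1) c b * g b + \sum_(b in A2) c b * g b by rewrite sum_setU.
  have pcat (p1 p2 : seq (arcs G)) : wcost (p1 ++ p2) = wcost p1 + wcost p2 by rewrite /wcost big_cat.
  case: IH1 => [[pr1 [Wr1 le1 B1]]|B1]; case: IH2 => [[pr2 [Wr2 le2 B2]]|B2].
  + left; exists (pr1 ++ pr2); split.
    * apply: walk_in_cat (walk_in_sub (setSD _ sub1) Wr1) (walk_in_sub (setSD _ sub2) Wr2).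
    * by rewrite !pcat leq_add.
    * move=> d e g h Cg Ch agr; rewrite costU !pcat.
      have [g1 g2] := series_conserves S1 S2 D J Cg.
      have [h1 h2] := series_conserves S1 S2 D J Ch.
      by rewrite !mulnDr; have := B1 _ _ _ _ g1 h1 agr; have := B2 _ _ _ _ g2 h2 agr; lia.
  + right=> d e g h Cg Ch agr; rewrite costU !pcat.
    have [g1 g2] := series_conserves S1 S2 D J Cg.
    have [h1 h2] := series_conserves S1 S2 D J Ch.
    have [E H2] := B2 _ _ _ _ g2 h2 agr; split=> //.
    have := B1 _ _ _ _ g1 h1 agr; rewrite mulnDr E minnn subnn mul0n addn0.
    by move: H2; rewrite E; lia.
  + right=> d e g h Cg Ch agr; rewrite costU !pcat.
    have [g1 g2] := series_conserves S1 S2 D J Cg.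
    have [h1 h2] := series_conserves S1 S2 D J Ch.
    have [E H1] := B1 _ _ _ _ g1 h1 agr; split=> //.
    have := B2 _ _ _ _ g2 h2 agr; rewrite mulnDr E minnn subnn mul0n addn0.
    by move: H1; rewrite E; lia.
  + right=> d e g h Cg Ch agr; rewrite costU !pcat.
    have [g1 g2] := series_conserves S1 S2 D J Cg.
    have [h1 h2] := series_conserves S1 S2 D J Ch.
    have [E H1] := B1 _ _ _ _ g1 h1 agr; have [_ H2] := B2 _ _ _ _ g2 h2 agr.
    by split=> //; rewrite mulnDr; lia.
- case: IH1 => pf1 W1 IH1; case: IH2 => pf2 W2 IH2.
  have sub1 : A1 \subset A1 :|: A2 by exact: subsetUl.
  have sub2 : A2 \subset A1 :|: A2 by exact: subsetUr.
  have costU (g : arcs G -> nat) : \sum_(b in A1 :|: A2) c b * g b =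
      \sum_(b in A1) c b * g b + \sum_(b in A2) c b * g b by rewrite sum_setU.
  have [pf Wf [l1 l2]] : exists2 pf, walk_in (A1 :|: A2) o q pf &
      wcost pf <= wcost pf1 /\ wcost pf <= wcost pf2.
    have [le|/ltnW le] := leqP (wcost pf1) (wcost pf2).
      by exists pf1; [exact: walk_in_sub W1|].
    by exists pf2; [exact: walk_in_sub W2|].
  exists pf => //.
  case: IH1 => [[pr1 [Wr1 le1 B1]]|B1]; case: IH2 => [[pr2 [Wr2 le2 B2]]|B2].
  + left; have [pr [Wr k1 k2 fr]] : exists pr, [/\ walk_in ((A1 :|: A2) :\: F) o q pr,
        wcost pr <= wcost pr1, wcost pr <= wcost pr2 & wcost pf <= wcost pr].
      have [le|/ltnW le] := leqP (wcost pr1) (wcost pr2).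
        by exists pr1; split=> //; [exact: walk_in_sub (setSD _ sub1) Wr1|
          exact: leq_trans l1 le1].
      by exists pr2; split=> //; [exact: walk_in_sub (setSD _ sub2) Wr2|
          exact: leq_trans l2 le2].
    exists pr; split=> // d e g h Cg Ch agr; rewrite costU.
    have [d1 [d2 [-> g1 g2]]] := parallel_conserves S1 S2 D J Cg.
    have [e1 [e2 [-> h1 h2]]] := parallel_conserves S1 S2 D J Ch.
    exact: (bound_parallel fr l1 l2 k1 k2 (B1 _ _ _ _ g1 h1 agr) (B2 _ _ _ _ g2 h2 agr)).
  + left; exists pr1; split=> [||d e g h Cg Ch agr].
    * exact: walk_in_sub (setSD _ sub1) Wr1.
    * exact: leq_trans l1 le1.
    rewrite costU.
    have [d1 [d2 [-> g1 g2]]] := parallel_conserves S1 S2 D J Cg.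
    have [e1 [e2 [-> h1 h2]]] := parallel_conserves S1 S2 D J Ch.
    have [E H2] := B2 _ _ _ _ g2 h2 agr.
    apply: (bound_parallel (leq_trans l1 le1) l1 l2 (leqnn _) (leqnn _)
      (B1 _ _ _ _ g1 h1 agr)).
    by rewrite -E minnn subnn mul0n addn0.
  + left; exists pr2; split=> [||d e g h Cg Ch agr].
    * exact: walk_in_sub (setSD _ sub2) Wr2.
    * exact: leq_trans l2 le2.
    rewrite costU.
    have [d1 [d2 [-> g1 g2]]] := parallel_conserves S1 S2 D J Cg.
    have [e1 [e2 [-> h1 h2]]] := parallel_conserves S1 S2 D J Ch.
    have [E H1] := B1 _ _ _ _ g1 h1 agr.
    apply: (bound_parallel (leq_trans l2 le2) l1 l2 (leqnn _) (leqnn _) _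
      (B2 _ _ _ _ g2 h2 agr)).
    by rewrite -E minnn subnn mul0n addn0.
  + right=> d e g h Cg Ch agr; rewrite costU.
    have [d1 [d2 [-> g1 g2]]] := parallel_conserves S1 S2 D J Cg.
    have [e1 [e2 [-> h1 h2]]] := parallel_conserves S1 S2 D J Ch.
    have [E1 H1] := B1 _ _ _ _ g1 h1 agr; have [E2 H2] := B2 _ _ _ _ g2 h2 agr.
    split; first by rewrite E1 E2.
    rewrite mulnDl; apply: leq_trans (leq_add H1 H2).
    by apply: leq_add; rewrite leq_mul2l ?l1 ?l2 orbT.
Qed.
End Cost.
End Blocks.

Lemma sp_set_morph (G1 G : digraph) (h : verts G1 -> verts G) (k : arcs G1 -> arcs G)
    (A : {set arcs G1}) o q :
  injective h -> injective k ->
  (forall a, src (k a) = h (src a)) -> (forall a, tgt (k a) = h (tgt a)) ->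
  sp_set A o q -> sp_set (k @: A) (h o) (h q).
Proof.
move=> hI kI ks kt.
have inc (A' : {set arcs G1}) x : incident (k @: A') x -> exists2 y, x = h y & incident A' y.
  case/exists_inP=> _ /imsetP[a aA ->]; rewrite ks kt => /orP[]/eqP <-.
    by exists (src a); rewrite ?incident_src.
  by exists (tgt a); rewrite ?incident_tgt.
have dis (A1 A2 : {set arcs G1}) : [disjoint A1 & A2] -> [disjoint k @: A1 & k @: A2].
  move=> D; apply/pred0P=> b /=; apply/negbTE/andP=> -[/imsetP[a1 i1 ->] /imsetP[a2 i2 /kI E]].
  by move/pred0P/(_ a1): D; rewrite /= i1 E i2.
elim=> [a na|A1 A2 o' p q' _ S1 _ S2 D J|A1 A2 o' q' _ S1 _ S2 D J].
- rewrite imset_set1 -ks -kt; apply: sp_set_arc.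
  by rewrite ks kt (inj_eq hI).
- rewrite imsetU; apply: (sp_set_series S1 S2); first exact: dis.
  by move=> x /inc[y -> i1] /inc[z /hI <- i2]; rewrite (J y).
- rewrite imsetU; apply: (sp_set_parallel S1 S2); first exact: dis.
  by move=> x /inc[y -> i1] /inc[z /hI E]; rewrite -E => i2; case: (J y i1 i2) => ->; auto.
Qed.

(** In a gluing the arcs of both components become complementary sets, and the
    contracted vertices are the only ones they share. *)
Lemma gluing_parts (G1 G2 G : digraph) (R : verts G1 -> verts G2 -> Prop)
    (h1 : verts G1 -> verts G) (h2 : verts G2 -> verts G) o1 q1 o2 q2 :
  gluing R h1 h2 -> sp_set [set: arcs G1] o1 q1 -> sp_set [set: arcs G2] o2 q2 ->
  (forall x, incident [set: arcs G1] x) -> (forall x, incident [set: arcs G2] x) ->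
  exists A1 A2 : {set arcs G},
    [/\ sp_set A1 (h1 o1) (h1 q1), sp_set A2 (h2 o2) (h2 q2), [disjoint A1 & A2],
        A1 :|: A2 = [set: arcs G] &
        (forall v, incident (A1 :|: A2) v) /\
        forall v, incident A1 v -> incident A2 v ->
          exists x y, [/\ v = h1 x, v = h2 y & R x y]].
Proof.
case=> i1 i2 HR V [k [kb s1 t1 s2 t2]] S1 S2 I1 I2; have kI := bij_inj kb.
have [K1 K2] : injective (k \o inl) /\ injective (k \o inr).
  by split=> x y /= /kI [].
have inc1 x : incident ((k \o inl) @: [set: arcs G1]) (h1 x).
  case/exists_inP: (I1 x) => a _ H; apply/exists_inP; exists (k (inl a)).
    by apply/imsetP; exists a.
  by rewrite s1 t1 !(inj_eq i1).
have inc2 x : incident ((k \o inr) @: [set: arcs G2]) (h2 x).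
  case/exists_inP: (I2 x) => a _ H; apply/exists_inP; exists (k (inr a)).
    by apply/imsetP; exists a.
  by rewrite s2 t2 !(inj_eq i2).
exists ((k \o inl) @: [set: arcs G1]), ((k \o inr) @: [set: arcs G2]); split.
- exact: sp_set_morph i1 K1 s1 t1 S1.
- exact: sp_set_morph i2 K2 s2 t2 S2.
- by apply/pred0P=> b /=; apply/negbTE/andP=> -[/imsetP[a1 _ ->] /imsetP[a2 _ /kI]].
- case: kb => k' kk' k'k; apply/setP=> b; rewrite !inE; apply/orP.
  by rewrite -(k'k b); case: (k' b) => a; [left|right]; apply/imsetP; exists a.
- split=> v.
    by rewrite incidentU; case: (V v) => [[x ->]|[x ->]]; rewrite ?inc1 ?inc2 ?orbT.
  case/exists_inP=> _ /imsetP[a _ ->] E1 /exists_inP[_ /imsetP[b _ ->] E2].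
  have [x Ex] : exists x, v = h1 x.
    by move: E1; rewrite /= s1 t1 => /orP[]/eqP <-; eexists.
  have [y Ey] : exists y, v = h2 y.
    by move: E2; rewrite /= s2 t2 => /orP[]/eqP <-; eexists.
  by exists x, y; split=> //; apply/HR; rewrite -Ex -Ey.
Qed.

Lemma sp_digraph_sp_set (G : digraph) (o q : verts G) : sp_digraph o q ->
  sp_set [set: arcs G] o q /\ forall x, incident [set: arcs G] x.
Proof.
elim=> {G o q}.
- move=> G o q a oq V A so tq.
  have -> : [set: arcs G] = [set a] by apply/setP=> b; rewrite !inE (A b) eqxx.
  split=> [|x].
    by rewrite -so -tq; apply: sp_set_arc; rewrite so tq; apply/eqP.
  by rewrite incident_set1 so tq; case: (V x) => ->; rewrite eqxx ?orbT.
- move=> G1 G2 G o1 q1 o2 q2 h1 h2 _ [S1 I1] _ [S2 I2] Gl.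
  have [A1 [A2 [T1 T2 D <- [inc J]]]] := gluing_parts Gl S1 S2 I1 I2.
  have E : h1 q1 = h2 o2 by case: Gl => _ _ /(_ q1 o2)[_ -> //].
  split=> //; rewrite -E in T2; apply: (sp_set_series T1 T2 D) => v i1 i2.
  by have [x [y [-> _ [-> _]]]] := J v i1 i2.
- move=> G1 G2 G o1 q1 o2 q2 h1 h2 _ [S1 I1] _ [S2 I2] Gl.
  have [A1 [A2 [T1 T2 D <- [inc J]]]] := gluing_parts Gl S1 S2 I1 I2.
  have Eo : h1 o1 = h2 o2 by case: Gl => _ _ /(_ o1 o2)[_ -> //]; left.
  have Eq : h1 q1 = h2 q2 by case: Gl => _ _ /(_ q1 q2)[_ -> //]; right.
  split=> //; rewrite -Eo -Eq in T2; apply: (sp_set_parallel T1 T2 D) => v i1 i2.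
  by have [x [y [-> _ [[-> _]|[-> _]]]]] := J v i1 i2; auto.
Qed.

(** * Labels and the label tree *)

Section Reachability.
Variables (G : digraph) (s q : verts G).
Hypothesis Gsp : sp_digraph s q.
Implicit Types (x y z v w : verts G) (a : arcs G).

Lemma reaches_inT x y : reaches_in [set: arcs G] x y = reaches x y.
Proof.
apply: eq_connect => u v; apply/exists_inP/existsP => -[a].
  by exists a.
by exists a; rewrite ?inE.
Qed.

Lemma reaches_refl x : reaches x x. Proof. exact: connect0. Qed.

Lemma reaches_trans y x z : reaches x y -> reaches y z -> reaches x z.
Proof. exact: connect_trans. Qed.

Lemma reaches_arc a : reaches (src a) (tgt a).
Proof. by apply/connect1/existsP; exists a; rewrite !eqxx. Qed.

Lemma reaches_first x y : reaches x y -> x != y ->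
  exists2 a, src a = x & reaches (tgt a) y.
Proof.
case/connectP=> -[|z p] /=; first by move=> _ ->; rewrite eqxx.
case/andP=> /existsP[a /andP[/eqP ax /eqP az]] zp -> _; exists a => //.
by apply/connectP; exists p; rewrite az.
Qed.

Lemma reaches_last x y : reaches x y -> x != y ->
  exists2 a, tgt a = y & reaches x (src a).
Proof.
case/connectP=> p; case: (lastP p) => [|p' z] /=; first by move=> _ ->; rewrite eqxx.
rewrite rcons_path last_rcons => /andP[xp /existsP[a /andP[/eqP ax /eqP az]]] -> _.
by exists a => //; rewrite ax; apply/connectP; exists p'.
Qed.

Lemma acyclic a : reaches (tgt a) (src a) = false.
Proof.
rewrite -reaches_inT; apply/negbTE; have [S _] := sp_digraph_sp_set Gsp.
by apply: sp_set_acyclic S _; rewrite inE.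
Qed.

Lemma reaches_anti x y : reaches x y -> reaches y x -> x = y.
Proof.
move=> xy yx; apply/eqP/contraT => /(reaches_first xy)[a ax ay].
by have := acyclic a; rewrite ax (reaches_trans ay yx).
Qed.

Lemma origin_reaches x : reaches s x.
Proof.
have [S inc] := sp_digraph_sp_set Gsp.
by rewrite -reaches_inT; have [] := sp_set_reaches S (inc x).
Qed.

Lemma origin_no_in a : tgt a != s.
Proof.
apply/eqP=> E; have := acyclic a; by rewrite E origin_reaches.
Qed.

Lemma merge_vertex a w : ~~ reaches w (src a) -> ~~ reaches (tgt a) w ->
  exists p, [/\ p != w, reaches w p,
    forall z, reaches (tgt a) z -> reaches w z -> reaches p z &
    forall z, reaches w z -> reaches z p || reaches p z].
Proof.
rewrite -!reaches_inT => n1 n2.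
have [S inc] := sp_digraph_sp_set Gsp.
have [p [pw wp H1 H2]] := sp_set_merge S (in_setT a) (inc w) n1 n2.
exists p; split=> //; first by rewrite -reaches_inT.
  by move=> z; rewrite -!reaches_inT; exact: H1.
by move=> z; rewrite -!reaches_inT; exact: H2.
Qed.

(** Depth and height increase strictly along arcs in opposite directions and are
    less than the number of vertices: they bound the number of rounds after which
    values that propagate along arcs are final. *)
Definition depth x : nat := #|[set z | reaches z x] :\ x|.
Definition height x : nat := #|[set z | reaches x z] :\ x|.

Lemma depth_bound x : depth x < #|verts G|.
Proof.
rewrite -cardsT; apply/proper_card/properP; split; first exact: subsetT.
by exists x; rewrite ?inE ?eqxx.
Qed.

Lemma height_bound x : height x < #|verts G|.
Proof.
rewrite -cardsT; apply/proper_card/properP; split; first exact: subsetT.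
by exists x; rewrite ?inE ?eqxx.
Qed.

Lemma src_neq_tgt a : src a != tgt a.
Proof. by apply/eqP=> E; have := acyclic a; rewrite E reaches_refl. Qed.

Lemma depth_arc a : depth (src a) < depth (tgt a).
Proof.
apply/proper_card/properP; split; last first.
  by exists (src a); rewrite ?inE ?eqxx // src_neq_tgt reaches_arc.
apply/subsetP=> z; rewrite !inE => /andP[zs za].
rewrite (reaches_trans za (reaches_arc a)) andbT.
by apply/eqP=> E; have := acyclic a; rewrite -E za.
Qed.

Lemma height_arc a : height (tgt a) < height (src a).
Proof.
apply/proper_card/properP; split; last first.
  by exists (tgt a); rewrite ?inE ?eqxx // eq_sym src_neq_tgt reaches_arc.
apply/subsetP=> z; rewrite !inE => /andP[zs za].
rewrite (reaches_trans (reaches_arc a) za) andbT.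
by apply/eqP=> E; have := acyclic a; rewrite -E za.
Qed.
End Reachability.

Section Labels.
Variables (G : digraph) (L : finType) (I : instance G L) (s q : verts G).
Hypothesis Gsp : sp_digraph s q.
Hypothesis Isrc : unique_source I s.
Hypothesis Ipar : parallel_sinks I.
Implicit Types (x y z v w t : verts G) (a : arcs G).

Local Notation label := (label I).

Definition live x : bool := label x != set0.

(** Equivalent to [last_vertex], see [terminal_last], but only equality of labels
    occurs. *)
Definition terminal w : bool :=
  live w && [forall a, (src a == w) ==> (label (tgt a) != label w)].

Lemma mem_label t v : (t \in label v) = (t \in sinks I) && reaches v t.
Proof. by rewrite inE. Qed.

Lemma label_sub x y : reaches x y -> label y \subset label x.
Proof.
move=> xy; apply/subsetP=> t; rewrite !mem_label => /andP[-> yt].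
exact: reaches_trans xy yt.
Qed.

Lemma label_arc_sub a : label (tgt a) \subset label (src a).
Proof. exact/label_sub/reaches_arc. Qed.

Lemma liveP x : reflect (exists t, t \in label x) (live x).
Proof. exact: set0Pn. Qed.

Lemma live_reaches x y : reaches x y -> live y -> live x.
Proof. by move=> /label_sub /subsetP xy /liveP[t /xy tx]; apply/liveP; exists t. Qed.

Lemma label_sink t : t \in sinks I -> label t = [set t].
Proof.
move=> ts; apply/setP=> t'; rewrite mem_label inE.
have [->|n] := eqVneq t' t; first by rewrite ts reaches_refl.
apply/negbTE; rewrite negb_and; case: (boolP (t' \in sinks I)) => //= t's.
by apply: Ipar => //; rewrite eq_sym.
Qed.

Lemma terminal_live w : terminal w -> live w. Proof. by case/andP. Qed.

Lemma terminal_arc w a : terminal w -> src a = w -> label (tgt a) != label w.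
Proof. by case/andP=> _ /forallP/(_ a)/implyP H /eqP /H. Qed.

Lemma terminal_proper w y : terminal w -> reaches w y -> y != w ->
  label y \proper label w.
Proof.
move=> T wy; rewrite eq_sym => /(reaches_first wy)[a aw ay].
apply: (sub_proper_trans (label_sub ay)).
rewrite properEneq (terminal_arc T aw) -aw; exact: label_arc_sub.
Qed.

Lemma sink_terminal t : t \in sinks I -> terminal t.
Proof.
move=> ts; apply/andP; split.
  by apply/liveP; exists t; rewrite mem_label ts reaches_refl.
apply/forallP=> a; apply/implyP=> /eqP at_; apply/eqP=> E.
have : t \in label (tgt a) by rewrite E mem_label ts reaches_refl.
by rewrite mem_label -{2}at_ (acyclic Gsp) andbF.
Qed.

(** Terminal vertices are bottlenecks.  Otherwise the arc [a] is an alternative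
    to [w]; the vertex [p] where both merge lies before all sinks of [w], as a
    sink between [w] and [p] would reach the sink [t] behind [p].  So [p] has the
    label of [w], which is impossible behind a terminal vertex. *)
Lemma terminal_between w t a : terminal w -> t \in label w -> reaches (tgt a) t ->
  reaches w (src a) || reaches (tgt a) w.
Proof.
move=> T tw at_; apply/contraT; rewrite negb_or => /andP[n1 n2].
have [p [pw wp H1 H2]] := merge_vertex Gsp n1 n2.
move: (tw); rewrite mem_label => /andP[ts wt].
have pt := H1 t at_ wt.
have := terminal_proper T wp pw; rewrite properE => /andP[_] /negP[].
apply/subsetP=> t' /[dup] t'w; rewrite !mem_label => /andP[t's wt'].
rewrite t's /=; case/orP: (H2 _ wt') => // t'p.
have [-> //|n] := eqVneq t' t.
by have /negP[] := Ipar t's ts n; exact: reaches_trans t'p pt.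
Qed.

Lemma terminal_comparable w t x : terminal w -> t \in label w -> reaches x t ->
  reaches w x || reaches x w.
Proof.
move=> T tw xt; have [->|xs] := eqVneq x s; first by rewrite (origin_reaches Gsp) orbT.
rewrite eq_sym in xs; have [a ax sa] := reaches_last (origin_reaches Gsp x) xs.
rewrite -ax in xt *; case/orP: (terminal_between T tw xt) => [wa|->]; last by rewrite orbT.
by rewrite (reaches_trans wa (reaches_arc a)).
Qed.

Lemma terminal_above w x : terminal w -> live x -> label x \subset label w ->
  reaches w x || reaches x w.
Proof.
move=> T /liveP[t tx] /subsetP/(_ t tx) tw.
by apply: terminal_comparable T tw _; move: tx; rewrite mem_label => /andP[].
Qed.

Lemma terminal_inj w w' : terminal w -> terminal w' -> label w = label w' -> w = w'.
Proof.
move=> T T' E; apply/eqP/contraT => n.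
have sub : label w' \subset label w by rewrite E.
case/orP: (terminal_above T (terminal_live T') sub) => R.
  by rewrite eq_sym in n; have := terminal_proper T R n; rewrite E properxx.
by have := terminal_proper T' R n; rewrite E properxx.
Qed.

Lemma exists_terminal x : live x -> exists w,
  [/\ terminal w, reaches x w & label w = label x].
Proof.
have [n] := ubnP (height x); elim: n x => // n IH x hn lx.
have [T|] := boolP (terminal x); first by exists x; split=> //; exact: reaches_refl.
rewrite negb_and lx /= negb_forall => /existsP[a]; rewrite negb_imply negbK.
case/andP=> /eqP ax /eqP E.
have [||w [T R E']] := IH (tgt a).
- by have := height_arc Gsp a; rewrite ax => /leq_trans; apply.
- by rewrite /live E.
exists w; split=> //; last by rewrite E' E.
by apply: reaches_trans R; rewrite -ax reaches_arc.
Qed.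

Lemma terminal_of w x : terminal w -> label x = label w -> reaches x w.
Proof.
move=> T E; have lx : live x by rewrite /live E; exact: terminal_live.
have [w' [T' R E']] := exists_terminal lx.
by rewrite (terminal_inj T T') // E' E.
Qed.

Lemma terminal_arc_consecutive w a : terminal w -> src a = w -> live (tgt a) ->
  consecutive I w (tgt a).
Proof.
move=> T aw /[dup] lv /liveP[t ty].
rewrite /consecutive properEneq (terminal_arc T aw) -aw label_arc_sub /=.
apply/existsP=> -[z /andP[yz zw]].
have lz : live z.
  by apply/liveP; exists t; move: (proper_sub yz) => /subsetP; apply.
have [z' [Tz _ Ez]] := exists_terminal lz; rewrite -Ez in yz zw.
have tz : t \in label z' by move: (proper_sub yz) => /subsetP; apply.
have yt : reaches (tgt a) t by move: ty; rewrite mem_label => /andP[].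
case/orP: (terminal_between Tz tz yt) => /label_sub sub.
  by move: zw; rewrite properE sub andbF.
by move: yz; rewrite properE sub andbF.
Qed.

Lemma terminal_last w : terminal w = last_vertex I w.
Proof.
apply/idP/idP => [T|/andP[lw /forallP H]].
  apply/andP; split; first exact: terminal_live.
  by apply/forallP=> a; apply/implyP=> /andP[/eqP aw]; exact: terminal_arc_consecutive.
rewrite /terminal /live lw /=; apply/forallP=> a; apply/implyP=> aw.
have := H a; rewrite aw /=; case: eqVneq => /= [->|_ /andP[]].
  by move=> _; rewrite eq_sym.
by rewrite properEneq => /andP[].
Qed.

(** If the label changes at a vertex that is not terminal, the arc leads around
    the terminal vertex of the old label, against [terminal_between]. *)
Lemma label_arc a : live (tgt a) ->
  label (src a) = label (tgt a) \/ terminal (src a) /\ consecutive I (src a) (tgt a).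
Proof.
move=> lt; have ls := live_reaches (reaches_arc a) lt.
have [T|nT] := boolP (terminal (src a)).
  by right; split=> //; exact: terminal_arc_consecutive.
left; have [w [T R E]] := exists_terminal ls.
have /liveP[t tt] := lt; have tw : t \in label w.
  by rewrite E; move: (label_arc_sub a) => /subsetP; apply.
have yt : reaches (tgt a) t by move: tt; rewrite mem_label => /andP[].
case/orP: (terminal_between T tw yt) => R'.
  by rewrite (reaches_anti Gsp R R') T in nT.
by apply/eqP; rewrite eqEsubset label_arc_sub -E label_sub.
Qed.

(** The possible upper ends of tree arcs. *)
Definition block_start x : bool := (x == s) || terminal x.

Lemma inner_label a : live (tgt a) -> ~~ block_start (src a) -> label (src a) = label (tgt a).
Proof. by move=> /label_arc[//|[T _]]; rewrite /block_start T orbT. Qed.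

Lemma tree_arcP v w : tree_arc I s v w ->
  [/\ terminal w, w != s, block_start v, reaches v w & v != w] /\
  (v = s /\ label s = label w \/ terminal v /\ consecutive I v w).
Proof.
case/orP=> [/and4P[/eqP -> tw ws /eqP E]|/and3P[tv tw cvw]].
  have T : terminal w by move: tw; rewrite /tree_vertex (negbTE ws) terminal_last.
  split; last by left.
  by split=> //; rewrite ?(origin_reaches Gsp) /block_start ?eqxx // eq_sym.
have Tv : terminal v by rewrite terminal_last.
have pr : label w \proper label v by case/andP: cvw.
have ws : w != s.
  apply/eqP=> E; move: pr; rewrite properE => /andP[_] /negP[].
  by rewrite E label_sub // (origin_reaches Gsp).
have T : terminal w by move: tw; rewrite /tree_vertex (negbTE ws) terminal_last.
split; last by right.
have R : reaches v w.
  case/orP: (terminal_above Tv (terminal_live T) (proper_sub pr)) => // /label_sub sub.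
  by move: pr; rewrite properE sub andbF.
split=> //; first by rewrite /block_start Tv orbT.
by apply: contraTneq pr => ->; rewrite properxx.
Qed.

Lemma between_label v w x : tree_arc I s v w -> x \in between v w -> x != v ->
  label x = label w.
Proof.
case/tree_arcP=> -[T ws hv R vw] D; rewrite inE => /andP[vx xw] xv.
case: D => [[E Es]|[Tv /andP[_ /existsPn/(_ x)]]].
  by apply/eqP; rewrite eqEsubset -{1}Es !label_sub // -E.
rewrite (terminal_proper Tv vx xv) andbT properEneq label_sub // andbT negbK.
by move/eqP.
Qed.

(** Since [w] is the terminal vertex of its label, this makes the subgraphs of
    the tree arcs a partition of the arcs with live target. *)
Lemma between_arc v w a : tree_arc I s v w ->
  (src a \in between v w) && (tgt a \in between v w) = (label (tgt a) == label w).
Proof.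
move=> vw; have [[T ws hv R nvw] D] := tree_arcP vw; apply/andP/eqP => [[sb tb]|E].
  apply: (between_label vw tb); apply/eqP=> E.
  by move: sb; rewrite inE -E (acyclic Gsp).
have tw := terminal_of T E.
have vs : reaches v (src a).
  case: D => [[-> _]|[Tv /andP[pr _]]]; first exact: origin_reaches Gsp _.
  have /liveP[t tt] := terminal_live T.
  have tv : t \in label v by move: (proper_sub pr) => /subsetP; apply.
  have at_ : reaches (tgt a) t by move: tt; rewrite -E mem_label => /andP[].
  case/orP: (terminal_between Tv tv at_) => // /label_sub.
  by rewrite E; move: pr; rewrite properE => /andP[_ /negbTE ->].
by rewrite !inE vs tw (reaches_trans vs (reaches_arc a)) (reaches_trans (reaches_arc a) tw).
Qed.

Lemma tree_arc_uniq v v' w : tree_arc I s v w -> tree_arc I s v' w -> v = v'.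
Proof.
move=> /tree_arcP[[T ws _ R _] D] /tree_arcP[[_ _ _ R' _] D'].
have no x : label s = label w -> ~ consecutive I x w.
  move=> E /andP[]; rewrite -E properE => /andP[_ /negP[]].
  by rewrite label_sub // (origin_reaches Gsp).
case: D D' => [[-> E]|[Tv c]] [[-> E']|[Tv' c']] //.
- by case: (no _ E c').
- by case: (no _ E' c).
have /liveP[t tt] := terminal_live T.
have up x : reaches x w -> t \in label x by move=> /label_sub/subsetP; apply.
have low x y : terminal x -> consecutive I x w -> consecutive I y w -> reaches x y -> x = y.
  move=> Tx /andP[_ /existsPn/(_ y) cx] /andP[yw _] xy; apply/eqP/contraT => n.
  by rewrite eq_sym in n; move: cx; rewrite yw (terminal_proper Tx xy n).
have vt : reaches v' t by move: (up _ R'); rewrite mem_label => /andP[].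
by case/orP: (terminal_comparable Tv (up _ R) vt) => H; [|apply: esym]; exact: low H.
Qed.

Lemma start_tree_arc w a : terminal w -> w != s -> label (tgt a) = label w ->
  block_start (src a) -> tree_arc I s (src a) w.
Proof.
move=> T ws E hd; have lt : live (tgt a) by rewrite /live E; exact: terminal_live.
have tw : tree_vertex I s w by rewrite /tree_vertex -terminal_last T orbT.
rewrite /tree_arc tw ws /= -terminal_last.
have [Es|nE] := eqVneq (label (src a)) (label w).
  case/orP: hd => [/eqP E'|Ta]; first by rewrite E' -Es E' !eqxx.
  by have := terminal_arc Ta erefl; rewrite E Es eqxx.
case: (label_arc lt) => [E'|[-> c]]; first by rewrite E' E eqxx in nE.
by apply/orP; right; rewrite /consecutive -E.
Qed.

Lemma exists_tree_arc w : terminal w -> w != s -> exists v, tree_arc I s v w.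
Proof.
move=> T ws; suff H x : label x = label w -> x != s ->
    exists2 a, label (tgt a) = label w & block_start (src a).
  by have [a E hd] := H w erefl ws; exists (src a); exact: start_tree_arc.
have [n] := ubnP (depth x); elim: n x => // n IH x dx E xs.
rewrite eq_sym in xs; have [a ax _] := reaches_last (origin_reaches Gsp x) xs.
have [hd|nh] := boolP (block_start (src a)); first by exists a; rewrite ?ax.
apply: (IH (src a)).
- by have := depth_arc Gsp a; rewrite ax => H; exact: leq_trans H dx.
- by rewrite inner_label // ax ?E // /live E; exact: terminal_live.
- by apply: contra nh => /eqP ->; rewrite /block_start eqxx.
Qed.

Lemma beta_sum l w : ((beta I l w)%:Z = - \sum_(t in label w) bal I l t)%R.
Proof.
rewrite /beta -[Posz _]natz natr_sum -sumrN big_mkcondr; apply: eq_bigr => t.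
rewrite mem_label => /andP[ts _]; rewrite natz /is_sink; case: ltrP => [/ltr0_norm <-|ge].
  by rewrite abszE.
have [b0|] := ltrP 0%R (bal I l t); last by move=> le; have -> : bal I l t = 0%R by lia.
have Es : t = s by apply/eqP; rewrite -(Isrc l).
move: ts; rewrite inE => /existsP[l']; rewrite /is_sink Es.
have : (0 < bal I l' s)%R by rewrite Isrc eqxx.
by move=> /ltW; rewrite leNgt => /negbTE ->.
Qed.
End Labels.

(** * Flows along two paths and across tree arcs *)

Lemma bigmin_spec (L : finType) (d : L -> nat) (l0 : L) (k := \max_(l : L) d l) :
  (forall l, \big[minn/k]_(l1 : L) d l1 <= d l) /\
  exists l, \big[minn/k]_(l1 : L) d l1 = d l.
Proof.
have low l : \big[minn/k]_(l1 : L) d l1 <= d l.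
  have : l \in index_enum L by rewrite mem_index_enum.
  elim: (index_enum L) => // l' r IH; rewrite inE big_cons => /orP[/eqP <-|/IH lr].
    exact: geq_minl.
  by rewrite geq_min lr orbT.
split=> //.
have : \big[minn/k]_(l1 : L) d l1 = k \/ exists l, \big[minn/k]_(l1 : L) d l1 = d l.
  elim/big_ind: _ => [|x y Hx Hy|l _]; [by left| |by right; exists l].
  by rewrite /minn; case: ifP.
case=> // E; exists l0; apply/eqP; rewrite eqn_leq low E.
exact: (@leq_bigmax _ d l0).
Qed.

Section Walks.
Variable G : digraph.
Implicit Types (v w x : verts G) (p : seq (arcs G)).

Lemma walk_count v w p x : is_walk v w p ->
  count (fun a => src a == x) p + (x == w) = count (fun a => tgt a == x) p + (x == v).
Proof.
elim: p v => [|a p IH] v /=; first by move/eqP->.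
case/andP=> /eqP -> /IH E; rewrite -addnA E (eq_sym x v) (eq_sym x (tgt a)); lia.
Qed.

Lemma sum_mem_uniq p (P : pred (arcs G)) : uniq p ->
  \sum_(a | P a) (a \in p : nat) = count P p.
Proof.
move=> U; rewrite -sum1_count big_mkcond [in RHS]big_mkcond /=.
rewrite (big_uniq _ U) [in RHS]big_mkcond /=.
by apply: eq_bigr => a _; case: (a \in p); case: (P a).
Qed.

Lemma is_path_uniq v w p : is_path v w p -> uniq p.
Proof. by case/andP=> _ /= /andP[_ /map_uniq]. Qed.

Lemma sum_cost_mem (c : arcs G -> nat) p : uniq p ->
  \sum_a c a * (a \in p) = \sum_(a <- p) c a.
Proof.
move=> U; rewrite (big_uniq _ U) [in RHS]big_mkcond /=.
by apply: eq_bigr => a _; case: (a \in p); rewrite ?muln1 ?muln0.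
Qed.
End Walks.

Section TwoPaths.
Variables (G : digraph) (L : finType) (I : instance G L) (d : L -> nat).
Variables (v w : verts G) (pfix : seq (arcs G)) (opfree : option (seq (arcs G))).
Variable l0 : L.
Hypothesis Pfix : shortest_path I setT v w pfix.
Hypothesis Pfree : shortest_path_opt I (~: fixed I) v w opfree.

Let d0 := \max_(l1 : L) d l1.
Let m := \big[minn/d0]_(l1 : L) d l1.
Let pfree := odflt [::] opfree.

Definition fixed_amount : nat :=
  if (if opfree is Some p then path_cost I pfix < path_cost I p else true)
  then m else 0.

Lemma fixed_amount_le l : fixed_amount <= d l.
Proof. by rewrite /fixed_amount; case: ifP => // _; have [] := bigmin_spec d l0. Qed.

Lemma two_path_flowE l a : two_path_flow I d pfix opfree l a =
  fixed_amount * (a \in pfix) + (d l - fixed_amount) * (a \in pfree).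
Proof.
have ml : m <= d l by have [] := bigmin_spec d l0.
rewrite /two_path_flow /fixed_amount -/m -/pfree.
by case: ifP => _; case: (a \in pfix); case: (a \in pfree);
  rewrite ?muln1 ?muln0 ?addn0 ?add0n ?subn0 ?subnKC.
Qed.

Lemma pfix_walk : is_walk v w pfix /\ uniq pfix.
Proof. by case: Pfix => /andP[/[dup] /is_path_uniq ? /andP[]]. Qed.

Lemma pfree_uniq : uniq pfree.
Proof.
rewrite /pfree; case: opfree Pfree => //= p [/andP[/is_path_uniq]].
by [].
Qed.

(** Without a free path only the least demand [m] is sent, so the equations hold
    if all demands agree. *)
Lemma two_path_conserves l x : (opfree = None -> d l = m) ->
  \sum_(a | src a == x) two_path_flow I d pfix opfree l a + d l * (x == w) =
  \sum_(a | tgt a == x) two_path_flow I d pfix opfree l a + d l * (x == v).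
Proof.
move=> H; under eq_bigr do rewrite two_path_flowE.
under [X in _ = X + _]eq_bigr do rewrite two_path_flowE.
rewrite !big_split -!big_distrr /= !sum_mem_uniq ?pfree_uniq //; try by case: pfix_walk.
have le := fixed_amount_le l; have [W _] := pfix_walk.
have E := walk_count x W.
have [E0|E0] := eqVneq (d l - fixed_amount) 0.
  have -> : d l = fixed_amount by lia.
  by rewrite subnn !mul0n !addn0 -!mulnDr E.
have F : count (fun a => src a == x) pfree + (x == w) =
         count (fun a => tgt a == x) pfree + (x == v).
  apply: walk_count; rewrite /pfree; move: Pfree H E0; rewrite /fixed_amount.
  case: opfree => [p [/andP[/andP[]]]|] //= _ /(_ erefl) ->.
  by rewrite subnn eqxx.
have E1 := congr1 (muln fixed_amount) E.
have F1 := congr1 (muln (d l - fixed_amount)) F.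
by move: E1 F1; rewrite -{2 4}(subnKC le) !mulnDr !mulnDl; lia.
Qed.

Lemma two_path_fixed l l' a : a \in fixed I ->
  two_path_flow I d pfix opfree l a = two_path_flow I d pfix opfree l' a.
Proof.
move=> af; rewrite !two_path_flowE; suff -> : a \in pfree = false by rewrite !muln0.
apply/negbTE; rewrite /pfree; case: opfree Pfree => //= p [/andP[_ /allP H] _].
by apply/negP=> /H /=; rewrite in_setC af.
Qed.

Lemma two_path_cost l : flow_cost I (two_path_flow I d pfix opfree l) =
  fixed_amount * path_cost I pfix + (d l - fixed_amount) * path_cost I pfree.
Proof.
rewrite /flow_cost; under eq_bigr do rewrite two_path_flowE mulnDr !(mulnCA (cost I _)).
rewrite big_split -!big_distrr /= !sum_cost_mem ?pfree_uniq //.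
by case: pfix_walk.
Qed.
End TwoPaths.

Section Flows.
Variables (G : digraph) (L : finType) (I : instance G L) (s q : verts G).
Hypothesis Gsp : sp_digraph s q.
Hypothesis Isrc : unique_source I s.
Hypothesis Ipar : parallel_sinks I.
Hypothesis Ibal : balanced I.
Implicit Types (x y z v w t : verts G) (a : arcs G) (f : arcs G -> nat).

Local Notation label := (label I).

Lemma flow_into (b : verts G -> int) f (Z : {set verts G}) : is_flow b f ->
  (forall a, src a \in Z -> tgt a \in Z) ->
  ((\sum_(a | (tgt a \in Z) && (src a \notin Z)) f a)%:Z = - \sum_(x in Z) b x)%R.
Proof.
move=> F clos.
have by_end (e : arcs G -> verts G) :
    \sum_(a | e a \in Z) f a = \sum_(x in Z) \sum_(a | e a == x) f a.
  rewrite (partition_big e (mem Z)) //=; apply: eq_bigr => x xZ.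
  by apply: eq_bigl => a; case: eqVneq => [->|]; rewrite ?xZ ?andbF.
have -> : (\sum_(x in Z) b x =
    (\sum_(a | src a \in Z) f a)%N%:Z - (\sum_(a | tgt a \in Z) f a)%N%:Z)%R.
  rewrite !by_end !(big_morph Posz PoszD erefl) -sumrB.
  by apply: eq_bigr => x _; rewrite -F.
have -> : \sum_(a | tgt a \in Z) f a = \sum_(a | src a \in Z) f a +
    \sum_(a | (tgt a \in Z) && (src a \notin Z)) f a.
  rewrite (bigID (fun a => src a \in Z)) /=; congr (_ + _); apply: eq_bigl => a.
  by case: (boolP (src a \in Z)) => [/clos ->|_]; rewrite ?andbF.
by rewrite PoszD; ring.
Qed.

Lemma bal_nonsink l x : x != s -> x \notin sinks I -> bal I l x = 0%R.
Proof.
move=> xs; rewrite inE => /existsPn/(_ l); rewrite /is_sink -leNgt => ge.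
by apply/eqP; rewrite eq_le ge andbT leNgt Isrc.
Qed.

Lemma source_not_sink : s \notin sinks I.
Proof.
rewrite inE; apply/existsP=> -[l']; rewrite /is_sink; apply/negP; rewrite -leNgt ltW //.
by rewrite Isrc eqxx.
Qed.

(** The flow that enters the vertices behind [a] has to be absorbed by sinks. *)
Lemma dead_arc l f a : is_flow (bal I l) f -> ~~ live I (tgt a) -> f a = 0.
Proof.
move=> F da; pose Z := [set z | reaches (tgt a) z].
have clos b : src b \in Z -> tgt b \in Z.
  by rewrite !inE => /reaches_trans; apply; exact: reaches_arc.
have := flow_into F clos; have : (0 <= \sum_(x in Z) bal I l x)%R.
  apply: sumr_ge0 => x; rewrite inE leNgt => R; apply: contra da => neg.
  apply/liveP; exists x; rewrite mem_label R andbT inE.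
  by apply/existsP; exists l.
rewrite (bigD1 a) /=; last by rewrite !inE reaches_refl (acyclic Gsp).
by move=> ? ?; lia.
Qed.

(** By [between_arc] these are the arcs of the subgraph spanned by the tree arc
    ending in [w]. *)
Definition tree_block w : {set arcs G} := [set a | label (tgt a) == label w].

Lemma tree_block_sp v w : tree_arc I s v w -> sp_set (tree_block w) v w.
Proof.
move=> vw; have [[_ _ _ R nvw] _] := tree_arcP Gsp Ipar vw.
have [S inc] := sp_digraph_sp_set Gsp.
suff -> : tree_block w = block [set: arcs G] v w.
  by apply: sp_set_block S _ _ nvw _ => //; rewrite reaches_inT.
apply/setP=> a; rewrite !inE -(between_arc Gsp Ipar a vw) !inE !reaches_inT /=.
case: (boolP (reaches v (src a))) => //= va; case: (boolP (reaches (tgt a) w)) => aw.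
  by rewrite (reaches_trans (reaches_arc a) aw) (reaches_trans va (reaches_arc a)).
by rewrite !andbF.
Qed.

(** All flow to the sinks behind [w] passes first through [v] and then through
    [w], and no other flow enters the subgraph spanned by them. *)
Lemma flow_restrict l f v w : is_flow (bal I l) f -> tree_arc I s v w ->
  conserves (tree_block w) v w (beta I l w) f.
Proof.
move=> F vw; have [[T ws hv R nvw] D] := tree_arcP Gsp Ipar vw.
have lw := terminal_live T.
have betw a : a \in tree_block w -> (src a \in between v w) && (tgt a \in between v w).
  by rewrite inE (between_arc Gsp Ipar a vw).
apply: (@conserves_missing _ _ _ _ _ _ w) => x xw; rewrite (negbTE xw) muln0 addn0.
have [xb|nxb] := boolP (x \in between v w); last first.
  rewrite big1 => [|a /andP[/betw/andP[sb _] /eqP E]]; last by rewrite -E sb in nxb.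
  rewrite big1 => [|a /andP[/betw/andP[_ tb] /eqP E]]; last by rewrite -E tb in nxb.
  case: eqVneq => [E|]; last by rewrite muln0.
  by move: nxb; rewrite E inE reaches_refl R.
have dead_out : label x = label w ->
    \sum_(a in tree_block w | src a == x) f a = \sum_(a | src a == x) f a.
  move=> Ex; rewrite [RHS](bigID (mem (tree_block w))) /=.
  rewrite [X in _ = _ + X]big1 ?addn0 => [|a /andP[/eqP ax nb]].
    by apply: eq_bigl => a; rewrite andbC.
  apply: (dead_arc F); apply: contra nb => lt; rewrite inE; apply/eqP.
  have [<-|[Tx _]] := label_arc Gsp Ipar lt; first by rewrite ax.
  rewrite ax in Tx; have E := terminal_inj Gsp Ipar Tx T Ex.
  by rewrite E eqxx in xw.
have [Exv|xv] := eqVneq x v; last first.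
  rewrite muln0 addn0; have Ex := between_label Gsp Ipar vw xb xv.
  rewrite (dead_out Ex).
  have -> : \sum_(a in tree_block w | tgt a == x) f a = \sum_(a | tgt a == x) f a.
    apply: eq_bigl => a; rewrite inE; case: (eqVneq (tgt a) x) => [->|_].
      by rewrite Ex eqxx.
    by rewrite andbF.
  have := F x; rewrite bal_nonsink; first by move/eqP; rewrite subr_eq0 eqz_nat => /eqP ->.
    apply: contra xv => /eqP E; apply/eqP; apply: (reaches_anti Gsp).
      by rewrite E (origin_reaches Gsp).
    by move: xb; rewrite inE => /andP[].
  apply: contra xw => xS; have Tx := sink_terminal Gsp xS.
  by apply/eqP; exact: (terminal_inj Gsp Ipar Tx T Ex).
subst x; rewrite muln1 [X in _ = X + _]big1 ?add0n => [|a /andP[/betw/andP[sb _] /eqP E]];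
  last by move: sb; rewrite inE -E (acyclic Gsp).
apply/eqP; rewrite -(eqr_nat int) !natz (beta_sum Isrc).
case: D => [[E Es]|[Tv /andP[pr _]]].
  subst v; rewrite (dead_out Es).
  have := F s; rewrite [X in (_ - Posz X)%R]big1 => [|a]; last first.
    by rewrite (negbTE (origin_no_in Gsp a)).
  rewrite subr0 => ->; rewrite -Es; apply/eqP.
  have := Ibal l; rewrite (bigID (mem (label s))) /= [X in (_ + X = _)%R](bigD1 s) /=; last first.
    by rewrite mem_label (negbTE (source_not_sink)).
  rewrite [X in (_ + (_ + X) = _)%R]big1 => [|x /andP[xl xs]].
    by rewrite addr0 addrC => /eqP; rewrite addr_eq0 => /eqP.
  apply: bal_nonsink xs _; apply: contra xl => xS.
  by rewrite mem_label xS (origin_reaches Gsp).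
pose Z := [set x | label x \subset label w].
have clos a : src a \in Z -> tgt a \in Z.
  by rewrite !inE; apply: subset_trans; exact: label_arc_sub.
have -> : (\sum_(t in label w) bal I l t = \sum_(x in Z) bal I l x)%R.
  rewrite big_mkcond [RHS]big_mkcond; apply: eq_bigr => x _; rewrite [x \in Z]inE.
  case: ifP => [xw'|/negbT xw'].
    by rewrite label_sub //; move: xw'; rewrite mem_label => /andP[].
  case: ifP => // /[dup] /subsetP sub sub'; rewrite bal_nonsink //.
    apply: contraTneq sub' => ->; apply/negP=> sub'.
    move: pr; rewrite properE => /andP[_] /negP[]; apply: subset_trans sub'.
    exact: label_sub (origin_reaches Gsp v).
  by apply: contra xw' => xS; apply: sub; rewrite mem_label xS reaches_refl.
rewrite -(flow_into F clos) eqz_nat; apply/eqP.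
rewrite big_mkcond [RHS]big_mkcond; apply: eq_bigr => a _.
have [la|/(dead_arc F) ->] := boolP (live I (tgt a)); last by case: ifP; case: ifP.
congr (if _ then _ else _); rewrite !inE; apply/andP/andP => -[].
  move=> /eqP E /eqP ->; rewrite E subxx; split=> //.
  by move: pr; rewrite properE => /andP[].
move=> sub nsub; have /liveP[t tt] := la.
have tw : t \in label w by move/subsetP: sub; apply.
have at_ : reaches (tgt a) t by move: tt; rewrite mem_label => /andP[].
have E : label (tgt a) = label w.
  case/orP: (terminal_between Gsp Ipar T tw at_) => /label_sub sub'.
    by rewrite sub' in nsub.
  by apply/eqP; rewrite eqEsubset sub sub'.
rewrite E eqxx; split=> //; apply/eqP.
apply: (@tree_arc_uniq _ _ _ _ _ Gsp Ipar _ _ w) vw.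
apply: (start_tree_arc Gsp Ipar T ws E).
case: (label_arc Gsp Ipar la) => [E'|[Ta _]]; last by rewrite /block_start Ta orbT.
by rewrite E' E subxx in nsub.
Qed.
End Flows.

(** * Optimality *)

Section Spanned.
Variables (G : digraph) (v w : verts G).
Implicit Types (a : arcs G) (b : arcs (spanned v w)) (u : verts (spanned v w)).

Definition inner a : bool := (src a \in between v w) && (tgt a \in between v w).

Lemma inner_val b : inner (val b). Proof. exact: valP b. Qed.

Lemma sum_spanned (F : arcs G -> nat) (P : pred (arcs G)) :
  \sum_(b : arcs (spanned v w) | P (val b)) F (val b) =
  \sum_(a | inner a && P a) F a.
Proof.
rewrite [RHS](reindex_omap (val : arcs (spanned v w) -> arcs G) insub).
  by apply: eq_bigl => b; rewrite inner_val valK eqxx andbT.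
by move=> a /andP[ia _]; rewrite insubT.
Qed.

Lemma extend_val (g : arcs (spanned v w) -> nat) b : extend g (val b) = g b.
Proof. by rewrite /extend valK. Qed.

Lemma extend_out (g : arcs (spanned v w) -> nat) a : ~~ inner a -> extend g a = 0.
Proof. by move=> na; rewrite /extend insubN. Qed.

Lemma extend_restrict (f : arcs G -> nat) a : inner a ->
  extend (fun b : arcs (spanned v w) => f (val b)) a = f a.
Proof. by move=> ia; rewrite /extend insubT. Qed.

Lemma sum_extend_src (g : arcs (spanned v w) -> nat) u :
  \sum_(b | src b == u) g b = \sum_(a | inner a && (src a == val u)) extend g a.
Proof.
rewrite -sum_spanned; apply: eq_big => [b|b _]; last by rewrite extend_val.
by rewrite -val_eqE.
Qed.

Lemma sum_extend_tgt (g : arcs (spanned v w) -> nat) u :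
  \sum_(b | tgt b == u) g b = \sum_(a | inner a && (tgt a == val u)) extend g a.
Proof.
rewrite -sum_spanned; apply: eq_big => [b|b _]; last by rewrite extend_val.
by rewrite -val_eqE.
Qed.

Lemma walk_val u u' (p : seq (arcs (spanned v w))) :
  is_walk u u' p -> is_walk (val u) (val u') [seq val b | b <- p].
Proof.
elim: p u => [|b p IH] u /=; first by move/eqP->.
by case/andP=> /eqP <- /IH ->; rewrite eqxx.
Qed.

Lemma walk_lift u u' (p : seq (arcs G)) :
  is_walk (val u) (val u') p -> all inner p ->
  exists2 p', is_walk u u' p' & [seq val b | b <- p'] = p.
Proof.
elim: p u => [|a p IH] u /=.
  by move/eqP/val_inj=> ->; exists [::]; rewrite /= ?eqxx.
case/andP=> /eqP au W /andP[ia ip]; pose b : arcs (spanned v w) := Sub a ia.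
have [p' W' E] := IH (tgt b) W ip; exists (b :: p'); last by rewrite /= E.
by rewrite /= W' andbT -val_eqE /= au.
Qed.
End Spanned.

Section Optimality.
Variables (G : digraph) (L : finType) (I : instance G L) (s q : verts G) (l0 : L).
Hypothesis Gsp : sp_digraph s q.
Hypothesis Isrc : unique_source I s.
Hypothesis Ipar : parallel_sinks I.
Hypothesis Ibal : balanced I.
Implicit Types (x y z v w t : verts G) (a : arcs G) (f : arcs G -> nat).

Lemma walk_path v w (p : seq (arcs G)) : is_walk v w p -> is_path v w p.
Proof.
move=> W; rewrite /is_path W /=; have [] : uniq [seq tgt a | a <- p] /\
    forall x, x \in [seq tgt a | a <- p] -> reaches v x && (v != x).
  elim: p v W => [|a p IH] v //= /andP[/eqP <- /IH[U R]]; split.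
    by rewrite U andbT; apply/negP=> /R; rewrite eqxx andbF.
  move=> x; rewrite inE => /orP[/eqP ->|/R/andP[ax _]].
    by rewrite reaches_arc (src_neq_tgt Gsp).
  rewrite (reaches_trans (reaches_arc a) ax).
  by apply/eqP=> E; have := acyclic Gsp a; rewrite E ax.
by move=> -> R; rewrite andbT; apply/negP=> /R; rewrite eqxx andbF.
Qed.

Section TreeArc.
Variables (v w : verts G).
Hypothesis vw : tree_arc I s v w.

Let J := sub_instance I v w.

Lemma inner_block a : inner v w a = (a \in tree_block I w).
Proof. by rewrite /inner (between_arc Gsp Ipar a vw) inE. Qed.

Lemma sub_walk_path (o t : verts (spanned v w)) p : is_walk o t p -> is_path o t p.
Proof.
move=> W; have /andP[_] := walk_path (walk_val W).
by rewrite /is_path W -map_comp -(map_inj_uniq val_inj) /= -map_comp.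
Qed.

Lemma sub_bal l (u : verts (spanned v w)) : bal J l u =
  ((beta I l w * (val u == v))%N%:Z - (beta I l w * (val u == w))%N%:Z)%R.
Proof.
have [[_ _ _ R nvw] _] := tree_arcP Gsp Ipar vw.
rewrite /=; case: eqVneq => [->|_]; first by rewrite (negbTE nvw) muln0 muln1 subr0.
by case: eqVneq => _; rewrite ?muln0 ?muln1 sub0r ?oppr0.
Qed.

Lemma sub_flowP l (g : arcs (spanned v w) -> nat) :
  is_flow (bal J l) g <-> conserves (tree_block I w) v w (beta I l w) (extend g).
Proof.
have [[_ _ _ R nvw] _] := tree_arcP Gsp Ipar vw.
have Eb (e : arcs G -> verts G) x : \sum_(a in tree_block I w | e a == x) extend g a =
    \sum_(a | inner v w a && (e a == x)) extend g a.
  by apply: eq_bigl => a; rewrite inner_block.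
split=> H x.
  have [xb|nxb] := boolP (x \in between v w).
    have := H (Sub x xb); rewrite sub_bal sum_extend_src sum_extend_tgt SubK -!Eb.
    by move=> ?; lia.
  rewrite !Eb !big1 => [|a|a].
  - have /negbTE -> : x != w by apply: contra nxb => /eqP ->; rewrite inE R reaches_refl.
    have /negbTE -> // : x != v.
    by apply: contra nxb => /eqP ->; rewrite inE R reaches_refl.
  - by case/andP=> /andP[_ tb] /eqP E; rewrite -E tb in nxb.
  - by case/andP=> /andP[sb _] /eqP E; rewrite -E sb in nxb.
rewrite sub_bal sum_extend_src sum_extend_tgt; have := H (val x); rewrite !Eb.
by move=> ?; lia.
Qed.

Lemma sub_cost (g : arcs (spanned v w) -> nat) :
  flow_cost J g = \sum_(a in tree_block I w) cost I a * extend g a.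
Proof.
rewrite /flow_cost (eq_bigl (fun a => inner v w a && true)) => [|a]; last first.
  by rewrite inner_block andbT.
by rewrite -sum_spanned; apply: eq_bigr => b _; rewrite extend_val.
Qed.

Lemma sub_restrict (g : L -> arcs G -> nat) : robust_flow I g ->
  robust_flow J (fun l b => g l (val b)).
Proof.
case=> F R; split=> [l|b]; last by rewrite inE => bf l l'; exact: R.
apply/sub_flowP=> x; have := flow_restrict Gsp Isrc Ipar Ibal (F l) vw x.
congr (_ + _ = _ + _); apply: eq_bigr => a /andP[ab _];
  by rewrite extend_restrict // inner_block.
Qed.

Lemma sub_fixed (g : L -> arcs (spanned v w) -> nat) l l' : robust_flow J g ->
  forall a, a \in fixed I -> extend (g l) a = extend (g l') a.
Proof.
case=> _ R a af; have [ia|na] := boolP (inner v w a); last by rewrite !extend_out.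
by rewrite /extend insubT; apply: R; rewrite inE.
Qed.

(** The lower bound of [sp_flow_bound], applied with a scenario [l1] of least
    demand as the second flow, is the cost of the two-path flow.  Feasibility of
    the whole instance is needed if there is no free path: all demands then have
    to agree. *)
Lemma sub_optimal (f : L -> arcs (spanned v w) -> nat) : feasible I -> step2 I f ->
  scenariowise_optimal J f.
Proof.
case=> g0 /sub_restrict R0 [o [t [ov tw [pfix [opfree [Pfix Pfree fE]]]]]].
have [[_ _ _ R nvw] _] := tree_arcP Gsp Ipar vw.
have lift (B : {set arcs G}) p : walk_in B v w p -> B \subset tree_block I w ->
    exists p', [/\ is_path o t p', all (mem [set b | val b \in B]) p' & path_cost J p' = wcost (cost I) p].
  case/andP=> W /allP AB /subsetP sub; have [||p' W' E] := @walk_lift _ v w o t p.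
  - by rewrite ov tw.
  - by apply/allP=> a /AB /sub; rewrite inner_block.
  exists p'; split; first exact: sub_walk_path.
    apply/allP=> b bp; rewrite /= inE; apply: AB.
    by rewrite -E; apply/mapP; exists b.
  by rewrite /wcost -E big_map.
have [pf Wf B] := sp_flow_bound (cost I) (fixed I) (tree_block_sp Gsp Ipar vw).
have [pf' [Pf' _ cf]] := lift _ _ Wf (subxx _).
have le_fix : path_cost J pfix <= wcost (cost I) pf.
  by rewrite -cf; apply: Pfix.2; rewrite Pf' /=; apply/allP=> b _; rewrite /= inE.
pose d l := beta I l w; pose d0 := \max_(l : L) d l.
pose m := \big[minn/d0]_(l : L) d l.
have [l1 El1] : exists l, m = d l by have [] := bigmin_spec d l0.
have low l : m <= d l by have [] := bigmin_spec d l0.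
have le_free pr : walk_in (tree_block I w :\: fixed I) v w pr ->
    exists2 p, opfree = Some p & path_cost J p <= wcost (cost I) pr.
  case/lift=> [|pr' [Ppr Apr cr]]; first exact: subsetDl.
  have Q : is_path o t pr' && all (mem (~: fixed J)) pr'.
    rewrite Ppr; apply/allP=> b /(allP Apr) /=; rewrite !inE.
    by case/andP.
  move: Pfree; case: (opfree) => [p [_ H]|/(_ pr')]; last by rewrite Q.
  by exists p => //; rewrite -cr; exact: H.
have bound g l : robust_flow J g -> conserves (tree_block I w) v w (d l) (extend (g l)).
  by case=> F _; apply/sub_flowP.
have rigid : opfree = None -> forall l, d l = m.
  move=> E l; rewrite El1; case: B => [[pr [Wr _ _]]|B].
    by have [p] := le_free pr Wr; rewrite E.
  by have [] := B _ _ _ _ (bound _ l R0) (bound _ l1 R0) (sub_fixed l l1 R0).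
have costs g l : robust_flow J g -> flow_cost J (f l) <= flow_cost J (g l).
  move=> Rg; have -> : flow_cost J (f l) = flow_cost J (two_path_flow J d pfix opfree l).
    by apply: eq_bigr => b _; rewrite fE.
  rewrite (two_path_cost _ l0 Pfix Pfree) sub_cost /fixed_amount -/d0 -/m.
  case: B => [[pr [Wr le B]]|B].
    have [p E le_p] := le_free pr Wr; rewrite E /=.
    have := B _ _ _ _ (bound _ l Rg) (bound _ l1 Rg) (sub_fixed l l1 Rg).
    rewrite -El1; have -> : minn (d l) m = m by apply/minn_idPr.
    apply: leq_trans; case: ifP => [_|/negbT].
      by apply: leq_add; rewrite leq_mul2l ?le_fix ?le_p orbT.
    rewrite -leqNgt mul0n add0n subn0 => le'.
    rewrite -{1}(subnKC (low l)) mulnDl.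
    apply: leq_add; rewrite leq_mul2l ?le_p ?orbT //.
    by rewrite (leq_trans le' le_fix) orbT.
  have [E] := B _ _ _ _ (bound _ l Rg) (bound _ l1 Rg) (sub_fixed l l1 Rg).
  apply: leq_trans; rewrite E -El1; case: ifP => [_|].
    by rewrite subnn mul0n addn0 leq_mul2l le_fix orbT.
  rewrite mul0n add0n subn0; case: (opfree) => [p /negbT|//] /=.
  by rewrite -leqNgt leq_mul2l => le'; rewrite (leq_trans le' le_fix) orbT.
have Rf : robust_flow J f.
  split=> [l u|b bf l l']; last first.
    by rewrite !fE; exact: (two_path_fixed d pfix l0 Pfree).
  have := two_path_conserves (d := d) l0 Pfix Pfree u (fun E => rigid E l).
  rewrite (eq_bigr (f l)) => [|b _]; last by rewrite fE.
  rewrite [X in _ = X + _](eq_bigr (f l)) => [|b _]; last by rewrite fE.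
  have -> : (u == t) = (val u == w) by rewrite -[RHS](congr1 (eq_op (val u)) tw).
  have -> : (u == o) = (val u == v) by rewrite -[RHS](congr1 (eq_op (val u)) ov).
  by rewrite sub_bal -/(d l) => ?; lia.
split; last by move=> g Rg l; exact: costs.
split=> // g Rg; apply/bigmax_leqP => l _.
apply: leq_trans (costs g l Rg) _.
exact: (@leq_bigmax _ (fun l => flow_cost J (g l)) l).
Qed.
End TreeArc.

(** An arc with live target lies in the block of exactly one tree arc, and the
    other arcs carry no flow. *)
Lemma sum_tree_blocks f (P : pred (arcs G)) :
  (forall a, ~~ live I (tgt a) -> f a = 0) ->
  \sum_(e : verts G * verts G | tree_arc I s e.1 e.2)
     \sum_(a in tree_block I e.2 | P a) f a = \sum_(a | P a) f a.
Proof.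
move=> dead; rewrite (exchange_big_dep P) /=; last by move=> e a _ /andP[].
apply: eq_bigr => a Pa; rewrite Pa.
have [la|/[dup] nl /dead ->] := boolP (live I (tgt a)); last by rewrite big1.
have [w [T R E]] := exists_terminal Gsp la.
have ws : w != s.
  apply/eqP=> Es; case/eqP: (origin_no_in Gsp a).
  by apply: (reaches_anti Gsp) => //; [rewrite -Es|exact: origin_reaches Gsp _].
have [v vw] := exists_tree_arc Gsp Ipar T ws.
rewrite (big_pred1 (v, w)) => [|[v' w'] /=]; first by [].
rewrite andbT inE; apply/andP/eqP => [[vw' /eqP E']|[-> ->]]; last by rewrite E.
have [[T' _ _ _ _] _] := tree_arcP Gsp Ipar vw'.
have Ew : w' = w by apply: (terminal_inj Gsp Ipar T' T); rewrite E.
by subst w'; rewrite (tree_arc_uniq Gsp Ipar vw' vw).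
Qed.

(** The balances of the sum are right because the restrictions of an arbitrary
    feasible flow have the same balances on each subgraph and add up to that
    flow; so the children of a vertex of the label tree need not be compared. *)
Lemma label_tree_optimal (f : L -> arcs G -> nat) : feasible I ->
  label_tree_result I s f -> optimal I f.
Proof.
move=> feas [F [Fstep fE]]; have [g0 R0] := feas.
have opt v w : tree_arc I s v w -> scenariowise_optimal (sub_instance I v w) (F v w).
  by move=> vw; apply: sub_optimal => //; exact: Fstep.
have dead g l : robust_flow I g -> forall a, ~~ live I (tgt a) -> g l a = 0.
  by case=> Fl _ a; exact: (dead_arc Gsp (Fl l)).
have ext_block v w (h : arcs (spanned v w) -> nat) (c : arcs G -> nat) (P : pred (arcs G)) :
    tree_arc I s v w ->
    \sum_(a | P a) c a * extend h a = \sum_(a in tree_block I w | P a) c a * extend h a.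
  move=> vw; rewrite (bigID (mem (tree_block I w))) /= [X in _ + X]big1 ?addn0.
    by apply: eq_bigl => a; rewrite andbC.
  by move=> a /andP[_ nb]; rewrite extend_out ?muln0 // (inner_block vw).
have sumE l (c : arcs G -> nat) (P : pred (arcs G)) : \sum_(a | P a) c a * f l a =
    \sum_(e : verts G * verts G | tree_arc I s e.1 e.2)
      \sum_(a in tree_block I e.2 | P a) c a * extend (F e.1 e.2 l) a.
  under eq_bigr do rewrite fE big_distrr /=.
  by rewrite exchange_big; apply: eq_bigr => -[v w] vw; exact: ext_block.
have Rf : robust_flow I f.
  split=> [l x|a af l l'].
    have sum1 P : \sum_(a | P a) f l a =
        \sum_(e : verts G * verts G | tree_arc I s e.1 e.2)
          \sum_(a in tree_block I e.2 | P a) extend (F e.1 e.2 l) a.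
      have := sumE l (fun=> 1) P; under eq_bigr do rewrite mul1n.
      move=> ->; apply: eq_bigr => e _; apply: eq_bigr => a _; by rewrite mul1n.
    have := R0.1 l x; rewrite -!(sum_tree_blocks _ (dead _ l R0)) !sum1 => <-.
    suff : \sum_(e : verts G * verts G | tree_arc I s e.1 e.2)
        (\sum_(a in tree_block I e.2 | src a == x) extend (F e.1 e.2 l) a +
         \sum_(a in tree_block I e.2 | tgt a == x) g0 l a) =
      \sum_(e : verts G * verts G | tree_arc I s e.1 e.2)
        (\sum_(a in tree_block I e.2 | tgt a == x) extend (F e.1 e.2 l) a +
         \sum_(a in tree_block I e.2 | src a == x) g0 l a).
      rewrite !big_split /=; lia.
    apply: eq_bigr => -[v w] /= vw.
    have /(_ x) := flow_restrict Gsp Isrc Ipar Ibal (R0.1 l) vw.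
    have [[[Fl _] _] _] := opt v w vw.
    by have /(_ x) := (sub_flowP vw l _).1 (Fl l); lia.
  rewrite !fE; apply: eq_bigr => -[v w] /= vw.
  have [[RF _] _] := opt v w vw; exact: sub_fixed RF _ af.
split=> // g Rg; apply/bigmax_leqP => l _.
apply: leq_trans (@leq_bigmax _ (fun l => flow_cost I (g l)) l).
rewrite /flow_cost sumE -(sum_tree_blocks (f := fun a => cost I a * g l a)) => [|a].
  apply: leq_sum => -[v w] /= vw; have [_ le] := opt v w vw.
  have := le _ (sub_restrict vw Rg) l; rewrite !(sub_cost vw).
  rewrite [X in _ <= X -> _](eq_bigr (fun a => cost I a * g l a)) => [|a ab].
    have drop h : \sum_(a in tree_block I w | true) h a = \sum_(a in tree_block I w) h a.
      by apply: eq_bigl => a; rewrite andbT.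
    by rewrite !drop.
  by rewrite extend_restrict // inner_block.
by move/(dead g l Rg) => ->; rewrite muln0.
Qed.
End Optimality.

(** * Programs with counting loops *)

(** While-programs whose loops run over one of the dimensions stored in bank 0.
    They always terminate, so their effect is a function on memories. *)
Inductive prog :=
| PSkip
| PStore (x : nat) (i e : expr)
| PSeq (c1 c2 : prog)
| PIf (e1 e2 : expr) (c1 c2 : prog)
| PFor (i d : nat) (c : prog).

Definition Var (x : nat) : expr := Cell x (Lit 0).

Fixpoint compile (c : prog) : cmd :=
  match c with
  | PSkip => Skip
  | PStore x i e => Store x i e
  | PSeq c1 c2 => Seq (compile c1) (compile c2)
  | PIf e1 e2 c1 c2 => If e1 e2 (compile c1) (compile c2)
  | PFor i d c =>
      Seq (Store i (Lit 0) (Lit 0))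
          (While (Plus (Var i) (Lit 1)) (Cell 0 (Lit d%:Z))
             (Seq (compile c) (Store i (Lit 0) (Plus (Var i) (Lit 1)))))
  end.

Fixpoint sem (c : prog) (M : memory) : memory :=
  match c with
  | PSkip => M
  | PStore x i e => update M x `|eval M i|%N (eval M e)
  | PSeq c1 c2 => sem c2 (sem c1 M)
  | PIf e1 e2 c1 c2 => if (eval M e1 <= eval M e2)%R then sem c1 M else sem c2 M
  | PFor i d c =>
      iter `|M 0 d|%N (fun M' => update (sem c M') i 0 (sem c M' i 0 + 1)%R)
           (update M i 0 0%R)
  end.

Fixpoint writes (c : prog) : seq nat :=
  match c with
  | PSkip => [::]
  | PStore x _ _ => [:: x]
  | PSeq c1 c2 | PIf _ _ c1 c2 => writes c1 ++ writes c2
  | PFor i _ c => i :: writes c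
  end.

(** Loop counters are not changed by the loop body and dimensions are never
    changed. *)
Fixpoint well_formed (c : prog) : bool :=
  match c with
  | PSkip => true
  | PStore x _ _ => x != 0
  | PSeq c1 c2 | PIf _ _ c1 c2 => well_formed c1 && well_formed c2
  | PFor i _ c => [&& i != 0, i \notin writes c & well_formed c]
  end.

(** Initialising a loop and its last test take 10 steps; testing, incrementing
    and sequencing take 13 steps per iteration. *)
Fixpoint time_bound (D : nat -> nat) (c : prog) : nat :=
  match c with
  | PSkip => 1
  | PStore _ i e => (eval_time i + eval_time e).+1
  | PSeq c1 c2 => time_bound D c1 + time_bound D c2
  | PIf e1 e2 c1 c2 =>
      (eval_time e1 + eval_time e2 + (time_bound D c1 + time_bound D c2)).+1
  | PFor _ d c => D d * (time_bound D c + 13) + 10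
  end.

Lemma sem_seq c1 c2 M : sem (PSeq c1 c2) M = sem c2 (sem c1 M).
Proof. by []. Qed.

Lemma update_other M x i z x' k : x' != x -> update M x i z x' k = M x' k.
Proof. by rewrite /update => /negbTE ->. Qed.

Lemma frame c M x k : x \notin writes c -> sem c M x k = M x k.
Proof.
elim: c M => [|y i e|c1 IH1 c2 IH2|e1 e2 c1 IH1 c2 IH2|i d c IH] M //=.
- by rewrite inE => nx; rewrite update_other.
- by rewrite mem_cat negb_or => /andP[n1 n2]; rewrite IH2 // IH1.
- by rewrite mem_cat negb_or => /andP[n1 n2]; case: ifP => _; rewrite ?IH1 ?IH2.
- rewrite inE negb_or => /andP[nx nc].
  elim: `|M 0 d|%N => [|n IHn] /=; first by rewrite update_other.
  by rewrite update_other // IH.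
Qed.

Section Loop.
Variables (i d : nat) (c : prog).
Hypothesis wf : well_formed (PFor i d c).

Let step (M : memory) : memory := update (sem c M) i 0 (sem c M i 0 + 1)%R.

Lemma loop_state M k : iter k step (update M i 0 0%R) i 0 = k%:Z%R /\
  forall x j, x \notin i :: writes c -> iter k step (update M i 0 0%R) x j = M x j.
Proof.
case/and3P: wf => _ ni _; elim: k => [|k [IHi IHx]] /=.
  split=> [|x j]; first by rewrite /update !eqxx.
  by rewrite inE negb_or => /andP[nx _]; rewrite update_other.
split=> [|x j nx].
  by rewrite /step /update !eqxx /= frame // IHi -PoszD addn1.
move: (nx); rewrite inE negb_or => /andP[nxi nxc].
by rewrite /step update_other // frame // IHx.
Qed.

Lemma for_ind M (P : nat -> memory -> Prop) :
  P 0 (update M i 0 0%R) ->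
  (forall j M', j < `|M 0 d|%N -> M' i 0 = j%:Z%R ->
     (forall x k, x \notin i :: writes c -> M' x k = M x k) ->
     P j M' -> P j.+1 (update (sem c M') i 0 j.+1%:Z%R)) ->
  P `|M 0 d|%N (sem (PFor i d c) M).
Proof.
case/and3P: (wf) => _ ni _ P0 Pstep /=.
have H k : k <= `|M 0 d|%N -> P k (iter k step (update M i 0 0%R)).
  elim: k => //= k IH lt; have [Si Sx] := loop_state M k.
  have := Pstep k _ lt Si Sx (IH (ltnW lt)).
  by rewrite {1 2}/step frame // Si -PoszD addn1.
exact: H.
Qed.

Lemma for_rank (T : finType) M (P : nat -> memory -> Prop) : M 0 d = #|T|%:Z%R ->
  P 0 (update M i 0 0%R) ->
  (forall (x : T) M', M' i 0 = (enum_rank x : nat)%:Z%R ->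
     (forall y k, y \notin i :: writes c -> M' y k = M y k) ->
     P (enum_rank x) M' ->
     P (enum_rank x).+1 (update (sem c M') i 0 (enum_rank x).+1%:Z%R)) ->
  P #|T| (sem (PFor i d c) M).
Proof.
move=> Md P0 Pstep; have := for_ind P0; rewrite Md absz_nat; apply=> j M' lt Mi fr.
have := Pstep (enum_val (Ordinal lt)) M'; rewrite enum_valK /= => /(_ Mi fr).
by [].
Qed.
End Loop.

Lemma dims_kept c : well_formed c -> 0 \notin writes c.
Proof.
elim: c => //= [x _ _|c1 IH1 c2 IH2|_ _ c1 IH1 c2 IH2|i _ c IH].
- by rewrite inE eq_sym.
- by case/andP=> /IH1 n1 /IH2 n2; rewrite mem_cat negb_or n1.
- by case/andP=> /IH1 n1 /IH2 n2; rewrite mem_cat negb_or n1.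
- by case/and3P=> ni _ /IH n; rewrite inE negb_or eq_sym ni.
Qed.

Lemma time_bound_ext D D' c : D =1 D' -> time_bound D c = time_bound D' c.
Proof.
move=> E; elim: c => //= [c1 -> c2 ->|e1 e2 c1 -> c2 ->|i d c ->] //.
by rewrite E.
Qed.

Lemma exec_compile c M : well_formed c -> (forall j, 0 <= M 0 j)%R ->
  exists2 t, exec (compile c) M t (sem c M) & t <= time_bound (fun d => `|M 0 d|%N) c.
Proof.
elim: c M => [|x i e|c1 IH1 c2 IH2|e1 e2 c1 IH1 c2 IH2|i d c IH] M wf pos.
- by exists 1 => //; exact: exec_skip.
- by eexists; [exact: exec_store|].
- case/andP: wf => wf1 wf2; have [t1 E1 T1] := IH1 M wf1 pos.
  have kept j : sem c1 M 0 j = M 0 j by rewrite frame // dims_kept.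
  have [|t2 E2 T2] := IH2 (sem c1 M) wf2; first by move=> j; rewrite kept.
  exists (t1 + t2); first exact: exec_seq E1 E2.
  apply: leq_add => //; apply: leq_trans T2 _; apply: eq_leq.
  by apply: time_bound_ext => j; rewrite kept.
- case/andP: wf => wf1 wf2; have [t1 E1 T1] := IH1 M wf1 pos.
  have [t2 E2 T2] := IH2 M wf2 pos.
  rewrite /=; have [le|nle] := boolP (eval M e1 <= eval M e2)%R.
    by eexists; [exact: exec_if_true le E1|lia].
  by eexists; [exact: exec_if_false nle E2|lia].
- case/and3P: (wf) => i0 ni wfc; set n := `|M 0 d|%N.
  pose step (M : memory) : memory := update (sem c M) i 0 (sem c M i 0 + 1)%R.
  pose W := While (Plus (Var i) (Lit 1)) (Cell 0 (Lit d%:Z))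
             (Seq (compile c) (Store i (Lit 0) (Plus (Var i) (Lit 1)))).
  pose T := time_bound (fun d => `|M 0 d|%N) c.
  have Mn : M 0 d = n%:Z%R by rewrite /n gez0_abs.
  have loop k M' : k <= n -> (forall j, M' 0 j = M 0 j) -> M' i 0 = (n - k)%:Z%R ->
      exists2 t, exec W M' t (iter k step M') & t <= k * (T + 13) + 7.
    elim: k M' => [|k IHk] M' lek dims Mi.
      exists 7 => //; apply: exec_while_false; rewrite /= Mi dims Mn; lia.
    have kept j : step M' 0 j = M 0 j.
      by rewrite /step update_other 1?eq_sym // frame ?dims_kept.
    have [|t1 E1 T1] := IH M' wfc; first by move=> j; rewrite dims.
    have [|t2 E2 T2] := IHk (step M') (ltnW lek) kept.
      rewrite /step /update !eqxx /= frame // Mi; lia.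
    exists (4 + 2 + (t1 + 6) + t2).+1.
      rewrite iterSr; apply: (@exec_while_true _ (step M') _ (Plus (Var i) (Lit 1)) (Cell 0 (Lit d%:Z))) E2.
        by rewrite /= Mi dims Mn; lia.
      by apply: exec_seq E1 _; exact: exec_store.
    have : t1 <= T.
      by apply: leq_trans T1 _; apply: eq_leq; apply: time_bound_ext => j; rewrite dims.
    by rewrite mulSn; lia.
  have [||t E Tt] := loop n (update M i 0 0%R) (leqnn n).
  + by move=> j; rewrite update_other // eq_sym.
  + by rewrite /update !eqxx subnn.
  exists (3 + t); last by rewrite /= -/n -/T; lia.
  by apply: exec_seq E; exact: exec_store.
Qed.

(** * Terminal vertices and shortest path forests by local rules *)

Section Merge.
Variable T : eqType.

(** The terminal vertex [o] found for [u] so far, updated by that of one more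
    successor: [None] stands for successors that reach no sink, and different
    values show that [u] is itself terminal. *)
Definition merge_label (u : T) (o y : option T) : option T :=
  match o, y with
  | _, None => o
  | None, Some w => Some w
  | Some w', Some w => if w' == w then o else Some u
  end.

Lemma merge_all_eq u o0 (o : option T) (ys : seq (option T)) :
  (forall y, y \in ys -> y = None \/ y = o) -> o0 = None \/ o0 = o ->
  foldl (merge_label u) o0 ys = None \/ foldl (merge_label u) o0 ys = o.
Proof.
elim: ys o0 => //= y ys IH o0 H H0; apply: IH => [z zys|].
  by apply: H; rewrite inE zys orbT.
have [->|->] := H y (mem_head _ _); first by case: H0 => ->; case: (o) => /=; auto.
by case: H0 => ->; case: (o) => //=; auto => w; rewrite eqxx; auto.
Qed.

Lemma merge_result u (ys : seq (option T)) : Some u \notin ys ->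
  foldl (merge_label u) None ys = Some u \/
  forall y, y \in ys -> y = None \/ y = foldl (merge_label u) None ys.
Proof.
elim/last_ind: ys => [|ys y IH]; first by right.
rewrite mem_rcons inE negb_or foldl_rcons => /andP[nuy /IH[->|H]].
  case: y nuy => [w|] /= nuw; last by left.
  by rewrite (inj_eq (@Some_inj _)) in nuw; rewrite (negbTE nuw); left.
case: y nuy => [w|] nuy /=; last first.
  by right=> y; rewrite mem_rcons inE => /orP[/eqP ->|/H]; [left|case: foldl].
case: (foldl _ _ _) H => [w'|] H /=.
  case: eqVneq H => [->|n] H; last by left.
  by right=> y; rewrite mem_rcons inE => /orP[/eqP ->|/H]; auto.
by right=> y; rewrite mem_rcons inE => /orP[/eqP ->|/H[]->]; auto.
Qed.
End Merge.

Section Trees.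
Variables (G : digraph) (L : finType) (I : instance G L) (s q : verts G).
Hypothesis Gsp : sp_digraph s q.
Hypothesis Isrc : unique_source I s.
Hypothesis Ipar : parallel_sinks I.
Implicit Types (x y z v w t u : verts G) (a b : arcs G).

Local Notation label := (label I).
Local Notation n := #|verts G|.

Definition last_of x : option (verts G) :=
  [pick w | terminal I w && (label w == label x)].

Lemma last_of_some x w : terminal I w -> label w = label x -> last_of x = Some w.
Proof.
move=> T E; rewrite /last_of; case: pickP => [w' /andP[T' /eqP E']|/(_ w)].
  by congr Some; apply: (terminal_inj Gsp Ipar T' T); rewrite E' E.
by rewrite T E eqxx.
Qed.

Lemma last_of_dead x : ~~ live I x -> last_of x = None.
Proof.
move=> dx; rewrite /last_of; case: pickP => // w /andP[/terminal_live lw /eqP E].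
by case/negP: dx; rewrite /live -E.
Qed.

Lemma last_of_live x : live I x -> exists2 w, last_of x = Some w &
  terminal I w /\ label w = label x.
Proof.
case/(exists_terminal Gsp) => w [T _ E]; exists w => //; exact: last_of_some.
Qed.

Lemma last_ofE x w : last_of x = Some w -> terminal I w /\ label w = label x.
Proof.
by rewrite /last_of; case: pickP => // w' /andP[T /eqP E] [<-].
Qed.

Lemma last_of_self w : (last_of w == Some w) = terminal I w.
Proof.
by apply/eqP/idP => [/last_ofE[]|T] //; exact: last_of_some.
Qed.

Definition out_lasts (S : seq (arcs G)) u : seq (option (verts G)) :=
  [seq last_of (tgt a) | a <- S & src a == u].

(** A terminal vertex that is not a sink has successors with different labels,
    as no proper part of its label is that of all successors; the live successors
    of other vertices share the label of [u]. *)
Lemma last_of_merge u : last_of u =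
  foldl (merge_label u) (if u \in sinks I then Some u else None)
        (out_lasts (enum (arcs G)) u).
Proof.
have out (o : option (verts G)) :
    reflect (exists2 a, src a = u & o = last_of (tgt a)) (o \in out_lasts (enum (arcs G)) u).
  apply: (iffP mapP) => [[a]|[a au ->]].
    by rewrite mem_filter => /andP[/eqP au _] ->; exists a.
  by exists a; rewrite // mem_filter au eqxx mem_enum.
case: ifPn => [uS|uS].
  have dead (o : option (verts G)) : o \in out_lasts (enum (arcs G)) u -> o = None.
    case/out=> a au ->; apply: last_of_dead; apply/negP=> /liveP[t].
    have := label_arc_sub I a; rewrite au (label_sink Ipar uS) => /subsetP sub.
    move=> /[dup] /sub; rewrite inE => /eqP ->.
    by rewrite mem_label -{2}au (acyclic Gsp) andbF.
  rewrite (last_of_some (sink_terminal Gsp uS)) //.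
  by elim: (out_lasts _ u) dead => //= o ys IH H;
    rewrite (H o) ?mem_head //; apply: IH => o' zys; apply: H; rewrite inE zys orbT.
set ys := out_lasts _ u; set r := foldl _ _ _.
have [lu|du] := boolP (live I u); last first.
  rewrite last_of_dead // /r; case: (@merge_all_eq _ u None None ys) => [o /out[a au ->]||->|->]; auto.
  left; apply: last_of_dead; apply: contra du.
  by rewrite -au; apply: live_reaches; exact: reaches_arc.
have nself : Some u \notin ys.
  apply/negP=> /out[a au] /esym/last_ofE[T E].
  by have := terminal_arc T au; rewrite E eqxx.
have some_arc t : t \in label u -> exists2 a, src a = u & t \in label (tgt a).
  rewrite mem_label => /andP[tS ut].
  have [|a au at_] := reaches_first ut; first by apply: contra uS => /eqP ->.
  by exists a; rewrite // mem_label tS.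
have [T|nT] := boolP (terminal I u).
  rewrite (last_of_some T) // /r; case: (merge_result nself) => [-> //|]; rewrite -/r => H.
  have /liveP[t tu] := lu; have [a au ta] := some_arc t tu.
  have la : live I (tgt a) by apply/liveP; exists t.
  have [w Ew [_ Ew']] := last_of_live la.
  have : label (tgt a) \proper label u.
    by rewrite properEneq (terminal_arc T au) -au label_arc_sub.
  case/properP=> _ [t' t'u nt']; have [a' au' ta'] := some_arc t' t'u.
  have la' : live I (tgt a') by apply/liveP; exists t'.
  have [w2 Ew2 [_ Ew2']] := last_of_live la'.
  have E1 : Some w = r.
    have /H[] // : Some w \in ys by apply/out; exists a.
  have E2 : Some w2 = r.
    have /H[] // : Some w2 \in ys by apply/out; exists a'.
  have [ww] : Some w = Some w2 by rewrite E1 E2.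
  by case/negP: nt'; rewrite -Ew' ww Ew2'.
have same a : src a = u -> live I (tgt a) -> label (tgt a) = label u.
  move=> au la; case: (label_arc Gsp Ipar la) => [<-|[]]; first by rewrite au.
  by rewrite au (negbTE nT).
have [w Ew [Tw Ew']] := last_of_live lu; rewrite Ew.
have H (o : option (verts G)) : o \in ys -> o = None \/ o = Some w.
  case/out=> a au ->; have [la|da] := boolP (live I (tgt a)); last first.
    by left; exact: last_of_dead.
  by right; apply: last_of_some; rewrite // (same a au la).
rewrite /r; case: (@merge_all_eq _ u None _ _ H) => [|E|->] //; first by left.
have /liveP[t tu] := lu; have [a au ta] := some_arc t tu.
have la : live I (tgt a) by apply/liveP; exists t.
have /[dup] ain : Some w \in ys.
  by apply/out; exists a => //; apply/esym/last_of_some; rewrite // (same a au la).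
case: (merge_result nself) => [E'|H']; first by rewrite E' in E.
by case/H' => //; rewrite E.
Qed.

(** Distances [e] from the start of the block, shifted by one so that [0] stands
    for unreachable, [c] being the shifted distance at which a vertex serves as
    the source of an arc, and [p] the last arcs of shortest paths. *)
Definition dist_tree (B : {set arcs G}) (c e : verts G -> nat) (p : verts G -> arcs G) :
    Prop :=
  [/\ forall v, c v = if block_start I s v then 1 else e v,
      forall y, 0 < e y -> [/\ tgt (p y) = y, p y \in B, 0 < c (src (p y)) &
                               e y = c (src (p y)) + cost I (p y)] &
      forall a, a \in B -> 0 < c (src a) ->
                0 < e (tgt a) <= c (src a) + cost I a].

(** Walking back from [w] along the predecessors [p] to the start of the block,
    while collecting the arcs of the path. *)
Definition trace_step (p : verts G -> arcs G) (xl : verts G * seq (arcs G)) :=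
  if block_start I s xl.1 then xl else (src (p xl.1), p xl.1 :: xl.2).

Definition trace (p : verts G -> arcs G) w : verts G * seq (arcs G) :=
  iter n (trace_step p) (src (p w), [:: p w]).

Section DistTree.
Variables (B : {set arcs G}) (c e : verts G -> nat) (p : verts G -> arcs G).
Hypothesis D : dist_tree B c e p.

Lemma trace_inv w k (xl := iter k (trace_step p) (src (p w), [:: p w])) :
  terminal I w -> 0 < e w ->
  [/\ walk_in (tree_block I w :&: B) xl.1 w xl.2, wcost (cost I) xl.2 + c xl.1 = e w,
      0 < c xl.1,
      ~~ block_start I s xl.1 -> label xl.1 = label w /\ depth xl.1 + k < depth w &
      exists a l, xl.2 = a :: l].
Proof.
have [Dc De Dl] := D; move=> T ew.
have walk_cons a x l : walk_in (tree_block I w :&: B) x w l -> tgt a = x -> a \in B ->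
    label x = label w -> walk_in (tree_block I w :&: B) (src a) w (a :: l).
  move=> /andP[W A] ax aB El.
  by rewrite /walk_in /= eqxx ax W A !inE aB ax El eqxx.
have inner a : tgt a \in [set x | label x == label w] -> ~~ block_start I s (src a) ->
    label (src a) = label w.
  rewrite inE => /eqP E ns; rewrite (inner_label Gsp Ipar _ ns) //.
  by rewrite /live E; exact: terminal_live.
rewrite /xl {xl}; elim: k => [|k [W C c0 ns [b [l El]]]] /=.
  have [t1 t2 t3 t4] := De w ew; split=> //.
  - by apply: (walk_cons _ w [::]) => //; rewrite /walk_in /= eqxx.
  - by rewrite /wcost big_seq1 addnC t4.
  - move=> ns; split; first by apply: inner; rewrite // inE t1.
    by rewrite addn0 -{2}t1 (depth_arc Gsp).
  - by exists (p w), [::].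
set xl := iter _ _ _ in W C c0 ns El *; rewrite /trace_step.
case: ifPn => [st|nst]; first by split=> //; [rewrite st|exists b, l].
have [Ex dx] := ns nst; have ex : 0 < e xl.1 by move: c0; rewrite Dc (negbTE nst).
have [t1 t2 t3 t4] := De _ ex; split=> //=.
- exact: walk_cons W t1 t2 Ex.
- rewrite /wcost big_cons -/(wcost _ _) -C (Dc xl.1) (negbTE nst) t4; lia.
- move=> ns'; split; first by apply: inner; rewrite // inE t1 Ex.
  by have := depth_arc Gsp (p xl.1); rewrite t1; lia.
- by exists (p xl.1), xl.2.
Qed.

Lemma traceP w : terminal I w -> w != s -> 0 < e w ->
  [/\ tree_arc I s (trace p w).1 w,
      walk_in (tree_block I w :&: B) (trace p w).1 w (trace p w).2 &
      wcost (cost I) (trace p w).2 + 1 = e w].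
Proof.
move=> T ws ew; have [Dc _ _] := D.
have [W C c0 ns [a [l E]]] := trace_inv n T ew; rewrite -/(trace p w) in W C c0 ns E.
have st : block_start I s (trace p w).1.
  apply/contraT => /ns[_]; have := depth_bound w; lia.
split=> //; last by rewrite Dc st in C.
move: (W); rewrite E => /andP[/= /andP[/eqP Es _] /andP[]].
rewrite !inE -Es => /andP[/eqP Ea _] _; apply: (start_tree_arc Gsp Ipar) => //.
by rewrite Es.
Qed.

(** Inner vertices of a walk in the block of [w] are not block starts, so that
    distances are not reset on the way. *)
Lemma dist_lower w v y (l : seq (arcs G)) : terminal I w -> block_start I s v ->
  walk_in (tree_block I w :&: B) v y l -> l != [::] ->
  0 < e y <= wcost (cost I) l + 1.
Proof.
move=> T sv; have [Dc De Dl] := D.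
have rc v' x l' a : is_walk v' x (rcons l' a) = is_walk v' (src a) l' && (tgt a == x).
  elim: l' v' => [|b l' IH] v' /=; first by rewrite eq_sym.
  by rewrite IH andbA.
elim/last_ind: l y => // l a IH y; rewrite /walk_in rc all_rcons.
case/andP=> /andP[W /eqP <-] /andP[/= /[!inE]/andP[/eqP Ea aB] A] _.
have cost1 : wcost (cost I) (rcons l a) = wcost (cost I) l + cost I a.
  by rewrite /wcost -cats1 big_cat big_seq1.
have [E|nl] := eqVneq l [::].
  rewrite cost1 E /wcost big_nil add0n; move: W; rewrite E => /= /eqP Ev.
  by have := Dl a aB; rewrite -Ev Dc sv addnC; apply.
have /andP[e0 le] : 0 < e (src a) <= wcost (cost I) l + 1.
  by apply: IH nl; rewrite /walk_in W.
have ns : ~~ block_start I s (src a).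
  move: nl W A; case: (lastP l) => // l' b _; rewrite rc all_rcons.
  case/andP=> _ /eqP Eb /andP[/= /[!inE]/andP[/eqP Eb' _] _].
  rewrite /block_start negb_or -{1}Eb (origin_no_in Gsp) /=; apply/negP=> Ts.
  by have := terminal_arc Ts erefl; rewrite Ea -Eb Eb' eqxx.
have := Dl a aB; rewrite Dc (negbTE ns) => /(_ e0) /andP[-> le'] /=.
by rewrite cost1; lia.
Qed.
End DistTree.

Section Up.
Variables (c e : verts G -> nat) (p : verts G -> arcs G).
Hypothesis D : dist_tree setT c e p.

Definition up x : verts G := if 0 < e x then src (p x) else x.

Lemma dist_pos x : (0 < e x) = (x != s).
Proof.
have [Dc De Dl] := D; apply/idP/idP => [ex|].
  by have [<- _ _ _] := De x ex; exact: origin_no_in Gsp _.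
have [k] := ubnP (depth x); elim: k x => // k IH x dx xs.
rewrite eq_sym in xs; have [a ax _] := reaches_last (origin_reaches Gsp x) xs.
have : 0 < c (src a); last by move/(Dl a (in_setT a)); rewrite ax => /andP[].
rewrite Dc; case: ifPn => // ns; apply: IH.
  by have := depth_arc Gsp a; rewrite ax => H; exact: leq_trans H dx.
by apply: contra ns => /eqP ->; rewrite /block_start eqxx.
Qed.

Lemma up_source : up s = s.
Proof. by rewrite /up dist_pos eqxx. Qed.

Lemma up_arc x : x != s -> tgt (p x) = x /\ up x = src (p x).
Proof.
by rewrite -dist_pos /up => ex; rewrite ex; have [_ De _] := D; have [] := De x ex.
Qed.

Lemma up_reaches j x : reaches (iter j up x) x.
Proof.
elim: j => [|j IH] /=; first exact: reaches_refl.
apply: reaches_trans IH; have [->|ns] := eqVneq (iter j up x) s.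
  by rewrite up_source reaches_refl.
have [E ->] := up_arc ns; rewrite -{2}E; exact: reaches_arc.
Qed.

Lemma up_depth x : depth (up x) <= depth x ?= iff (x == s).
Proof.
have [->|ns] := eqVneq x s; first by rewrite up_source; split; rewrite ?eqxx.
have [E ->] := up_arc ns; have := depth_arc Gsp (p x); rewrite E => lt.
by split; [exact: ltnW|rewrite ltn_eqF].
Qed.

(** The walk from [t] up to the source meets [w] by [terminal_between], and only
    once since depths decrease; afterwards it stays at [s]. *)
Lemma up_count w t : terminal I w -> w != s -> t \in sinks I ->
  \sum_(j < n) (iter j up t == w : nat) = (t \in label w).
Proof.
move=> T ws tS; case: (boolP (t \in label w)) => [tw|ntw]; last first.
  apply: big1 => j _; case: eqVneq => // E; case/negP: ntw.
  by rewrite mem_label tS -E up_reaches.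
have search k : (exists2 j, j < k & iter j up t = w) \/
    reaches w (iter k up t) /\ depth (iter k up t) + k <= depth t.
  elim: k => [|k [[j jk E]|[R dk]]].
  - by right; rewrite addn0 /=; split=> //; move: tw; rewrite mem_label => /andP[].
  - by left; exists j; rewrite // ltnW.
  - have [E|nw] := eqVneq (iter k up t) w; first by left; exists k.
    have ns : iter k up t != s.
      apply: contra ws => /eqP E; rewrite E in R.
      by apply/eqP; apply: (reaches_anti Gsp R); exact: origin_reaches Gsp _.
    right; rewrite /=; have [E ->] := up_arc ns; split; last first.
      by have := depth_arc Gsp (p (iter k up t)); rewrite E; lia.
    have xt := up_reaches k t; rewrite -{1}E in xt.
    case/orP: (terminal_between Gsp Ipar T tw xt) => // R'.
    by case/eqP: nw; apply: (reaches_anti Gsp _ R); rewrite -{1}E.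
have [[j0 lt E0]|[_]] := search n; last by have := depth_bound t; lia.
have mono i j : i <= j -> depth (iter j up t) <= depth (iter i up t).
  move=> le; rewrite -(subnK le); elim: (j - i) => // d IH.
  by rewrite addSn /=; apply: leq_trans IH; exact: (up_depth _).1.
have uniq_ i j : i < j -> iter i up t = w -> iter j up t = w -> False.
  move=> ij Ei Ej; have := mono _ _ ij; rewrite Ej iterS Ei leqNgt.
  by rewrite (ltn_leqif (up_depth w)) ws.
rewrite (bigD1 (Ordinal lt)) //= E0 eqxx big1 // => j nj; case: eqVneq => // E.
have nj' : (j : nat) != j0 by apply: contra nj => /eqP Ej; apply/eqP/val_inj.
by case: (ltngtP j j0) nj' => // ij _; [case: (uniq_ j j0)|case: (uniq_ j0 j)].
Qed.

Lemma up_beta l w : terminal I w -> w != s ->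
  ((beta I l w)%:Z = \sum_t \sum_(j < n) ((iter j up t == w : nat)%:Z * - bal I l t))%R.
Proof.
move=> T ws; rewrite (beta_sum Isrc) -sumrN big_mkcond; apply: eq_bigr => t _.
rewrite -big_distrl /= -(big_morph Posz PoszD erefl).
have [tS|ntS] := boolP (t \in sinks I).
  by rewrite (up_count T ws tS); case: ifP; rewrite ?mul1r ?mul0r.
have -> : (t \in label w) = false by rewrite mem_label (negbTE ntS).
have [->|ts] := eqVneq t s; last by rewrite (bal_nonsink Isrc) // oppr0 mulr0.
rewrite big1 ?mul0r // => j _; suff -> : iter j up s = s by rewrite eq_sym (negbTE ws).
by elim: (nat_of_ord j) => //= k ->; exact: up_source.
Qed.
End Up.
End Trees.

(** * The program: terminal vertices *)

(** Use of memory: banks 7 and 8 hold the offset of each scenario in arrays over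
    vertices and over arcs; 9 flags the sinks; 10 and 11 hold the current and the
    next terminal vertex of each label, as rank plus one, or zero if there is
    none; 12 flags the block starts; 13 to 15 hold distances as sources,
    distances as targets and predecessors for all paths, 16 to 18 the same for
    free paths; 19 holds the demands; 20 the amounts to be routed in each
    scenario; 21 and 22 are running offsets, 23 is the current vertex and 24 the
    amount on the path with fixed arcs; 30 to 32 are loop counters. *)
Definition at_balance (l v : expr) : expr := Cell 5 (Plus (Cell 7 l) v).
Definition incr (e : expr) : expr := Plus e (Lit 1).
Definition PIfEq (e1 e2 : expr) (c1 c2 : prog) : prog :=
  PIf e1 e2 (PIf e2 e1 c1 c2) c2.

Lemma sem_if e1 e2 c1 c2 M : sem (PIf e1 e2 c1 c2) M =
  if (eval M e1 <= eval M e2)%R then sem c1 M else sem c2 M.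
Proof. by []. Qed.

Lemma sem_if_eq e1 e2 c1 c2 M : sem (PIfEq e1 e2 c1 c2) M =
  if eval M e1 == eval M e2 then sem c1 M else sem c2 M.
Proof. by rewrite /PIfEq !sem_if eq_le; case: ifP => //= _; case: ifP. Qed.

Lemma eval_incr e M : eval M (incr e) = (eval M e + 1)%R. Proof. by []. Qed.

Definition rows : prog :=
  PFor 30 2
    (PSeq (PStore 7 (Var 30) (Var 21))
    (PSeq (PStore 8 (Var 30) (Var 22))
    (PSeq (PStore 21 (Lit 0) (Plus (Var 21) (Cell 0 (Lit 0))))
          (PStore 22 (Lit 0) (Plus (Var 22) (Cell 0 (Lit 1))))))).

Definition sink_flags : prog :=
  PFor 30 0 (PFor 31 2
    (PIf (incr (at_balance (Var 31) (Var 30))) (Lit 0)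
       (PStore 9 (Var 30) (Lit 1)) PSkip)).

Definition last_init : prog :=
  PFor 30 0 (PIf (Lit 1) (Cell 9 (Var 30))
    (PStore 11 (Var 30) (incr (Var 30))) (PStore 11 (Var 30) (Lit 0))).

Definition last_arcs : prog :=
  PFor 30 1
    (PIf (Lit 1) (Cell 10 (Cell 2 (Var 30)))
      (PIf (Cell 11 (Cell 1 (Var 30))) (Lit 0)
        (PStore 11 (Cell 1 (Var 30)) (Cell 10 (Cell 2 (Var 30))))
        (PIfEq (Cell 11 (Cell 1 (Var 30))) (Cell 10 (Cell 2 (Var 30)))
           PSkip
           (PStore 11 (Cell 1 (Var 30)) (incr (Cell 1 (Var 30))))))
      PSkip).

Definition last_copy : prog :=
  PFor 30 0 (PStore 10 (Var 30) (Cell 11 (Var 30))).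

Definition last_round : prog := PSeq last_init (PSeq last_arcs last_copy).

Definition lasts : prog := PFor 32 0 last_round.

Notation rk x := (nat_of_ord (enum_rank x)).

Lemma rk_eq (T : finType) (x y : T) : (rk x == rk y) = (x == y).
Proof. by rewrite (inj_eq val_inj) (inj_eq enum_rank_inj). Qed.

Lemma rk_ltS (T : finType) (x y : T) : (rk x < (rk y).+1) = (x == y) || (rk x < rk y).
Proof. by rewrite ltnS leq_eqVlt rk_eq. Qed.

Lemma rk_lt (T : finType) (x : T) : rk x < #|T|. Proof. exact: ltn_ord. Qed.

Section Verify.
Variables (G : digraph) (L : finType) (I : instance G L) (s q : verts G).
Hypothesis Gsp : sp_digraph s q.
Hypothesis Ipar : parallel_sinks I.
Implicit Types (x y z v w t u : verts G) (a b : arcs G) (l : L) (M : memory).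

Local Notation n := #|verts G|.
Local Notation m := #|arcs G|.

Record graph_data M : Prop := GraphData {
  gd_n : M 0 0 = n%:Z%R;
  gd_m : M 0 1 = m%:Z%R;
  gd_k : M 0 2 = #|L|%:Z%R;
  gd_src : forall a, M 1 (rk a) = (rk (src a))%:Z%R;
  gd_tgt : forall a, M 2 (rk a) = (rk (tgt a))%:Z%R;
  gd_cost : forall a, M 3 (rk a) = (cost I a)%:Z%R;
  gd_fixed : forall a, M 4 (rk a) = ((a \in fixed I) : nat)%:Z%R;
  gd_bal : forall l v, M 5 (rk l * n + rk v) = bal I l v
}.

Lemma graph_data_agree M M' : (forall y k : nat, y < 6 -> M' y k = M y k) ->
  graph_data M -> graph_data M'.
Proof. by move=> E [*]; split=> *; rewrite E. Qed.

Definition row_data M : Prop :=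
  forall l, M 7 (rk l) = (rk l * n)%:Z%R /\ M 8 (rk l) = (rk l * m)%:Z%R.

Lemma graph_data_frame (S : seq nat) M M' : graph_data M -> all (leq 6) S ->
  (forall y k : nat, y \notin S -> M' y k = M y k) -> graph_data M'.
Proof.
move=> D /allP S6 fr; apply: graph_data_agree D => x k x6; apply: fr.
by apply: contraL x6 => /S6; rewrite -leqNgt.
Qed.

Lemma rows_spec M : graph_data M -> M 21 0 = 0%R -> M 22 0 = 0%R ->
  row_data (sem rows M).
Proof.
move=> D M21 M22.
pose P j (M' : memory) := [/\ M' 21 0 = (j * n)%:Z%R, M' 22 0 = (j * m)%:Z%R &
  forall l, rk l < j -> M' 7 (rk l) = (rk l * n)%:Z%R /\ M' 8 (rk l) = (rk l * m)%:Z%R].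
suff [_ _ H] : P #|L| (sem rows M) by move=> l; apply: H; exact: rk_lt.
apply: for_rank => [//||| l M' Mi fr [M'21 M'22 H]].
- exact: gd_k D.
- by split.
- have D' : graph_data M' by apply: graph_data_frame D _ fr.
  split.
  + by rewrite /= /update /= M'21 (gd_n D') -PoszD mulSn addnC.
  + by rewrite /= /update /= M'22 (gd_m D') -PoszD mulSn addnC.
  + move=> l'; rewrite rk_ltS /= /update /= Mi M'21 M'22 /= rk_eq.
    by case: eqVneq => [->|_ /=]; [|exact: H].
Qed.

Lemma eval_balance M l v e1 e2 : graph_data M -> row_data M ->
  eval M e1 = (rk l)%:Z%R -> eval M e2 = (rk v)%:Z%R ->
  eval M (at_balance e1 e2) = bal I l v.
Proof.
by move=> D R E1 E2; rewrite /= E1 E2 /= (R l).1 -PoszD /= (gd_bal D).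
Qed.

Definition sink_data M : Prop := forall v, M 9 (rk v) = Posz (v \in sinks I).

Definition seen j v : bool := [exists l, (rk l < j) && is_sink I l v].

Lemma seenS l v : seen (rk l).+1 v = is_sink I l v || seen (rk l) v.
Proof.
apply/existsP/orP => [[l']|[H|/existsP[l' /andP[lt H]]]].
- rewrite rk_ltS => /andP[/orP[/eqP ->|lt] H]; first by left.
  by right; apply/existsP; exists l'; rewrite lt.
- by exists l; rewrite ltnSn.
- by exists l'; rewrite (ltn_trans lt).
Qed.

Lemma seen_all v : seen #|L| v = (v \in sinks I).
Proof. by rewrite inE; apply: eq_existsb => l; rewrite rk_lt. Qed.

Lemma seen0 v : seen 0 v = false.
Proof. by apply/existsP=> -[]. Qed.

Lemma sink_flags_spec M : graph_data M -> row_data M -> (forall k, M 9 k = 0%R) ->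
  sink_data (sem sink_flags M).
Proof.
move=> D R M9.
pose P j (M' : memory) := forall v, M' 9 (rk v) = Posz ((rk v < j) && (v \in sinks I)).
suff H : P n (sem sink_flags M) by move=> v; rewrite H rk_lt.
apply: for_rank => [//||v /=|v M' Mi fr HP].
- exact: gd_n D.
- by rewrite /update /= M9.
have D' : graph_data M' by apply: graph_data_frame D _ fr.
have R' : row_data M' by move=> l; rewrite !fr.
pose Q j (M2 : memory) := forall u, M2 9 (rk u) =
  Posz (((rk u < rk v) && (u \in sinks I)) || ((u == v) && seen j u)).
set c := PFor 31 2 _; have : Q #|L| (sem c M').
  apply: for_rank => [//||u /=|l M2 M2i fr2 HQ u].
  - exact: gd_k D'.
  - by rewrite /update /= HP seen0 andbF orbF.
  - have D2 : graph_data M2 by apply: graph_data_frame D' _ fr2.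
    have R2 : row_data M2 by move=> l'; rewrite !fr2.
    have M2v : M2 30 0 = (rk v)%:Z%R by rewrite fr2.
    have Eb : eval M2 (at_balance (Var 31) (Var 30)) = bal I l v.
      by apply: eval_balance.
    rewrite update_other // sem_if eval_incr Eb seenS.
    have -> : (bal I l v + 1 <= eval M2 (Lit 0))%R = is_sink I l v.
      by rewrite /is_sink /=; lia.
    case: ifPn => lv; last first.
      by rewrite /= HQ; case: eqVneq => [->|//]; rewrite (negbTE lv).
    rewrite /= /update /= M2v /= rk_eq HQ; case: eqVneq => [->|//].
    by rewrite lv orbT.
move=> HQ u; rewrite update_other // HQ seen_all rk_ltS andb_orl orbC.
by case: eqVneq => [->|].
Qed.

Definition code (o : option (verts G)) : int := Posz (if o is Some w then (rk w).+1 else 0).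

Lemma code_ge1 o : (1 <= code o)%R = (o != None).
Proof. by case: o. Qed.

Lemma code_le0 o : (code o <= 0)%R = (o == None).
Proof. by case: o. Qed.

Lemma code_inj : injective code.
Proof.
by move=> [w|] [w'|] //= [] /eqP; rewrite rk_eq => /eqP ->.
Qed.

Lemma take_enum_rank (T : finType) (x : T) :
  take (rk x).+1 (enum T) = rcons (take (rk x) (enum T)) x.
Proof. by rewrite (take_nth x) ?nth_enum_rank // -cardE rk_lt. Qed.

(** Vertices of height at most [j] have only successors of height less than [j],
    whose values are final; the others may hold anything. *)
Lemma last_round_spec M j : graph_data M -> sink_data M ->
  (forall u, height u < j -> M 10 (rk u) = code (last_of I u)) ->
  forall u, height u < j.+1 -> sem last_round M 10 (rk u) = code (last_of I u).
Proof.
move=> D S H10; pose init u := if u \in sinks I then Some u else None.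
rewrite -[sem last_round M]/(sem last_copy (sem last_arcs (sem last_init M))).
set M1 := sem last_init M; set M2 := sem last_arcs M1.
have init1 u : M1 11 (rk u) = code (init u).
  pose P j (M' : memory) := forall u, rk u < j -> M' 11 (rk u) = code (init u).
  suff H : P n M1 by apply: H; exact: rk_lt.
  apply: for_rank => [//|||v M' Mi fr HP u'].
  - exact: gd_n D.
  - by [].
  - rewrite rk_ltS update_other // sem_if /= Mi /= fr // S.
    rewrite /init; case: (boolP (v \in sinks I)) => vS /=;
      rewrite /update /= ?Mi /= rk_eq; case: eqVneq => [->|_ /= /HP //] _.
    + by rewrite vS -PoszD addn1.
    + by rewrite (negbTE vS).
have D1 : graph_data M1 by apply: graph_data_frame D _ (@frame last_init M).
have fr1 k : M1 10 k = M 10 k by rewrite /M1 frame.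
have arcs2 u : height u < j.+1 -> M2 11 (rk u) = code (last_of I u).
  pose P j' (M' : memory) := forall u, height u < j.+1 -> M' 11 (rk u) =
    code (foldl (merge_label u) (init u) (out_lasts I (take j' (enum (arcs G))) u)).
  suff H : P m M2.
    by move=> hu; rewrite H // (last_of_merge Gsp Ipar) cardE take_size.
  apply: for_rank => [//|||a M' Mi fr HP u' hu].
  - exact: gd_m D1.
  - by move=> u' _; rewrite /update /= init1 take0.
  - have D' : graph_data M' by apply: graph_data_frame D1 _ fr.
    rewrite take_enum_rank /out_lasts filter_rcons update_other //.
    have Es : eval M' (Cell 1 (Var 30)) = (rk (src a))%:Z%R by rewrite /= Mi (gd_src D').
    have E10 k : M' 10 k = M 10 k by rewrite fr // fr1.
    have Et : eval M' (Cell 10 (Cell 2 (Var 30))) = M 10 (rk (tgt a)).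
      by rewrite /= Mi /= (gd_tgt D') /= E10.
    have Eo : eval M' (Cell 11 (Cell 1 (Var 30))) = M' 11 (rk (src a)).
      by rewrite /= Mi /= (gd_src D').
    rewrite sem_if Et sem_if Eo sem_if_eq Et Eo.
    have [Eu|nu] := eqVneq (src a) u'; last first.
      have ne : (rk u' == rk (src a)) = false by rewrite rk_eq eq_sym (negbTE nu).
      rewrite -HP // -/(eval _ _); case: ifP => _ //; case: ifP => _; last case: ifP => _ //.
        by rewrite /= /update /= Mi /= (gd_src D') ne.
      by rewrite /= /update /= Mi /= (gd_src D') ne.
    rewrite map_rcons foldl_rcons -Eu -/(out_lasts I _ _).
    set o := foldl _ _ _; have Eo' : M' 11 (rk (src a)) = code o by rewrite Eu HP // -Eu.
    have Ey : M 10 (rk (tgt a)) = code (last_of I (tgt a)).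
      by apply: H10; have := height_arc Gsp a; rewrite Eu => lt; exact: leq_trans lt _.
    have upd k (val : int) : update M' 11 k val 11 k = val by rewrite /update !eqxx.
    rewrite Ey Eo' (inj_eq code_inj) code_ge1 code_le0; case: (last_of _ _) Ey => [w|] Ey /=.
      case: o Eo' => [w'|] Eo' /=; last by rewrite Mi /= (gd_src D') (gd_tgt D') E10 Ey upd.
      rewrite (inj_eq (@Some_inj _)); case: eqVneq => [//|_].
      by rewrite Mi /= (gd_src D') upd -PoszD addn1.
    by case: o Eo'.
have D2 : graph_data M2 by apply: graph_data_frame D1 _ (@frame last_arcs M1).
move=> u hu; pose P j' (M' : memory) := forall u, rk u < j' -> M' 10 (rk u) = M2 11 (rk u).
suff -> : P n (sem last_copy M2) by [rewrite arcs2|exact: rk_lt].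
apply: for_rank => [//|||v M' Mi fr HP u'].
- exact: gd_n D2.
- by [].
- rewrite rk_ltS update_other // /= /update /= Mi /= rk_eq.
  by case: eqVneq => [->|_ /= /HP //] _; rewrite fr.
Qed.

Lemma lasts_spec M : graph_data M -> sink_data M ->
  forall u, sem lasts M 10 (rk u) = code (last_of I u).
Proof.
move=> D S; pose P j (M' : memory) :=
  forall u, height u < j -> M' 10 (rk u) = code (last_of I u).
suff H : P n (sem lasts M) by move=> u; apply: H; exact: height_bound.
rewrite -[n]absz_nat -(gd_n D); apply: for_ind => //= j M' _ Mi fr HP u hu.
rewrite update_other //; apply: last_round_spec hu => //.
- by apply: graph_data_frame D _ fr.
- by move=> v; rewrite fr.
Qed.
End Verify.

(** * The program: shortest paths *)

Definition start_flags : prog :=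
  PFor 30 0 (PIf (Lit 1) (Cell 5 (Var 30)) (PStore 12 (Var 30) (Lit 1))
    (PIfEq (Cell 10 (Var 30)) (incr (Var 30))
       (PStore 12 (Var 30) (Lit 1)) (PStore 12 (Var 30) (Lit 0)))).

Section DistProgram.
Variables (cur new prd : nat) (lim : int).

Let src_cell : expr := Cell 1 (Var 30).
Let tgt_cell : expr := Cell 2 (Var 30).
Let cand : expr := Plus (Cell cur src_cell) (Cell 3 (Var 30)).

Definition dist_init : prog := PFor 30 0 (PStore new (Var 30) (Lit 0)).

Definition dist_update : prog :=
  PSeq (PStore new tgt_cell cand) (PStore prd tgt_cell (Var 30)).

Definition dist_body : prog :=
  PIf (Cell 4 (Var 30)) (Lit lim)
    (PIf (Lit 1) (Cell cur src_cell)
       (PIf (Cell new tgt_cell) (Lit 0) dist_update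
          (PIf (incr cand) (Cell new tgt_cell) dist_update PSkip))
       PSkip)
    PSkip.

Definition dist_copy : prog :=
  PFor 30 0 (PIf (Lit 1) (Cell 12 (Var 30)) (PStore cur (Var 30) (Lit 1))
                 (PStore cur (Var 30) (Cell new (Var 30)))).

Definition dist_round : prog :=
  PSeq dist_init (PSeq (PFor 30 1 dist_body) dist_copy).

(** One more round after the [n] rounds to the fixed point makes the stored
    predecessors agree with the final distances. *)
Definition dists : prog := PSeq (PFor 32 0 dist_round) dist_round.
End DistProgram.

Section Verify.
Variables (G : digraph) (L : finType) (I : instance G L) (s q : verts G).
Hypothesis Gsp : sp_digraph s q.
Implicit Types (x y v w t u : verts G) (a b : arcs G) (l : L) (M : memory).

Local Notation n := #|verts G|.
Local Notation m := #|arcs G|.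

Definition start_data M : Prop := forall v, M 12 (rk v) = Posz (block_start I s v).

Section Starts.
Hypothesis Isrc : unique_source I s.
Hypothesis Ipar : parallel_sinks I.
Hypothesis Lpos : 0 < #|L|.

(** Only [s] has a positive balance, in each scenario; the one of rank zero is
    used to recognise [s], as its balances come first. *)
Definition scenario0 : L := enum_val (Ordinal Lpos).

Lemma rk_scenario0 : rk scenario0 = 0.
Proof. by rewrite /scenario0 enum_valK. Qed.

Lemma eval_balance0 M e v : graph_data I M -> eval M e = (rk v)%:Z%R ->
  eval M (Cell 5 e) = bal I scenario0 v.
Proof. by move=> D E; rewrite -(gd_bal D) rk_scenario0 mul0n /= E. Qed.

Lemma start_flags_spec M : graph_data I M ->
  (forall v, M 10 (rk v) = code (last_of I v)) -> start_data (sem start_flags M).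
Proof.
move=> D H10; pose P j (M' : memory) :=
  forall v, rk v < j -> M' 12 (rk v) = Posz (block_start I s v).
suff H : P n (sem start_flags M) by move=> v; apply: H; exact: rk_lt.
apply: for_rank => [//|||v M' Mi fr HP u].
- exact: gd_n D.
- by [].
- have D' : graph_data I M' by apply: graph_data_frame D _ fr.
  have Ei : eval M' (Var 30) = (rk v)%:Z%R by rewrite /= Mi.
  rewrite update_other // sem_if (eval_balance0 D' Ei) sem_if_eq eval_incr Ei.
  have -> : eval M' (Cell 10 (Var 30)) = code (last_of I v) by rewrite /= Mi /= fr.
  have -> : (eval M' (Lit 1) <= bal I scenario0 v)%R = (v == s).
    by rewrite -(Isrc scenario0); rewrite /=; lia.
  have -> : (code (last_of I v) == (rk v)%:Z + 1)%R = terminal I v.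
    rewrite -(last_of_self Gsp Ipar) -(inj_eq (@code_inj G)) /code /= -PoszD addn1.
    by [].
  have E z : sem (PStore 12 (Var 30) (Lit z)) M' 12 (rk u) =
      if u == v then z else M' 12 (rk u).
    by rewrite -[sem _ M']/(update M' 12 `|eval M' (Var 30)| z) /update Ei absz_nat !eqxx rk_eq.
  rewrite rk_ltS /block_start; case: eqVneq => [Eu|nu]; rewrite ?orTb ?orFb => lt.
    subst u; by case: ifP => vs; [|case: ifP => Tv]; rewrite E eqxx ?vs ?Tv ?orbT.
  by case: ifP => vs; [|case: ifP => Tv]; rewrite E (negbTE nu) HP.
Qed.

End Starts.

Section Dist.
Variables (cur new prd : nat) (lim : int) (B : {set arcs G}).
Hypothesis banks : [/\ 12 < cur < 30, 12 < new < 30, 12 < prd < 30 & [/\ cur != new, cur != prd & new != prd]].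
Hypothesis limB : forall a, (((a \in fixed I) : nat)%:Z <= lim)%R = (a \in B).

(** The distance [e] of [y] and its last arc, of rank [p], once the arcs of rank
    less than [j] have been relaxed with source distances [c]. *)
Definition relaxed j (c : verts G -> nat) y (e : nat) (p : int) : Prop :=
  (0 < e -> exists a, [/\ tgt a = y, a \in B, 0 < c (src a),
                          e = c (src a) + cost I a & p = (rk a)%:Z%R]) /\
  (forall a, rk a < j -> a \in B -> tgt a = y -> 0 < c (src a) ->
     0 < e <= c (src a) + cost I a).

Lemma relaxed_uniq c c' y e e' p p' : relaxed m c y e p -> relaxed m c' y e' p' ->
  (forall a, tgt a = y -> c (src a) = c' (src a)) -> e = e'.
Proof.
move=> [H1 H2] [H1' H2'] E.
have half : 0 < e -> 0 < e' <= e.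
  by case/H1=> a [ay aB ca -> _]; rewrite E //; apply: H2'; rewrite -?E ?rk_lt.
have half' : 0 < e' -> 0 < e <= e'.
  by case/H1'=> a [ay aB ca -> _]; rewrite -E //; apply: H2; rewrite ?E ?rk_lt.
by case: e half half' H1 H2 => [|e]; case: e' H1' H2' => [|e'] _ _ half half' _ _ //; lia.
Qed.

Lemma dist_body_step M c (e : verts G -> nat) a : graph_data I M ->
  (forall v, M cur (rk v) = Posz (c v)) -> (forall y, M new (rk y) = Posz (e y)) ->
  M 30 0 = (rk a)%:Z%R ->
  let better := [&& a \in B, 0 < c (src a) &
                    (e (tgt a) == 0) || (c (src a) + cost I a < e (tgt a))] in
  let M' := sem (dist_body cur new prd lim) M in
  forall y,
    M' new (rk y) = Posz (if better && (y == tgt a) then c (src a) + cost I a else e y) /\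
    M' prd (rk y) = if better && (y == tgt a) then (rk a)%:Z%R else M prd (rk y).
Proof.
have [bc bn bp [cn cp np]] := banks.
move=> D Mc Mn Mi better M' y.
have Es : eval M (Cell 1 (Var 30)) = (rk (src a))%:Z%R by rewrite /= Mi /= (gd_src D).
have Et : eval M (Cell 2 (Var 30)) = (rk (tgt a))%:Z%R by rewrite /= Mi /= (gd_tgt D).
have Ec : eval M (Cell cur (Cell 1 (Var 30))) = Posz (c (src a)).
  by rewrite -Mc -(absz_nat (rk (src a))) -Es.
have En : eval M (Cell new (Cell 2 (Var 30))) = Posz (e (tgt a)).
  by rewrite -Mn -(absz_nat (rk (tgt a))) -Et.
have Ed : eval M (Plus (Cell cur (Cell 1 (Var 30))) (Cell 3 (Var 30))) =
    Posz (c (src a) + cost I a).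
  by rewrite PoszD -Ec /= Mi /= (gd_cost D).
have upd : (sem (dist_update cur new prd) M new (rk y) =
      if y == tgt a then Posz (c (src a) + cost I a) else Posz (e y)) /\
    (sem (dist_update cur new prd) M prd (rk y) =
      if y == tgt a then (rk a)%:Z%R else M prd (rk y)).
  set M1 := update M new `|eval M (Cell 2 (Var 30))|
    (eval M (Plus (Cell cur (Cell 1 (Var 30))) (Cell 3 (Var 30)))).
  have -> : sem (dist_update cur new prd) M =
    update M1 prd `|eval M1 (Cell 2 (Var 30))| (eval M1 (Var 30)) by [].
  have M1o z k : z != new -> M1 z k = M z k by exact: update_other.
  have -> : eval M1 (Cell 2 (Var 30)) = (rk (tgt a))%:Z%R.
    by rewrite -Et /= !M1o //; lia.
  have -> : eval M1 (Var 30) = (rk a)%:Z%R by rewrite /= M1o ?Mi //; lia.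
  split; first by rewrite update_other // /M1 /update eqxx Et Ed absz_nat rk_eq Mn.
  by rewrite /update eqxx absz_nat rk_eq M1o // eq_sym.
have E4 : (eval M (Cell 4 (Var 30)) <= eval M (Lit lim))%R = (a \in B).
  by rewrite -limB /= Mi /= (gd_fixed D).
have E0 : (eval M (Cell new (Cell 2 (Var 30))) <= eval M (Lit 0))%R = (e (tgt a) == 0).
  by rewrite En /=; lia.
have E1 : (eval M (incr (Plus (Cell cur (Cell 1 (Var 30))) (Cell 3 (Var 30)))) <=
    eval M (Cell new (Cell 2 (Var 30))))%R = (c (src a) + cost I a < e (tgt a)).
  by rewrite eval_incr Ed En -PoszD lez_nat addn1.
have E5 : (eval M (Lit 1) <= eval M (Cell cur (Cell 1 (Var 30))))%R = (0 < c (src a)).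
  by rewrite Ec lez_nat.
set N := sem (dist_update cur new prd) M in upd.
have -> : M' = if better then N else M.
  rewrite /M' /dist_body !sem_if E4 E5 E0 E1 -/N /better.
  by case: (a \in B); case: (0 < c _); case: (e _ == 0); case: (_ < e _).
by case: better; [rewrite !(fun_if Posz); exact: upd|rewrite Mn].
Qed.

Lemma writes_round : writes (dist_round cur new prd lim) =
  [:: 30; new; 30; new; prd; new; prd; 30; cur; cur].
Proof. by []. Qed.

Lemma banks_out z : z \notin [:: 30; 32; cur; new; prd] ->
  z \notin 32 :: writes (dist_round cur new prd lim).
Proof. by rewrite writes_round !inE !negb_or; case/and5P=> -> -> -> -> ->. Qed.

Lemma dist_round_spec M c : graph_data I M -> start_data M ->
  (forall v, M cur (rk v) = Posz (c v)) ->
  let M' := sem (dist_round cur new prd lim) M in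
  exists e : verts G -> nat,
    forall y, [/\ M' new (rk y) = Posz (e y), relaxed m c y (e y) (M' prd (rk y)) &
                  M' cur (rk y) = Posz (if block_start I s y then 1 else e y)].
Proof.
have [bc bn bp [cn cp np]] := banks; move=> D S Mc.
rewrite -[sem (dist_round _ _ _ _) M]/(sem (dist_copy cur new)
  (sem (PFor 30 1 (dist_body cur new prd lim)) (sem (dist_init new) M))).
set M1 := sem (dist_init new) M; set M2 := sem (PFor 30 1 _) M1.
have M1o z k : z != new -> z != 30 -> M1 z k = M z k.
  by move=> z1 z2; rewrite /M1 frame // /= !inE negb_or z1 z2.
have M2o z k : z != new -> z != prd -> z != 30 -> M2 z k = M z k.
  by move=> z1 z2 z3; rewrite /M2 frame ?M1o //= !inE !negb_or z1 z2 z3.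
have D1 : graph_data I M1.
  by apply: graph_data_agree D => z k z6; rewrite M1o //; lia.
have D2 : graph_data I M2.
  by apply: graph_data_agree D => z k z6; rewrite M2o //; lia.
have init1 y : M1 new (rk y) = 0%R.
  pose P j (M' : memory) := forall y, rk y < j -> M' new (rk y) = 0%R.
  suff H : P n M1 by apply: H; exact: rk_lt.
  apply: for_rank => [||//|v M' Mi fr HP u].
  - by rewrite /= !inE; lia.
  - exact: gd_n D.
  - rewrite rk_ltS update_other /= ?/update ?eqxx ?Mi /= ?rk_eq; last by lia.
    by case: eqVneq => [->|_ /= /HP].
have [e He] : exists e : verts G -> nat,
    forall y, M2 new (rk y) = Posz (e y) /\ relaxed m c y (e y) (M2 prd (rk y)).
  pose P j (M' : memory) := exists e : verts G -> nat,
    forall y, M' new (rk y) = Posz (e y) /\ relaxed j c y (e y) (M' prd (rk y)).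
  suff : P m M2 by [].
  apply: for_rank => [|||a M' Mi fr [e He]].
  - by rewrite /= !inE; lia.
  - exact: gd_m D1.
  - exists (fun=> 0) => y; rewrite update_other; last by lia.
    by rewrite init1; split=> //; split.
  - have frz z k : z != new -> z != prd -> z != 30 -> M' z k = M1 z k.
      by move=> z1 z2 z3; rewrite fr //= !inE !negb_or z1 z2 z3.
    have D' : graph_data I M'.
      by apply: graph_data_agree D1 => z k z6; rewrite frz //; lia.
    have M'c v : M' cur (rk v) = Posz (c v).
      by rewrite frz ?M1o ?Mc //; lia.
    have := dist_body_step D' M'c (fun y => (He y).1) Mi.
    set better := [&& _, _ & _] => step; eexists => y.
    rewrite !update_other; [|lia|lia].
    have [-> ->] := step y; split; first by [].
    have [_ [H1 H2]] := He y; case: ifP => [/andP[/and3P[aB ca eb] /eqP Ey]|nb].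
      subst y; split=> [_|a']; first by exists a.
      rewrite rk_ltS => /orP[/eqP -> _ _ _|lt a'B Ea ca']; first by lia.
      by have := H2 a' lt a'B Ea ca'; lia.
    split=> // a'; rewrite rk_ltS => /orP[/eqP -> aB Ea ca|]; last exact: H2.
    by move: nb; rewrite /better aB ca Ea eqxx /=; lia.
set M3 := sem _ M2; exists e => y; have [E1 E2] := He y.
have M3o z k : z != cur -> z != 30 -> M3 z k = M2 z k.
  by move=> z1 z2; rewrite /M3 frame // /= !inE !negb_or z1 z2.
split; [by rewrite M3o // 1?eq_sym //; lia|by rewrite M3o 1?eq_sym //; lia|].
pose P j (M' : memory) := forall y, rk y < j ->
  M' cur (rk y) = Posz (if block_start I s y then 1 else e y).
suff H : P n M3 by apply: H; exact: rk_lt.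
apply: for_rank => [||//|v M' Mi fr HP u].
- by rewrite /= !inE; lia.
- exact: gd_n D2.
- have frz z k : z != cur -> z != 30 -> M' z k = M2 z k.
    by move=> z1 z2; rewrite fr //= !inE !negb_or z1 z2.
  have Ev : eval M' (Var 30) = (rk v)%:Z%R by rewrite /= Mi.
  have E12 : eval M' (Cell 12 (Var 30)) = Posz (block_start I s v).
    by rewrite -S /= Mi /= frz ?M2o //; lia.
  have En : eval M' (Cell new (Var 30)) = Posz (e v).
    by rewrite -(He v).1 /= Mi /= frz //; [rewrite eq_sym|lia].
  have Eu val : update M' cur `|eval M' (Var 30)| val cur (rk u) =
      if u == v then val else M' cur (rk u).
    by rewrite /update eqxx Ev absz_nat rk_eq.
  rewrite rk_ltS update_other; last by lia.
  rewrite sem_if E12; case: (boolP (block_start I s v)) => sv;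
    rewrite /= ?Eu -?/(eval M' (Cell new (Var 30))) ?En.
  + case: eqVneq => [->|_ /= /HP //]; by rewrite sv.
  + case: eqVneq => [->|_ /= /HP //]; by rewrite (negbTE sv).
Qed.

(** After [j] rounds the values are final at all vertices of depth less than
    [j], as a vertex takes its value from vertices of smaller depth. *)
Lemma dists_spec M : graph_data I M -> start_data M ->
  (forall k, M cur k = 0%R) ->
  let M' := sem (dists cur new prd lim) M in
  exists c e p, dist_tree I s B c e p /\
    forall v, M' new (rk v) = Posz (e v) /\ (0 < e v -> M' prd (rk v) = (rk (p v))%:Z%R).
Proof.
have [bc bn bp [cn cp np]] := banks; move=> D S M0 M'.
set round := dist_round cur new prd lim.
pose settled (c : verts G -> nat) v := if block_start I s v then c v = 1
  else exists p, relaxed m c v (c v) p.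
pose P j (M2 : memory) := exists c, (forall v, M2 cur (rk v) = Posz (c v)) /\
  forall v, depth v < j -> settled c v.
have keep M2 z : (forall b k : nat, b \notin 32 :: writes round -> M2 b k = M b k) ->
    z <= 12 -> forall k, M2 z k = M z k.
  move=> fr z12 k; apply: fr; apply: banks_out; rewrite !inE !negb_or; lia.
have env M2 : (forall b k : nat, b \notin 32 :: writes round -> M2 b k = M b k) ->
    graph_data I M2 /\ start_data M2.
  move=> fr; split; first by apply: graph_data_agree D => z k z6; apply: keep => //; lia.
  by move=> v; rewrite keep.
have [c [Mc Hc]] : P n (sem (PFor 32 0 round) M).
  rewrite -[n]absz_nat -(gd_n D); apply: for_ind.
  - by rewrite /= !inE; lia.
  - exists (fun=> 0); split=> // v; rewrite update_other ?M0 //; lia.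
  - move=> j M2 _ Mi fr [c [Mc Hc]]; have [D2 S2] := env M2 fr.
    have [e He] := dist_round_spec D2 S2 Mc; rewrite -/round in He.
    pose c' v := if block_start I s v then 1 else e v; exists c'.
    split=> [v|v dv]; first by have [_ _ <-] := He v; rewrite update_other //; lia.
    have same a : tgt a = v -> c (src a) = c' (src a).
      move=> av; have /Hc : depth (src a) < j.
        by have := depth_arc Gsp a; rewrite av; lia.
      rewrite /settled /c'; case: ifP => // _ [p Hp].
      have [_ He' _] := He (src a).
      by apply: relaxed_uniq Hp He' _.
    rewrite /settled; case: ifP => ns; first by rewrite /c' ns.
    have -> : c' v = e v by rewrite /c' ns.
    have [_ [H1 H2] _] := He v; eexists; split.
      by case/H1=> a [av aB ca E Ep]; exists a; rewrite -same //; split=> //; exact: Ep.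
    by move=> a lt aB av; rewrite -same // => ca; exact: H2.
set M1 := sem (PFor 32 0 round) M in Mc.
have fr1 (b k : nat) : b \notin 32 :: writes round -> M1 b k = M b k.
  exact: (@frame (PFor 32 0 round)).
have [D1 S1] := env M1 fr1; have [e He] := dist_round_spec D1 S1 Mc.
have EM' : M' = sem round M1 by [].
rewrite -/round -EM' in He.
have cE v : c v = if block_start I s v then 1 else e v.
  have := Hc v (depth_bound v); rewrite /settled; case: ifP => // _ [p Hp].
  by have [_ He' _] := He v; apply: relaxed_uniq Hp He' _.
have [p Hp] : exists p : verts G -> arcs G, forall v, 0 < e v ->
    [/\ tgt (p v) = v, p v \in B, 0 < c (src (p v)), e v = c (src (p v)) + cost I (p v) &
        M' prd (rk v) = (rk (p v))%:Z%R].
  have [St inc] := sp_digraph_sp_set Gsp; have /exists_inP[a0 _ _] := inc s.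
  suff H v : exists a, 0 < e v -> [/\ tgt a = v, a \in B, 0 < c (src a),
      e v = c (src a) + cost I a & M' prd (rk v) = (rk a)%:Z%R].
    exact: fin_all_exists H.
  have [_ [H1 _] _] := He v; have [ev|] := boolP (0 < e v); last by exists a0.
  by have [a Ha] := H1 ev; exists a.
exists c, e, p; split; last first.
  by move=> v; have [? _ _] := He v; split=> // /Hp[].
split=> // [y /Hp[]//|a aB ca].
by have [_ [_ H2] _] := He (tgt a); apply: H2; rewrite ?rk_lt.
Qed.
End Dist.
End Verify.

(** * The program: demands and routing *)

Definition at_beta (l v : expr) : expr := Cell 19 (Plus (Cell 7 l) v).

(** From each vertex the program climbs [n] times to the source of the
    predecessor arc, and subtracts the balance of the start at each vertex on the
    way.  Only [s] has distance zero, so the walk stops there. *)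
Definition beta_add : prog :=
  PFor 32 2 (PStore 19 (Plus (Cell 7 (Var 32)) (Var 23))
    (Minus (at_beta (Var 32) (Var 23)) (at_balance (Var 32) (Var 30)))).

Definition beta_climb : prog :=
  PIf (Lit 1) (Cell 14 (Var 23))
      (PStore 23 (Lit 0) (Cell 1 (Cell 15 (Var 23)))) PSkip.

Definition betas : prog :=
  PFor 30 0 (PSeq (PStore 23 (Lit 0) (Var 30))
                  (PFor 31 0 (PSeq beta_add beta_climb))).

Definition least_demand : prog :=
  PSeq (PStore 24 (Lit 0) (Cell 19 (Var 30)))
       (PFor 31 2 (PIf (at_beta (Var 31) (Var 30)) (Var 24)
          (PStore 24 (Lit 0) (at_beta (Var 31) (Var 30))) PSkip)).

Definition choose_amount : prog :=
  PIf (Lit 1) (Cell 17 (Var 30))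
      (PIf (Cell 17 (Var 30)) (Cell 14 (Var 30)) (PStore 24 (Lit 0) (Lit 0)) PSkip)
      PSkip.

(** The path is followed backwards from its end to the block start; the first arc
    is taken unconditionally since the end is a block start as well. *)
Definition route_arc (prd : nat) : prog :=
  PSeq (PFor 32 2 (PStore 6 (Plus (Cell 8 (Var 32)) (Cell prd (Var 23)))
          (Plus (Cell 6 (Plus (Cell 8 (Var 32)) (Cell prd (Var 23)))) (Cell 20 (Var 32)))))
       (PStore 23 (Lit 0) (Cell 1 (Cell prd (Var 23)))).

Definition route (prd : nat) : prog :=
  PSeq (PStore 23 (Lit 0) (Var 30))
  (PSeq (route_arc prd)
        (PFor 31 0 (PIf (Cell 12 (Var 23)) (Lit 0) (route_arc prd) PSkip))).

Definition fixed_demands : prog := PFor 31 2 (PStore 20 (Var 31) (Var 24)).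
Definition free_demands : prog :=
  PFor 31 2 (PStore 20 (Var 31) (Minus (at_beta (Var 31) (Var 30)) (Var 24))).

Definition route_block : prog :=
  PSeq least_demand (PSeq choose_amount (PSeq fixed_demands (PSeq (route 15)
    (PIf (Lit 1) (Cell 17 (Var 30)) (PSeq free_demands (route 18)) PSkip)))).

Definition output_flow : prog :=
  PFor 30 0 (PIfEq (Cell 10 (Var 30)) (incr (Var 30))
    (PIf (Cell 5 (Var 30)) (Lit 0) route_block PSkip) PSkip).

Lemma addr_eq (T1 T2 : finType) (x x' : T1) (y y' : T2) :
  (rk x * #|T2| + rk y == rk x' * #|T2| + rk y') = (x == x') && (y == y').
Proof.
have T2pos : 0 < #|T2| by exact: leq_ltn_trans (leq0n _) (rk_lt y).
apply/eqP/andP => [E|[/eqP -> /eqP ->] //].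
have := congr1 (divn^~ #|T2|) E; rewrite !divnMDl // !divn_small ?rk_lt // !addn0.
have := congr1 (modn^~ #|T2|) E; rewrite !modnMDl !modn_small ?rk_lt //.
by move=> /eqP; rewrite rk_eq => -> /eqP; rewrite rk_eq.
Qed.

Lemma sum_rkS (T : finType) (x : T) (F : T -> int) :
  (\sum_(y | (rk y < (rk x).+1)%N) F y = F x + \sum_(y | (rk y < rk x)%N) F y)%R.
Proof.
rewrite (bigD1 x) ?ltnSn //=; congr (_ + _)%R; apply: eq_bigl => y.
rewrite rk_ltS; case: eqVneq => [->|_]; first by rewrite ltnn.
by rewrite andbT.
Qed.

Lemma sum_rk_all (T : finType) (F : T -> int) :
  (\sum_(y | (rk y < #|T|)%N) F y = \sum_y F y)%R.
Proof. by apply: eq_bigl => y; rewrite rk_lt. Qed.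

Section Verify.
Variables (G : digraph) (L : finType) (I : instance G L) (s q : verts G).
Hypothesis Gsp : sp_digraph s q.
Hypothesis Isrc : unique_source I s.
Hypothesis Ipar : parallel_sinks I.
Implicit Types (x y v w t u : verts G) (a : arcs G) (l : L) (M : memory).

Local Notation n := #|verts G|.
Local Notation m := #|arcs G|.

Section Betas.
Variables (e : verts G -> nat) (p : verts G -> arcs G).

Local Notation climb := (up e p).

Definition visits k t w : int := (\sum_(j < k) (Posz (iter j climb t == w)))%R.

Lemma beta_add_spec M t x : graph_data I M -> row_data G L M ->
  M 30 0 = (rk t)%:Z%R -> M 23 0 = (rk x)%:Z%R ->
  forall l w, sem beta_add M 19 (rk l * n + rk w) =
    (M 19 (rk l * n + rk w)%N + Posz (x == w) * - bal I l t)%R.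
Proof.
move=> D R M30 M23.
pose P j (M' : memory) := forall l w, M' 19 (rk l * n + rk w) =
  (M 19 (rk l * n + rk w)%N + Posz ((rk l < j)%N && (x == w)) * - bal I l t)%R.
suff H : P #|L| (sem beta_add M) by move=> l w; rewrite H rk_lt.
apply: for_rank => [//||l w /=|l M' Mi fr HP l' w].
- exact: gd_k D.
- by rewrite /update /= mul0r addr0.
- have D' : graph_data I M' by apply: graph_data_frame D _ fr.
  have R' : row_data G L M' by move=> k; rewrite !fr.
  have E7 : eval M' (Cell 7 (Var 32)) = (rk l * n)%:Z%R by rewrite /= Mi (R' l).1.
  have E23 : eval M' (Var 23) = (rk x)%:Z%R by rewrite /= fr.
  have Eb : eval M' (at_balance (Var 32) (Var 30)) = bal I l t.
    by apply: eval_balance; rewrite //= fr.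
  have Ea : eval M' (Plus (Cell 7 (Var 32)) (Var 23)) = (rk l * n + rk x)%:Z%R.
    by rewrite PoszD -E7 -E23.
  rewrite update_other //.
  rewrite -[sem _ M']/(update M' 19 `|eval M' (Plus (Cell 7 (Var 32)) (Var 23))|
     (M' 19 `|eval M' (Plus (Cell 7 (Var 32)) (Var 23))|%N -
      eval M' (at_balance (Var 32) (Var 30)))%R).
  rewrite Ea Eb absz_nat /update eqxx addr_eq !HP rk_ltS.
  case: eqVneq => [->|nl] /=; last by [].
  rewrite ltnn /= mul0r !addr0 (eq_sym w); case: eqVneq => [->|_] /=.
    by rewrite mul1r.
  by rewrite mul0r addr0.
Qed.

Lemma betas_spec M : graph_data I M -> row_data G L M -> (forall k, M 19 k = 0%R) ->
  (forall v, M 14 (rk v) = Posz (e v)) ->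
  (forall v, 0 < e v -> M 15 (rk v) = (rk (p v))%:Z%R) ->
  forall l w, sem betas M 19 (rk l * n + rk w) =
    (\sum_t visits n t w * - bal I l t)%R.
Proof.
move=> D R M19 M14 M15.
pose P j (M' : memory) := forall l w, M' 19 (rk l * n + rk w) =
  (\sum_(t | (rk t < j)%N) visits n t w * - bal I l t)%R.
suff H : P n (sem betas M) by move=> l w; rewrite H sum_rk_all.
apply: for_rank => [//||l w /=|t M' Mi fr HP l w].
- exact: gd_n D.
- by rewrite /update /= M19 big1.
- have D' : graph_data I M' by apply: graph_data_frame D _ fr.
  rewrite update_other // sum_rkS addrC.
  rewrite -[sem _ M']/(sem (PFor 31 0 (PSeq beta_add beta_climb))
     (sem (PStore 23 (Lit 0) (Var 30)) M')).
  set M1 := sem (PStore 23 _ _) M'.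
  have fr1 (b k : nat) : b != 23 -> M1 b k = M' b k by exact: update_other.
  have D1 : graph_data I M1.
    by apply: graph_data_agree D' => b k b6; rewrite fr1 //; lia.
  pose Q j (M2 : memory) := M2 23 0 = (rk (iter j climb t))%:Z%R /\
    forall l w, M2 19 (rk l * n + rk w) =
      (M' 19 (rk l * n + rk w)%N + visits j t w * - bal I l t)%R.
  suff [_ ->] : Q n (sem (PFor 31 0 (PSeq beta_add beta_climb)) M1) by rewrite HP.
  rewrite -[n]absz_nat -(gd_n D1); apply: for_ind => //.
    split; first by rewrite update_other // /M1 /= /update /= Mi.
    by move=> l' w'; rewrite /visits big_ord0 mul0r addr0 update_other // fr1.
  move=> j M2 _ M2i fr2 [H23 H19].
  have D2 : graph_data I M2 by apply: graph_data_frame D1 _ fr2.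
  have R2 : row_data G L M2 by move=> k; rewrite !fr2 // !fr1 // !fr.
  have M2t : M2 30 0 = (rk t)%:Z%R by rewrite fr2 // fr1.
  set x := iter j climb t in H23.
  rewrite -[sem _ M2]/(sem beta_climb (sem beta_add M2)).
  set M3 := sem beta_add M2.
  have fr3 (b k : nat) : b \notin [:: 32; 19] -> M3 b k = M2 b k.
    exact: (@frame beta_add).
  have D3 : graph_data I M3.
    by apply: graph_data_agree D2 => b k b6; rewrite fr3 // !inE; lia.
  split; last first.
    move=> l' w'; rewrite update_other // frame //.
    rewrite /M3 (beta_add_spec D2 R2 M2t H23) H19 /visits big_ord_recr /= -/x mulrDl.
    by rewrite addrA.
  rewrite update_other // sem_if.
  have E14 : eval M3 (Cell 14 (Var 23)) = Posz (e x).
    by rewrite /= (fr3 23) // H23 /= fr3 // fr2 // fr1 // fr // M14.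
  rewrite E14 lez_nat /= -/x /up; case: ifP => ex; last by rewrite fr3.
  rewrite /update /= (fr3 23) // H23 /= !fr3 // (fr2 15) // (fr1 15) // (fr 15) // M15 //=.
  by rewrite (gd_src D2).
Qed.
End Betas.

Section Routing.
Variables (B : {set arcs G}) (c e : verts G -> nat) (p : verts G -> arcs G).
Hypothesis T : dist_tree I s B c e p.
Variable prd : nat.
Hypothesis prd_bank : 12 < prd < 19.

Lemma route_arc_spec M x : graph_data I M -> row_data G L M ->
  M 23 0 = (rk x)%:Z%R -> M prd (rk x) = (rk (p x))%:Z%R ->
  sem (route_arc prd) M 23 0 = (rk (src (p x)))%:Z%R /\
  forall l a, sem (route_arc prd) M 6 (rk l * m + rk a) =
    (M 6 (rk l * m + rk a)%N + Posz (p x == a) * M 20 (rk l))%R.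
Proof.
move=> D R M23 Mp.
set c1 := PFor 32 2 (PStore 6 (Plus (Cell 8 (Var 32)) (Cell prd (Var 23)))
          (Plus (Cell 6 (Plus (Cell 8 (Var 32)) (Cell prd (Var 23)))) (Cell 20 (Var 32)))).
rewrite -[sem _ M]/(sem (PStore 23 (Lit 0) (Cell 1 (Cell prd (Var 23)))) (sem c1 M)).
set M1 := sem c1 M.
have fr1 (b k : nat) : b \notin [:: 32; 6] -> M1 b k = M b k by exact: (@frame c1).
split.
  rewrite /= /update /= (fr1 23) // M23 /= (fr1 prd) ?Mp /=; last by rewrite !inE; lia.
  by rewrite fr1 // (gd_src D).
move=> l a; rewrite frame //.
pose P j (M' : memory) := forall l a, M' 6 (rk l * m + rk a) =
  (M 6 (rk l * m + rk a)%N + Posz ((rk l < j)%N && (p x == a)) * M 20 (rk l))%R.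
suff H : P #|L| M1 by rewrite H rk_lt.
apply: for_rank => [//||{}l {}a /=|{}l M' Mi fr HP l' {}a].
- exact: gd_k D.
- by rewrite /update /= mul0r addr0.
- have R' : row_data G L M' by move=> k; rewrite !fr.
  have Ea : eval M' (Plus (Cell 8 (Var 32)) (Cell prd (Var 23))) = (rk l * m + rk (p x))%:Z%R.
    by rewrite PoszD -(R' l).2 -Mp /= Mi (fr 23) // M23 /= (fr prd) // !inE; lia.
  rewrite update_other //.
  rewrite -[sem _ M']/(update M' 6 `|eval M' (Plus (Cell 8 (Var 32)) (Cell prd (Var 23)))|
     (M' 6 `|eval M' (Plus (Cell 8 (Var 32)) (Cell prd (Var 23)))|%N +
      eval M' (Cell 20 (Var 32)))%R).
  have -> : eval M' (Cell 20 (Var 32)) = M 20 (rk l) by rewrite /= Mi /= fr.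
  rewrite Ea absz_nat /update eqxx addr_eq !HP rk_ltS.
  case: eqVneq => [->|nl] /=; last by [].
  rewrite ltnn /= mul0r !addr0 (eq_sym a); case: eqVneq => [->|_] /=.
    by rewrite mul1r.
  by rewrite mul0r addr0.
Qed.

Lemma route_spec M w : graph_data I M -> row_data G L M -> start_data I s M ->
  (forall v, 0 < e v -> M prd (rk v) = (rk (p v))%:Z%R) ->
  terminal I w -> 0 < e w -> M 30 0 = (rk w)%:Z%R ->
  forall l a, sem (route prd) M 6 (rk l * m + rk a) =
    (M 6 (rk l * m + rk a)%N + Posz (count_mem a (trace I s p w).2) * M 20 (rk l))%R.
Proof.
move=> D R S Mp Tw ew M30.
pose c2 := PFor 31 0 (PIf (Cell 12 (Var 23)) (Lit 0) (route_arc prd) PSkip).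
rewrite -[sem _ M]/(sem c2 (sem (route_arc prd) (sem (PStore 23 (Lit 0) (Var 30)) M))).
set M1 := sem (PStore 23 _ _) M; set M2 := sem (route_arc prd) M1.
have fr1 (b k : nat) : b != 23 -> M1 b k = M b k by exact: update_other.
have D1 : graph_data I M1 by apply: graph_data_agree D => b k b6; rewrite fr1 //; lia.
have R1 : row_data G L M1 by move=> l; rewrite !fr1.
have M1x : M1 23 0 = (rk w)%:Z%R by rewrite /M1 /= /update /= M30.
have [H23 H6] : M2 23 0 = (rk (src (p w)))%:Z%R /\ forall l a,
    M2 6 (rk l * m + rk a) = (M1 6 (rk l * m + rk a)%N + Posz (p w == a) * M1 20 (rk l))%R.
  by apply: route_arc_spec => //; rewrite fr1 ?Mp //; lia.
have fr2 (b k : nat) : b \notin [:: 32; 6; 23] -> M2 b k = M1 b k.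
  exact: (@frame (route_arc prd)).
have D2 : graph_data I M2.
  by apply: graph_data_agree D1 => b k b6; rewrite fr2 // !inE; lia.
pose state j := iter j (trace_step I s p) (src (p w), [:: p w]).
pose P j (M' : memory) := M' 23 0 = (rk (state j).1)%:Z%R /\ forall l a,
  M' 6 (rk l * m + rk a) =
  (M 6 (rk l * m + rk a)%N + Posz (count_mem a (state j).2) * M 20 (rk l))%R.
suff [_ H] : P n (sem c2 M2) by exact: H.
rewrite -[n]absz_nat -(gd_n D2); apply: for_ind => //.
  split=> [|l a]; first by rewrite update_other.
  by rewrite update_other // H6 !fr1 //= addn0.
move=> j M' _ Mi fr [E23 E6].
have D' : graph_data I M' by apply: graph_data_frame D2 _ fr.
have R' : row_data G L M' by move=> l; rewrite !fr // !fr2 // !fr1.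
have [_ _ c0 _ _] := trace_inv Gsp Ipar T j Tw ew; rewrite -/(state j) in c0.
have E12 : eval M' (Cell 12 (Var 23)) = Posz (block_start I s (state j).1).
  by rewrite /= E23 /= fr // fr2 // fr1 // S.
have stateS : state j.+1 = trace_step I s p (state j) by [].
rewrite /P stateS /trace_step sem_if E12.
have -> : (Posz (block_start I s (state j).1) <= eval M' (Lit 0))%R =
    ~~ block_start I s (state j).1 by case: block_start.
case: (boolP (block_start I s (state j).1)) => st.
  by split=> [|l a]; rewrite update_other // /= ?E6.
have ex : 0 < e (state j).1.
  by move: c0; have [-> _ _] := T; rewrite (negbTE st).
have Mpx : M' prd (rk (state j).1) = (rk (p (state j).1))%:Z%R.
  have np : prd \notin [:: 31; 32; 6; 23] by rewrite !inE; lia.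
  rewrite fr // fr2 ?fr1 ?Mp //; last by rewrite !inE; lia.
  lia.
have [F23 F6] := route_arc_spec D' R' E23 Mpx.
split=> [|l a]; rewrite update_other //.
rewrite F6 E6.
have -> : M' 20 (rk l) = M 20 (rk l) by rewrite fr // fr2 // fr1.
by rewrite /= PoszD mulrDl addrAC addrA.
Qed.
End Routing.
End Verify.

(** * The program: output *)

Definition label_tree_program : prog :=
  PSeq rows (PSeq sink_flags (PSeq lasts (PSeq start_flags
  (PSeq (dists 13 14 15 1) (PSeq (dists 16 17 18 0) (PSeq betas output_flow)))))).

Section Verify.
Variables (G : digraph) (L : finType) (I : instance G L) (s q : verts G).
Hypothesis Gsp : sp_digraph s q.
Hypothesis Isrc : unique_source I s.
Hypothesis Ipar : parallel_sinks I.
Hypothesis Lpos : 0 < #|L|.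
Implicit Types (x y v w t u : verts G) (a : arcs G) (l : L) (M : memory).

Local Notation n := #|verts G|.
Local Notation m := #|arcs G|.

Definition least (d : L -> nat) : nat :=
  let d0 := \max_(l : L) d l in \big[minn/d0]_(l : L) d l.

Lemma least_uniq (d : L -> nat) k : (forall l, k <= d l) -> (exists l, k = d l) ->
  k = least d.
Proof.
move=> low [l E]; have [low' [l' E']] := bigmin_spec d l.
by apply/eqP; rewrite eqn_leq /least {1}E' low E low'.
Qed.

Lemma least_demand_spec M w (d : L -> nat) : graph_data I M -> row_data G L M ->
  M 30 0 = (rk w)%:Z%R -> (forall l, M 19 (rk l * n + rk w) = Posz (d l)) ->
  sem least_demand M 24 0 = Posz (least d).
Proof.
move=> D R M30 M19; set M1 := sem (PStore 24 (Lit 0) (Cell 19 (Var 30))) M.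
have fr1 (b k : nat) : b != 24 -> M1 b k = M b k by exact: update_other.
have D1 : graph_data I M1 by apply: graph_data_agree D => b k b6; rewrite fr1 //; lia.
pose P j (M' : memory) := exists l, M' 24 0 = Posz (d l) /\
  forall l', rk l' < j -> d l <= d l'.
have [l [-> low]] : P #|L| (sem least_demand M).
  rewrite -[sem least_demand M]/(sem (PFor 31 2 (PIf (at_beta (Var 31) (Var 30)) (Var 24)
          (PStore 24 (Lit 0) (at_beta (Var 31) (Var 30))) PSkip)) M1).
  apply: for_rank => [//|||l M' Mi fr [l1 [E low]]].
  - exact: gd_k D1.
  - exists (scenario0 Lpos); split=> //.
    rewrite update_other // /M1 /= /update /= M30 /= -M19.
    by rewrite rk_scenario0 mul0n.
  - have Eb : eval M' (at_beta (Var 31) (Var 30)) = Posz (d l).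
      rewrite -M19 /= Mi /= (fr 30) // fr1 // M30 (fr 7) // fr1 // (R l).1 -PoszD /=.
      by rewrite fr // fr1.
    rewrite /P update_other // sem_if Eb; have -> : eval M' (Var 24) = Posz (d l1) by [].
    rewrite lez_nat; case: leqP => le.
      exists l; split; last first.
        by move=> l'; rewrite rk_ltS => /orP[/eqP ->|/low /(leq_trans le)].
      by rewrite -Eb /= /update /=.
    exists l1; split=> [//|l']; rewrite rk_ltS => /orP[/eqP ->|/low //]; exact: ltnW.
congr Posz; apply: least_uniq; last by exists l.
by move=> l'; apply: low; exact: rk_lt.
Qed.

Section Output.
Variables (c1 e1 c2 e2 : verts G -> nat) (p1 p2 : verts G -> arcs G).
Hypothesis T1 : dist_tree I s setT c1 e1 p1.
Hypothesis T2 : dist_tree I s (~: fixed I) c2 e2 p2.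

(** The test compares the costs of the two paths; a zero distance stands for the
    absence of a free path. *)
Definition amount w : nat :=
  if (0 < e2 w) && (e2 w <= e1 w) then 0 else least (fun l => beta I l w).

Definition block_flow l w a : nat :=
  amount w * count_mem a (trace I s p1 w).2 +
  (if 0 < e2 w then (beta I l w - amount w) * count_mem a (trace I s p2 w).2 else 0).

Lemma amount_le l w : amount w <= beta I l w.
Proof.
rewrite /amount; case: ifP => // _; exact: (bigmin_spec (fun l => beta I l w) l).1.
Qed.

Record tables M : Prop := Tables {
  tb_graph : graph_data I M;
  tb_rows : row_data G L M;
  tb_start : start_data I s M;
  tb_last : forall v, M 10 (rk v) = code (last_of I v);
  tb_e1 : forall v, M 14 (rk v) = Posz (e1 v);
  tb_p1 : forall v, 0 < e1 v -> M 15 (rk v) = (rk (p1 v))%:Z%R;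
  tb_e2 : forall v, M 17 (rk v) = Posz (e2 v);
  tb_p2 : forall v, 0 < e2 v -> M 18 (rk v) = (rk (p2 v))%:Z%R;
  tb_beta : forall l w, terminal I w -> w != s ->
    M 19 (rk l * n + rk w) = Posz (beta I l w)
}.

Lemma tables_agree M M' : (forall b k : nat, b < 20 -> b != 6 -> M' b k = M b k) ->
  tables M -> tables M'.
Proof.
move=> E [D R S H10 H14 H15 H17 H18 H19]; split.
- by apply: graph_data_agree D => b k b6; rewrite E //; lia.
- by move=> l; rewrite !E.
- by move=> v; rewrite E.
- by move=> v; rewrite E.
- by move=> v; rewrite E.
- by move=> v ev; rewrite E // H15.
- by move=> v; rewrite E.
- by move=> v ev; rewrite E // H18.
- by move=> l w Tw ws; rewrite E // H19.
Qed.

Lemma tables_frame (S : seq nat) M M' : tables M ->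
  all (fun b => (b == 6) || (20 <= b)) S ->
  (forall b k : nat, b \notin S -> M' b k = M b k) -> tables M'.
Proof.
move=> T /allP H fr; apply: tables_agree T => b k b20 b6; apply: fr.
by apply/negP=> /H; lia.
Qed.

Lemma demands_spec e M (d : L -> int) : graph_data I M ->
  (forall M' l, M' 31 0 = (rk l)%:Z%R -> (forall b k : nat, b \notin [:: 31; 20] -> M' b k = M b k) ->
     eval M' e = d l) ->
  forall l, sem (PFor 31 2 (PStore 20 (Var 31) e)) M 20 (rk l) = d l.
Proof.
move=> D He; pose P j (M' : memory) := forall l, rk l < j -> M' 20 (rk l) = d l.
suff H : P #|L| (sem (PFor 31 2 (PStore 20 (Var 31) e)) M) by move=> l; apply: H; exact: rk_lt.
apply: for_rank => [//|||l M' Mi fr HP l'].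
- exact: gd_k D.
- by [].
- rewrite rk_ltS update_other //.
  rewrite -[sem _ M']/(update M' 20 `|eval M' (Var 31)| (eval M' e)).
  have -> : eval M' (Var 31) = (rk l)%:Z%R by rewrite /= Mi.
  rewrite (He M' l Mi fr) /update eqxx absz_nat rk_eq.
  by case: eqVneq => [->|_ /= /HP].
Qed.

Lemma route_block_spec M w : tables M -> terminal I w -> w != s -> M 30 0 = (rk w)%:Z%R ->
  forall l a, sem route_block M 6 (rk l * m + rk a) =
    (M 6 (rk l * m + rk a)%N + Posz (block_flow l w a))%R.
Proof.
move=> Tb Tw ws M30 l a.
have e1w : 0 < e1 w by rewrite (dist_pos Gsp T1).
set M1 := sem least_demand M; set M2 := sem choose_amount M1.
set M3 := sem fixed_demands M2; set M4 := sem (route 15) M3.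
rewrite -[sem route_block M]/(sem (PIf (Lit 1) (Cell 17 (Var 30))
   (PSeq free_demands (route 18)) PSkip) M4).
have fr1 (b k : nat) : b \notin [:: 24; 31; 24] -> M1 b k = M b k.
  exact: (@frame least_demand).
have fr2 (b k : nat) : b \notin [:: 24] -> M2 b k = M1 b k.
  exact: (@frame choose_amount).
have fr3 (b k : nat) : b \notin [:: 31; 20] -> M3 b k = M2 b k.
  exact: (@frame fixed_demands).
have fr4 (b k : nat) : b \notin writes (route 15) -> M4 b k = M3 b k.
  exact: (@frame (route 15)).
have Tb1 : tables M1 by exact: tables_frame Tb _ fr1.
have Tb2 : tables M2 by exact: tables_frame Tb1 _ fr2.
have Tb3 : tables M3 by exact: tables_frame Tb2 _ fr3.
have Tb4 : tables M4 by exact: tables_frame Tb3 _ fr4.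
have M24 : M2 24 0 = Posz (amount w).
  have E24 : M1 24 0 = Posz (least (fun l => beta I l w)).
    by apply: least_demand_spec (tb_graph Tb) (tb_rows Tb) M30 _ => l'; exact: tb_beta Tb _ _ Tw ws.
  have E30 : M1 30 0 = (rk w)%:Z%R by rewrite fr1.
  rewrite /M2 /choose_amount !sem_if.
  have -> : eval M1 (Cell 17 (Var 30)) = Posz (e2 w) by rewrite /= E30 (tb_e2 Tb1).
  have -> : eval M1 (Cell 14 (Var 30)) = Posz (e1 w) by rewrite /= E30 (tb_e1 Tb1).
  rewrite !lez_nat /amount; case: (0 < e2 w) => //=; case: (e2 w <= e1 w) => //=.
have M30' : M3 30 0 = (rk w)%:Z%R by rewrite fr3 // fr2 // fr1.
have M20 l' : M3 20 (rk l') = Posz (amount w).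
  apply: (@demands_spec (Var 24) M2 (fun=> Posz (amount w)) (tb_graph Tb2)).
  by move=> M' l2 _ fr; rewrite /= fr.
have E6 : M4 6 (rk l * m + rk a) =
    (M 6 (rk l * m + rk a)%N + Posz (amount w * count_mem a (trace I s p1 w).2))%R.
  rewrite /M4 (route_spec Gsp Ipar T1 (prd := 15) _ (tb_graph Tb3) (tb_rows Tb3) (tb_start Tb3)
    (tb_p1 Tb3) Tw e1w M30') // M20 fr3 // fr2 // fr1 //.
  by rewrite PoszM mulrC.
have M40 : M4 30 0 = (rk w)%:Z%R by rewrite fr4.
rewrite sem_if; have -> : eval M4 (Cell 17 (Var 30)) = Posz (e2 w).
  by rewrite /= M40 (tb_e2 Tb4).
rewrite lez_nat /block_flow; case: ifP => e2w; last by rewrite /= E6 addn0.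
rewrite -[sem _ M4]/(sem (route 18) (sem free_demands M4)).
set M5 := sem free_demands M4.
have fr5 (b k : nat) : b \notin [:: 31; 20] -> M5 b k = M4 b k.
  exact: (@frame free_demands).
have Tb5 : tables M5 by exact: tables_frame Tb4 _ fr5.
have M50 : M5 30 0 = (rk w)%:Z%R by rewrite fr5.
have M520 l' : M5 20 (rk l') = Posz (beta I l' w - amount w).
  apply: (@demands_spec (Minus (at_beta (Var 31) (Var 30)) (Var 24)) M4
    (fun l => Posz (beta I l w - amount w)) (tb_graph Tb4)).
  move=> M' l2 Mi fr; rewrite -[eval _ _]/(eval M' (at_beta (Var 31) (Var 30)) - M' 24 0)%R.
  have -> : eval M' (at_beta (Var 31) (Var 30)) = Posz (beta I l2 w).
    rewrite -(tb_beta Tb4 l2 Tw ws) /= Mi /= (fr 7) // (fr 30) // M40 (tb_rows Tb4 l2).1.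
    by rewrite -PoszD /= fr.
  by rewrite fr // fr4 // fr3 // M24 subzn // amount_le.
rewrite (route_spec Gsp Ipar T2 (prd := 18) _ (tb_graph Tb5) (tb_rows Tb5) (tb_start Tb5)
    (tb_p2 Tb5) Tw e2w M50) // M520 fr5 // E6.
by rewrite PoszD -addrA PoszM (PoszM (_ - _)) (mulrC (Posz (count_mem _ _))).
Qed.

Lemma output_spec M : tables M -> (forall k, M 6 k = 0%R) ->
  forall l a, sem output_flow M 6 (rk l * m + rk a) =
    Posz (\sum_(w | terminal I w && (w != s)) block_flow l w a).
Proof.
move=> Tb M6.
pose P j (M' : memory) := forall l a, M' 6 (rk l * m + rk a) =
  (\sum_(w | (rk w < j)%N) Posz (if terminal I w && (w != s) then block_flow l w a else 0))%R.
suff H : P n (sem output_flow M).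
  by move=> l a; rewrite H sum_rk_all -(big_morph Posz PoszD erefl) -big_mkcond.
apply: for_rank => [//||l a|w M' Mi fr HP l a].
- exact: gd_n (tb_graph Tb).
- by rewrite update_other // M6 big1.
- have Tb' : tables M' by exact: tables_frame Tb _ fr.
  have Ew : eval M' (Var 30) = (rk w)%:Z%R by rewrite /= Mi.
  rewrite sum_rkS update_other // sem_if_eq eval_incr Ew sem_if.
  rewrite (eval_balance0 Lpos (tb_graph Tb') Ew).
  have -> : eval M' (Cell 10 (Var 30)) = code (last_of I w) by rewrite /= Mi (tb_last Tb').
  have -> : (code (last_of I w) == (rk w)%:Z + 1)%R = terminal I w.
    by rewrite -(last_of_self Gsp Ipar) -(inj_eq (@code_inj G)) /code /= -PoszD addn1.
  have -> : (bal I (scenario0 Lpos) w <= eval M' (Lit 0))%R = (w != s).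
    by rewrite -(Isrc (scenario0 Lpos)) /=; lia.
  have -> : (if terminal I w then if w != s then sem route_block M' else sem PSkip M'
      else sem PSkip M') = if terminal I w && (w != s) then sem route_block M' else M'.
    by case: (terminal I w); case: (w != s).
  case: ifP => [/andP[Tw ws]|_]; last by rewrite add0r HP.
  by rewrite (route_block_spec Tb' Tw ws Mi) HP addrC.
Qed.
End Output.
End Verify.

(** * The computed flow as a result of the algorithm *)

Lemma nth_allpairs (S T R : Type) (f : S -> T -> R) (s : seq S) (t : seq T) x0 y0 z0 i j :
  i < size s -> j < size t ->
  nth z0 [seq f x y | x <- s, y <- t] (i * size t + j) = f (nth x0 s i) (nth y0 t j).
Proof.
elim: s i => // x s IH [|i] /= lt jt; rewrite nth_cat size_map.
  by rewrite mul0n add0n jt (nth_map y0).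
by rewrite mulSn -addnA ltnNge leq_addr /= addKn IH.
Qed.

Section Main.
Variables (G : digraph) (L : finType) (I : instance G L) (s q : verts G).
Hypothesis Gsp : sp_digraph s q.
Hypothesis Isrc : unique_source I s.
Hypothesis Ipar : parallel_sinks I.
Implicit Types (x y v w t u : verts G) (a : arcs G) (l : L) (M : memory).

Local Notation n := #|verts G|.
Local Notation m := #|arcs G|.

Lemma input_data : graph_data I (input I).
Proof.
split=> // [a|a|a|a|l v]; rewrite /input /=.
- by rewrite (nth_map a) ?nth_enum_rank // -cardE rk_lt.
- by rewrite (nth_map a) ?nth_enum_rank // -cardE rk_lt.
- by rewrite (nth_map a) ?nth_enum_rank // -cardE rk_lt.
- by rewrite (nth_map a) ?nth_enum_rank // -cardE rk_lt.
- have := @nth_allpairs _ _ _ (bal I) (enum L) (enum (verts G)) l v 0%R (rk l) (rk v).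
  by rewrite -!cardE !rk_lt !nth_enum_rank; apply.
Qed.

Lemma input_zero b k : 5 < b -> input I b k = 0%R.
Proof. by move=> b5; rewrite /input (nth_default [::]) // nth_nil. Qed.

Lemma label_tree_program_spec (Lpos : 0 < #|L|) : exists c1 e1 p1 c2 e2 p2,
  [/\ dist_tree I s setT c1 e1 p1, dist_tree I s (~: fixed I) c2 e2 p2 &
      forall l a, sem label_tree_program (input I) 6 (rk l * m + rk a) =
        Posz (\sum_(w | terminal I w && (w != s)) block_flow I s e1 e2 p1 p2 l w a)].
Proof.
set M0 := input I; set M1 := sem rows M0; set M2 := sem sink_flags M1.
set M3 := sem lasts M2; set M4 := sem start_flags M3.
set M5 := sem (dists 13 14 15 1) M4; set M6 := sem (dists 16 17 18 0) M5.
set M7 := sem betas M6.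
have Z0 (b k : nat) : 5 < b -> M0 b k = 0%R by exact: input_zero.
have fr1 (b k : nat) : b \notin writes rows -> M1 b k = M0 b k by exact: frame.
have fr2 (b k : nat) : b \notin writes sink_flags -> M2 b k = M1 b k by exact: frame.
have fr3 (b k : nat) : b \notin writes lasts -> M3 b k = M2 b k by exact: frame.
have fr4 (b k : nat) : b \notin writes start_flags -> M4 b k = M3 b k by exact: frame.
have fr5 (b k : nat) : b \notin writes (dists 13 14 15 1) -> M5 b k = M4 b k by exact: frame.
have fr6 (b k : nat) : b \notin writes (dists 16 17 18 0) -> M6 b k = M5 b k by exact: frame.
have fr7 (b k : nat) : b \notin writes betas -> M7 b k = M6 b k by exact: frame.
have D0 : graph_data I M0 by exact: input_data.
have D1 := graph_data_frame D0 (isT : all (leq 6) (writes rows)) fr1.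
have D2 := graph_data_frame D1 (isT : all (leq 6) (writes sink_flags)) fr2.
have D3 := graph_data_frame D2 (isT : all (leq 6) (writes lasts)) fr3.
have D4 := graph_data_frame D3 (isT : all (leq 6) (writes start_flags)) fr4.
have D5 := graph_data_frame D4 (isT : all (leq 6) (writes (dists 13 14 15 1))) fr5.
have D6 := graph_data_frame D5 (isT : all (leq 6) (writes (dists 16 17 18 0))) fr6.
have D7 := graph_data_frame D6 (isT : all (leq 6) (writes betas)) fr7.
have R1 : row_data G L M1 by exact: rows_spec D0 (Z0 21 0 isT) (Z0 22 0 isT).
have S2 : sink_data I M2.
  by apply: sink_flags_spec => // k; rewrite fr1 // Z0.
have H3 := lasts_spec Gsp Ipar D2 S2; rewrite -/M3 in H3.
have S4 : start_data I s M4 by exact: (start_flags_spec Gsp Isrc Ipar Lpos D3 H3).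
have Z4 (k b : nat) : 12 < b < 20 -> M4 b k = 0%R.
  move=> b12; rewrite fr4 ?fr3 ?fr2 ?fr1 ?Z0 //= ?inE; lia.
have [|a|k|c1 [e1 [p1 [T1 H5]]]] := dists_spec (cur := 13) (new := 14) (prd := 15)
    (lim := 1%R) (B := setT) Gsp _ _ D4 S4.
- by split.
- by rewrite inE; case: (a \in _).
- exact: Z4.
have [|a||k|c2 [e2 [p2 [T2 H6]]]] := dists_spec (cur := 16) (new := 17) (prd := 18)
    (lim := 0%R) (B := ~: fixed I) Gsp _ _ D5.
- by split.
- by rewrite inE; case: (a \in _).
- by move=> v; rewrite fr5.
- by rewrite fr5 // Z4.
exists c1, e1, p1, c2, e2, p2; split=> // l a.
have R6 : row_data G L M6 by move=> k; rewrite !fr6 // !fr5 // !fr4 // !fr3 // !fr2.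
have E6 v : M6 14 (rk v) = Posz (e1 v) by rewrite fr6 //; exact: (H5 v).1.
have P6 v : 0 < e1 v -> M6 15 (rk v) = (rk (p1 v))%:Z%R.
  by rewrite fr6 //; exact: (H5 v).2.
have Z6 (k : nat) : M6 19 k = 0%R by rewrite fr6 // fr5 // Z4.
have B7 := betas_spec D6 R6 Z6 E6 P6.
rewrite /label_tree_program 7!sem_seq -/M1 -/M2 -/M3 -/M4 -/M5 -/M6 -/M7.
apply: (output_spec Gsp Isrc Ipar Lpos T1 T2) => [|k]; last first.
  by rewrite fr7 // fr6 // fr5 // fr4 // fr3 // fr2 // fr1 // Z0.
split=> [|k|v|v|v|v ev|v|v ev|l' w Tw ws]; first exact: D7.
- by rewrite !fr7.
- by rewrite fr7 // fr6 // fr5.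
- by rewrite fr7 // fr6 // fr5 // fr4.
- by rewrite fr7.
- by rewrite fr7 // P6.
- by rewrite fr7 //; exact: (H6 v).1.
- by rewrite fr7 //; exact: (H6 v).2.
- by rewrite /M7 B7 (up_beta Gsp Isrc Ipar T1 l' Tw ws); apply: eq_bigr => t _; rewrite -big_distrl.
Qed.

Section Result.
Variables (c1 e1 c2 e2 : verts G -> nat) (p1 p2 : verts G -> arcs G).
Hypothesis T1 : dist_tree I s setT c1 e1 p1.
Hypothesis T2 : dist_tree I s (~: fixed I) c2 e2 p2.

(** The arcs of a path in the subgraph of a tree arc, as arcs of that subgraph. *)
Definition pull v w (l : seq (arcs G)) : seq (arcs (spanned v w)) := pmap insub l.

Lemma pull_val v w (l : seq (arcs G)) : all (inner v w) l ->
  [seq val b | b <- pull v w l] = l.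
Proof.
elim: l => //= a l IH /andP[ia il]; rewrite /pull /= insubT /=.
by rewrite -/(pull v w l) IH.
Qed.

Section TreeArc.
Variables (v w : verts G) (o t : verts (spanned v w)).
Hypotheses (vw : tree_arc I s v w) (ov : val o = v) (tw : val t = w).

Let J := sub_instance I v w.

Lemma spanned_walk (B : {set arcs G}) (l : seq (arcs (spanned v w))) :
  is_path o t l -> all (mem [set b | val b \in B]) l ->
  walk_in (tree_block I w :&: B) v w [seq val b | b <- l] /\ [seq val b | b <- l] != [::].
Proof.
case/andP=> W _ A; split; last first.
  have [[_ _ _ _ nvw] _] := tree_arcP Gsp Ipar vw.
  by apply: contra nvw; case: l W {A} => //= /eqP E _; rewrite -{1}ov E tw.
rewrite /walk_in; have := walk_val W; rewrite ov tw => -> /=; rewrite all_map.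
apply/allP=> b /(allP A) /=; rewrite !inE => ->.
by rewrite -(between_arc Gsp Ipar (val b) vw) (valP b).
Qed.

Lemma trace_shortest (B : {set arcs G}) (c e : verts G -> nat) (p : verts G -> arcs G) :
  dist_tree I s B c e p -> 0 < e w ->
  [/\ shortest_path J [set b | val b \in B] o t (pull v w (trace I s p w).2),
      [seq val b | b <- pull v w (trace I s p w).2] = (trace I s p w).2,
      all (mem (tree_block I w)) (trace I s p w).2,
      uniq (trace I s p w).2 &
      path_cost J (pull v w (trace I s p w).2) + 1 = e w].
Proof.
move=> T ew; have [[Tw ws _ _ _] _] := tree_arcP Gsp Ipar vw.
have [vw' W C] := traceP Gsp Ipar T Tw ws ew.
rewrite (tree_arc_uniq Gsp Ipar vw' vw) in W.
case/andP: W => W /allP A; set tr := (trace I s p w).2 in W A C *.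
have inn : all (inner v w) tr.
  by apply/allP=> a /A /= /[!inE]/andP[H _]; rewrite (inner_block Gsp Ipar vw) inE.
have E := pull_val inn.
have P : is_path o t (pull v w tr).
  apply: (sub_walk_path Gsp); have [|l W' El] := @walk_lift _ v w o t tr _ inn.
    by rewrite ov tw.
  by rewrite (_ : pull v w tr = l) //; apply: (inj_map val_inj); rewrite E El.
have costE (l : seq (arcs (spanned v w))) : path_cost J l = wcost (cost I) [seq val b | b <- l].
  by rewrite /wcost big_map.
split=> //; last by rewrite costE E.
- split.
    rewrite P /=; apply/allP=> b bt; rewrite /= inE.
    have : val b \in tr by rewrite -E map_f.
    by move/A; rewrite /= inE => /andP[].
  move=> l /andP[Pl Al]; have [Wl nl] := spanned_walk Pl Al.
  have sv : block_start I s v by have [[_ _ hv _ _] _] := tree_arcP Gsp Ipar vw.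
  have /andP[_] := dist_lower Gsp T Tw sv Wl nl.
  by rewrite -C leq_add2r !costE E.
- by apply/allP=> a /A /= /[!inE]/andP[].
- rewrite -E map_inj_uniq; last exact: val_inj.
  exact: is_path_uniq P.
Qed.

Lemma no_path (B : {set arcs G}) (c e : verts G -> nat) (p : verts G -> arcs G)
    (l : seq (arcs (spanned v w))) :
  dist_tree I s B c e p -> (0 < e w) = false ->
  ~~ (is_path o t l && all (mem [set b | val b \in B]) l).
Proof.
move=> T e0; apply/negP=> /andP[Pl Al]; have [Wl nl] := spanned_walk Pl Al.
have [[Tw _ sv _ _] _] := tree_arcP Gsp Ipar vw.
by have := dist_lower Gsp T Tw sv Wl nl; rewrite e0.
Qed.
End TreeArc.

Definition arc_flow v w (l : L) : arcs (spanned v w) -> nat :=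
  two_path_flow (sub_instance I v w) (fun l => beta I l w)
    (pull v w (trace I s p1 w).2)
    (if 0 < e2 w then Some (pull v w (trace I s p2 w).2) else None) l.

Arguments arc_flow : clear implicits.

Lemma arc_flow_step2 v w : tree_arc I s v w -> step2 I (arc_flow v w).
Proof.
move=> vw; have [[Tw ws _ R _] _] := tree_arcP Gsp Ipar vw.
have vb : v \in between v w by rewrite inE R reaches_refl.
have wb : w \in between v w by rewrite inE R reaches_refl.
pose o : verts (spanned v w) := Sub v vb; pose t : verts (spanned v w) := Sub w wb.
have ov : val o = v by []. have tw : val t = w by [].
have e1w : 0 < e1 w by rewrite (dist_pos Gsp T1).
exists o, t; split=> //; exists (pull v w (trace I s p1 w).2),
  (if 0 < e2 w then Some (pull v w (trace I s p2 w).2) else None); split=> //.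
  have [+ _ _ _ _] := trace_shortest vw ov tw T1 e1w.
  by congr (shortest_path _ _ _ _ _); apply/setP=> b; rewrite !inE.
have EB : ~: fixed (sub_instance I v w) = [set b | val b \in ~: fixed I].
  by apply/setP=> b; rewrite !inE.
rewrite EB; case: ifP => e2w.
  by have [] := trace_shortest vw ov tw T2 e2w.
by move=> l; apply: no_path vw ov tw _ _ _ _ _ T2 e2w.
Qed.

Lemma arc_flowE (Lpos : 0 < #|L|) v w l a : tree_arc I s v w ->
  extend (arc_flow v w l) a = block_flow I s e1 e2 p1 p2 l w a.
Proof.
move=> vw; have [[Tw ws _ R _] _] := tree_arcP Gsp Ipar vw.
have vb : v \in between v w by rewrite inE R reaches_refl.
have wb : w \in between v w by rewrite inE R reaches_refl.
pose o : verts (spanned v w) := Sub v vb; pose t : verts (spanned v w) := Sub w wb.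
have ov : val o = v by []. have tw : val t = w by [].
have e1w : 0 < e1 w by rewrite (dist_pos Gsp T1).
have [_ V1 /allP A1 U1 C1] := trace_shortest vw ov tw T1 e1w.
have free2 (e2w : 0 < e2 w) := trace_shortest vw ov tw T2 e2w.
have [ia|na] := boolP (inner v w a); last first.
  rewrite extend_out // /block_flow.
  have nb : a \notin tree_block I w by rewrite -(inner_block Gsp Ipar vw).
  rewrite (count_memPn _); last by apply: contra nb; exact: A1.
  case: ifP => [e2w|_]; last by rewrite muln0.
  have [_ _ /allP A2 _ _] := free2 e2w.
  rewrite (count_memPn _) ?muln0 //; by apply: contra nb; exact: A2.
rewrite /extend insubT /arc_flow (two_path_flowE _ _ _ _ (scenario0 Lpos)).
set b : arcs (spanned v w) := Sub a ia.
have memE (tr : seq (arcs G)) : [seq val b | b <- pull v w tr] = tr ->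
    (b \in pull v w tr) = (a \in tr).
  by move=> E; rewrite -{2}E -[a]/(val b) mem_map //; exact: val_inj.
have amountE : fixed_amount (sub_instance I v w) (fun l => beta I l w)
    (pull v w (trace I s p1 w).2)
    (if 0 < e2 w then Some (pull v w (trace I s p2 w).2) else None) = amount I e1 e2 w.
  rewrite /fixed_amount /amount /least; case: (boolP (0 < e2 w)) => //= e2w.
  have [_ _ _ _ C2] := free2 e2w; rewrite -C1 -C2 leq_add2r ltnNge.
  by case: leqP.
rewrite amountE /block_flow (memE _ V1) count_uniq_mem //.
case: ifP => e2w /=; last by rewrite muln0.
have [_ V2 _ U2 _] := free2 e2w.
by rewrite (memE _ V2) count_uniq_mem.
Qed.

Lemma sum_tree_arcs (H : verts G -> nat) :
  \sum_(e : verts G * verts G | tree_arc I s e.1 e.2) H e.2 =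
  \sum_(w | terminal I w && (w != s)) H w.
Proof.
rewrite (partition_big (fun e => e.2) (fun w => terminal I w && (w != s))) /=; last first.
  by case=> v w /= vw; have [[-> ->]] := tree_arcP Gsp Ipar vw.
apply: eq_bigr => w /andP[Tw ws]; have [v vw] := exists_tree_arc Gsp Ipar Tw ws.
rewrite (big_pred1 (v, w)) // => -[v' w'] /=; apply/andP/eqP => [[vw' /eqP E]|[-> ->] //].
by subst w'; rewrite (tree_arc_uniq Gsp Ipar vw' vw).
Qed.
End Result.
End Main.
Arguments arc_flow : clear implicits.

(** Every monomial of the running time is at most one of those on the right, as
    there are a vertex and a scenario; 2000 exceeds the sum of the
    coefficients. *)
Lemma time_label_tree_program D : 0 < D 0 -> 0 < D 2 ->
  time_bound D label_tree_program <= 2000 * D 2 * (D 0 ^ 2 + D 0 * D 1).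
Proof.
rewrite /= -mulnn; move: (D 0) (D 1) (D 2) => n m k n0 k0.
have b1 : 0 < k * (n * n) by rewrite !muln_gt0 n0 k0.
have b2 : k <= k * (n * n) by rewrite leq_pmulr // muln_gt0 n0.
have b3 : n * n <= k * (n * n) by rewrite leq_pmull.
have b4 : n * m <= k * (n * m) by rewrite leq_pmull.
have b5 : n <= n * n by rewrite leq_pmulr.
have b6 : m <= n * m by rewrite leq_pmull.
have b7 : k * n <= k * (n * n) by rewrite leq_mul2l b5 orbT.
lia.
Qed.

Theorem theorem4 :
  exists (P : cmd) (C : nat),
    forall (G : digraph) (L : finType) (I : instance G L) (s q : verts G),
      0 < #|L| ->
      sp_digraph s q ->
      balanced I ->
      unique_source I s ->
      parallel_sinks I ->
      (exists f : L -> arcs G -> nat,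
         label_tree_result I s f /\
         computes_within P I f
           (C * #|L| * (#|verts G| ^ 2 + #|verts G| * #|arcs G|))) /\
      (feasible I ->
         (forall (v w : verts G) (f : L -> arcs (spanned v w) -> nat),
            tree_arc I s v w -> step2 I f ->
            scenariowise_optimal (sub_instance I v w) f) /\
         (forall f : L -> arcs G -> nat,
            label_tree_result I s f -> optimal I f)).
Proof.
exists (compile label_tree_program), 2000 => G L I s q Lpos Gsp Ibal Isrc Ipar; split; last first.
  move=> feas; split=> [v w f vw st|f res].
    exact: (sub_optimal (scenario0 Lpos) Gsp Isrc Ipar Ibal vw feas st).
  exact: (label_tree_optimal (scenario0 Lpos) Gsp Isrc Ipar Ibal feas res).
have [c1 [e1 [p1 [c2 [e2 [p2 [T1 T2 out]]]]]]] := label_tree_program_spec Gsp Isrc Ipar Lpos.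
exists (fun l a => \sum_(e : verts G * verts G | tree_arc I s e.1 e.2)
  extend (arc_flow G L I s e2 p1 p2 e.1 e.2 l) a); split.
  exists (arc_flow G L I s e2 p1 p2); split=> // v w; exact: (arc_flow_step2 Gsp Ipar T1 T2).
have D := input_data I.
have [||t E Tt] := @exec_compile label_tree_program (input I).
- by [].
- by case=> [|[|[|j]]]; rewrite ?(gd_n D) ?(gd_m D) ?(gd_k D) //= /input /= ?nth_nil.
exists t, (sem label_tree_program (input I)); split=> //.
  move=> l a; rewrite out; congr Posz; rewrite -(sum_tree_arcs Gsp Ipar).
  by apply: eq_bigr => -[v w] /= vw; rewrite (arc_flowE Gsp Ipar T1 T2 Lpos).
apply: leq_trans Tt _; have := @time_label_tree_program (fun d => `|input I 0 d|%N).
rewrite (gd_n D) (gd_m D) (gd_k D) !absz_nat; apply=> //.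
by apply/card_gt0P; exists s.
Qed.
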